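(* Let $1<p<\infty$, $\eta>-1$. Suppose that $W$ and $V$ are operator weights on a nonzero separable Hilbert space $\mathcal H$, both satisfying the standing assumptions, which agree on $\{z:r<|z|<1\}$ for some $0<r<1$. Then $P_\eta$ is bounded on $L^p(W)$ if and only if it is bounded on $L^p(V)$. More precisely, \[ \|P_\eta\|_{L^p(W)\to L^p(W)}\le\|P_\eta\|_{L^p(V)\to L^p(V)}+2(1-r)^{-\eta-2}C_+(W)C_-(W), \] whenever the norm on the right is finite. The averaging characteristic $[W]_{\mathbf B_p^{\rm av}(\eta)}$ is finite if and only if $[V]_{\mathbf B_p^{\rm av}(\eta)}$ is finite.
   Context: Measure. $\mathbb D$ is the open unit disc, $dA$ is area measure normalized so that $A(\mathbb D)=1$, and $d\mu_\eta(z)=(\eta+1)(1-|z|^2)^\eta\,dA(z)$. Put $p'=p/(p-1)$. Standing assumptions on a weight $W$ on a nonzero separable complex Hilbert space $\mathcal H$: for almost every $z\in\mathbb D$, $W(z)$ is a positive, boundedly invertible bounded operator on $\mathcal H$; $z\mapsto W(z)e$ is strongly measurable for every $e\in\mathcal H$; and for every $e\in\mathcal H$, $\int_{\mathbb D}\|W^{1/p}e\|^p\,d\mu_\eta<\infty$ and $\int_{\mathbb D}\|W^{-1/p}e\|^{p'}\,d\mu_\eta<\infty$. $L^p(W)$ is the space of (a.e. classes of) strongly measurable $f:\mathbb D\to\mathcal H$ with $\|f\|_{L^p(W)}^p=\int_{\mathbb D}\|W(z)^{1/p}f(z)\|^p\,d\mu_\eta(z)<\infty$. Constants. \[ C_+(W)=\sup_{\|e\|=1}\Big(\int_{\mathbb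 D}\|W^{1/p}e\|^p\,d\mu_\eta\Big)^{1/p},\qquad C_-(W)=\sup_{\|e\|=1}\Big(\int_{\mathbb D}\|W^{-1/p}e\|^{p'}\,d\mu_\eta\Big)^{1/p'}; \] these are finite under the standing assumptions. Carleson squares and averages. Arc length on $\partial\mathbb D$ is normalized so that $|\partial\mathbb D|=1$. For an arc $I\subset\partial\mathbb D$ with $0<|I|\le1$, $S(I)=\{re^{it}:e^{it}\in I,\ 1-|I|<r<1\}$; $S(\partial\mathbb D)=\mathbb D$ (up to a null set) is included. For a Carleson square $S$, $E_Sf=\mathbf 1_S v$ with $v\in\mathcal H$ the weak average: $\langle v,h\rangle=\frac1{\mu_\eta(S)}\int_S\langle f,h\rangle\,d\mu_\eta$ for all $h\in\mathcal H$. Then $[W]_{\mathbf B_p^{\rm av}(\eta)}=\sup_S\|E_S\|_{L^p(W)\to L^p(W)}^p$. Bergman projection. $P_\eta f(z)=\int_{\mathbb D}\frac{f(\zeta)}{(1-\overline\zeta z)^{\eta+2}}\,d\mu_\eta(\zeta)$, where the power is the analytic branch equal to $1$ at $z=0$, defined as a Bochner integral on the dense subspace $\{W^{-1/p}F: F\text{ a bounded, compactly supported, finite-valued simple }\mathcal H\text{-valued function}\}$ of $L^p(W)$. Boundedness on $L^p(W)$, and the operator norm, refer to the unique bounded extension to $L^p(W)$. *)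

(* Defs.v *)
(* MathComp and MathComp-Analysis; R[i] is [complex] of real-closed. Points of
   the plane are pairs R * R, so that planar Lebesgue measure is a product. *)
From HB Require Import structures.
From mathcomp Require Import all_boot all_order all_algebra.
From mathcomp Require Import complex.
From mathcomp Require Import all_classical all_reals all_analysis. 
From mathcomp Require Import measurable_realfun.

Set Implicit Arguments.
Unset Strict Implicit.
Unset Printing Implicit Defensive.

Import Order.TTheory GRing.Theory Num.Theory numFieldNormedType.Exports.

Local Open Scope classical_set_scope.
Local Open Scope ring_scope.
Local Open Scope complex_scope.

Section Disc.
Context {R : realType}.

Definition cplx (z : R * R) : R[i] := z.1 +i* z.2.

Definition cabs (w : R[i]) : R := complex.Re `|w|.

Definition unit_disc : set (R * R) := [set z | cabs (cplx z) < 1].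

Definition expi (t : R) : R[i] := cos t +i* sin t.

(* [w ^ s] for [Re w > 0], with argument [atan (Im w / Re w)]: the analytic
   branch on the right half-plane that is positive on the positive reals. *)
Definition cpowr (w : R[i]) (s : R) : R[i] :=
  (cabs w `^ s)%:C * expi (s * atan (complex.Im w / complex.Re w)).

(* [Re (1 - conj zeta * z) > 0] for z, zeta in the disc, and the branch is 1
   at z = 0. *)
Definition bergman_kernel (eta : R) (z zeta : R * R) : R[i] :=
  (cpowr (1 - (cplx zeta)^* * cplx z) (eta + 2))^-1.

(* [dA = dx dy / pi], so that the disc has area 1. *)
Definition disc_density (eta : R) (z : R * R) : R :=
  (eta + 1) * (1 - cabs (cplx z) ^+ 2) `^ eta / pi.

(* The argument [-1 < eta] makes the density nonnegative, so that [mu_eta] is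
   a measure; it is a measure on the plane, carried by the disc. *)
Definition mu_eta (eta : R) of -1 < eta : set (R * R) -> \bar R :=
  fun A => (\int[lebesgue_measure \x lebesgue_measure]_(z in A `&` unit_disc)
              (disc_density eta z)%:E)%E.

Lemma measurable_cabs_cplx :
  measurable_fun [set: R * R] (fun z => cabs (cplx z)).
Proof.
apply: (measurableT_comp (continuous_measurable_fun (@sqrt_continuous R))).
by apply: measurable_funD; apply: measurable_funX;
  [exact: measurable_fst | exact: measurable_snd].
Qed.

Lemma measurable_unit_disc : measurable unit_disc.
Proof.
rewrite -[unit_disc]setTI.
have := measurable_cabs_cplx measurableT (measurable_itv `]-oo, 1[%R).
by congr (measurable _); apply/seteqP; split => z /=; rewrite in_itv.
Qed.

Lemma measurable_disc_density eta :
  measurable_fun [set: R * R] (disc_density eta).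
Proof.
apply: measurable_funM => //; apply: measurable_funM => //.
apply: (measurableT_comp (measurable_powR eta)).
apply: measurable_funB => //.
by apply: measurable_funX; exact: measurable_cabs_cplx.
Qed.

Section MuEtaMeasure.
Variables (eta : R) (heta : -1 < eta).

Let disc_density_ge0 z : 0 <= disc_density eta z.
Proof.
by rewrite mulr_ge0 ?invr_ge0 ?pi_ge0// mulr_ge0 ?powR_ge0// -lerBlDr sub0r ltW.
Qed.

Let mu_eta0 : mu_eta heta set0 = 0%E.
Proof. by rewrite /mu_eta set0I integral_set0. Qed.

Let mu_eta_ge0 A : (0 <= mu_eta heta A)%E.
Proof. by apply: integral_ge0 => z _; rewrite lee_fin disc_density_ge0. Qed.

Let mu_eta_sigma_additive : semi_sigma_additive (mu_eta heta).
Proof.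
move=> A mA tA mUA; rewrite /mu_eta setI_bigcupl ge0_integral_bigcup //=.
- apply: is_cvg_nneseries => n _ _.
  by apply: integral_ge0 => z _; rewrite lee_fin disc_density_ge0.
- move=> n; exact: (measurableI _ _ (mA n) measurable_unit_disc).
- apply: measurable_funTS; apply/measurable_EFinP.
  exact: measurable_disc_density.
- by move=> z _; rewrite lee_fin disc_density_ge0.
- exact: trivIset_setIr.
Qed.

HB.instance Definition _ := isMeasure.Build _ _ _
  (mu_eta heta) mu_eta0 mu_eta_ge0 mu_eta_sigma_additive.

End MuEtaMeasure.

(* Arcs of normalized length l, with or without their endpoints; for l = 1 this
   includes the full circle. *)
Definition is_arc (l : R) (I : set R[i]) : Prop :=
  exists a : R,
    [set expi t | t in [set t | a < t < a + 2 * pi * l]] `<=` I /\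
    I `<=` [set expi t | t in [set t | a <= t <= a + 2 * pi * l]].

Definition carleson_square (l : R) (I : set R[i]) : set (R * R) :=
  [set z | exists rho : R, exists2 u : R[i],
     I u & 1 - l < rho < 1 /\ cplx z = rho%:C * u].

Definition carleson_squares : set (set (R * R)) :=
  [set S | exists l : R, exists2 I : set R[i],
     0 < l <= 1 & is_arc l I /\ S = carleson_square l I].

End Disc.

Section Hilbert.
Context {R : realType} {H : completeNormedModType R[i]}.

(* The inner product [dot] (linear in its first argument) induces the norm of
   H; together with completeness, H is a Hilbert space. *)
Definition hilbert_dot (dot : {dot H for Num.conj}) : Prop :=
  forall x, `|x| ^+ 2 = dot x x.

Definition separable : Prop := exists2 D : set H, countable D & dense D.

(* Norms in H take values in R[i]; [hnorm] is the same norm as a real. *)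
Definition hnorm (x : H) : R := complex.Re `|x|.

Definition bounded_op (A : H -> H) : Prop :=
  linear A /\ exists M : R, forall x, hnorm (A x) <= M * hnorm x.

Definition boundedly_invertible (A : H -> H) : Prop :=
  exists2 B : H -> H, bounded_op B & cancel A B /\ cancel B A.

Definition positive_op (dot : {dot H for Num.conj}) (A : H -> H) : Prop :=
  forall x, 0 <= dot (A x) x.

Definition spectrum (A : H -> H) : set R[i] :=
  [set l | ~ boundedly_invertible (fun x => A x - l *: x)].

Definition poly_op (q : {poly R}) (A : H -> H) (x : H) : H :=
  \sum_(k < size q) (q`_k)%:C *: iter k A x.

(* Continuous functional calculus of a self-adjoint operator A (whose spectrum
   is real): B = f(A) is the operator-norm limit of q_n(A) for polynomials q_n
   converging to f uniformly on the spectrum of A. *)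
Definition is_fun_calculus (A : H -> H) (f : R -> R) (B : H -> H) : Prop :=
  bounded_op B /\
  exists q : nat -> {poly R},
    (forall e : R, 0 < e -> \forall n \near \oo,
       forall x : R, spectrum A x%:C -> `|(q n).[x] - f x| <= e) /\
    (forall e : R, 0 < e -> \forall n \near \oo,
       forall u : H, hnorm (poly_op (q n) A u - B u) <= e * hnorm u).

(* A^s, meaningful for A positive and boundedly invertible. *)
Definition op_pow (A : H -> H) (s : R) : H -> H :=
  xget (fun=> 0) [set B : H -> H | is_fun_calculus A (fun x => x `^ s) B].

Section BochnerIntegral.
Context {d : measure_display} {T : measurableType d}.
Variable mu : {measure set T -> \bar R}.

Definition simple_fun (s : T -> H) : Prop :=
  finite_set (range s) /\ forall v, measurable (s @^-1` [set v]).

Definition strongly_measurable (f : T -> H) : Prop :=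
  exists2 s : nat -> T -> H, (forall n, simple_fun (s n)) &
    {ae mu, forall z, s n z @[n --> \oo] --> f z}.

Definition simple_integral (s : T -> H) : H :=
  \sum_(v \in range s) (fine (mu (s @^-1` [set v])))%:C *: v.

(* For a finite measure mu. *)
Definition is_bochner_integral (f : T -> H) (v : H) : Prop :=
  strongly_measurable f /\
  exists2 s : nat -> T -> H, (forall n, simple_fun (s n)) &
    (\int[mu]_z (hnorm (f z - s n z))%:E @[n --> \oo] --> 0)%E /\
    simple_integral (s n) @[n --> \oo] --> v.

Definition bochner_integral (f : T -> H) : H :=
  xget 0 [set v | is_bochner_integral f v].

Definition complex_integral (D : set T) (g : T -> R[i]) : R[i] :=
  (\int[mu]_(z in D) complex.Re (g z)) +i* (\int[mu]_(z in D) complex.Im (g z)).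

End BochnerIntegral.

Section Weights.
Variables (dot : {dot H for Num.conj}) (p eta : R) (heta : -1 < eta).

Local Notation mu := (mu_eta heta).
Local Notation p' := (p / (p - 1)).

Definition operator_weight (W : R * R -> H -> H) : Prop :=
  [/\ {ae mu, forall z, [/\ bounded_op (W z), positive_op dot (W z) &
                            boundedly_invertible (W z)]},
      forall e, strongly_measurable mu (fun z => W z e),
      forall e,
        (\int[mu]_z (hnorm (op_pow (W z) p^-1 e) `^ p)%:E < +oo)%E &
      forall e,
        (\int[mu]_z (hnorm (op_pow (W z) (- p^-1) e) `^ p')%:E < +oo)%E].

Definition LpW_norm (W : R * R -> H -> H) (f : R * R -> H) : \bar R :=
  ((\int[mu]_z (hnorm (op_pow (W z) p^-1 (f z)) `^ p)%:E) `^ p^-1)%E.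

Definition in_LpW (W : R * R -> H -> H) (f : R * R -> H) : Prop :=
  strongly_measurable mu f /\ (LpW_norm W f < +oo)%E.

(* Norm of an operator L^p(W) -> L^p(W), +oo if it is unbounded. *)
Definition LpW_opnorm (W : R * R -> H -> H)
    (T : (R * R -> H) -> R * R -> H) : \bar R :=
  ereal_inf [set c%:E | c in [set c : R | 0 <= c /\
    forall f, in_LpW W f ->
      in_LpW W (T f) /\ (LpW_norm W (T f) <= c%:E * LpW_norm W f)%E]].

Definition C_plus (W : R * R -> H -> H) : \bar R :=
  ereal_sup [set ((\int[mu]_z (hnorm (op_pow (W z) p^-1 e) `^ p)%:E)
                    `^ p^-1)%E | e in [set e : H | hnorm e = 1]].

Definition C_minus (W : R * R -> H -> H) : \bar R :=
  ereal_sup [set ((\int[mu]_z (hnorm (op_pow (W z) (- p^-1) e) `^ p')%:E)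
                    `^ p'^-1)%E | e in [set e : H | hnorm e = 1]].

Definition weak_average (S : set (R * R)) (f : R * R -> H) : H :=
  xget 0 [set v | forall h, dot v h =
    ((fine (mu S))^-1)%:C * complex_integral mu S (fun z => dot (f z) h)].

Definition averaging (S : set (R * R)) (f : R * R -> H) (z : R * R) : H :=
  if z \in S then weak_average S f else 0.

Definition Bp_av (W : R * R -> H -> H) : \bar R :=
  ereal_sup [set (LpW_opnorm W (averaging S) `^ p)%E | S in carleson_squares].

Definition bergman (f : R * R -> H) (z : R * R) : H :=
  bochner_integral mu (fun zeta => bergman_kernel eta z zeta *: f zeta).

(* Finite-valued functions are automatically bounded. *)
Definition bergman_domain (W : R * R -> H -> H) : set (R * R -> H) :=
  [set f | exists2 F : R * R -> H,
     simple_fun F /\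
     (exists K : set (R * R), [/\ compact K, K `<=` unit_disc &
        forall z, ~ K z -> F z = 0]) &
     f = fun z => op_pow (W z) (- p^-1) (F z)].

(* T, a linear operator on the classes of L^p(W), extends the Bergman
   projection from its dense domain. *)
Definition bergman_extension (W : R * R -> H -> H)
    (T : (R * R -> H) -> R * R -> H) : Prop :=
  [/\ forall f, in_LpW W f -> in_LpW W (T f),
      forall f g, in_LpW W f -> in_LpW W g ->
        {ae mu, forall z, f z = g z} -> {ae mu, forall z, T f z = T g z},
      forall (a : R[i]) f g, in_LpW W f -> in_LpW W g ->
        {ae mu, forall z, T (fun z => a *: f z + g z) z = a *: T f z + T g z} &
      forall f, bergman_domain W f -> {ae mu, forall z, T f z = bergman f z}].

Definition bergman_bounded (W : R * R -> H -> H) : Prop :=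
  exists2 T, bergman_extension W T & (LpW_opnorm W T < +oo)%E.

(* The bounded extension being unique, the infimum runs over its norm only;
   it is +oo when there is no bounded extension. *)
Definition bergman_norm (W : R * R -> H -> H) : \bar R :=
  ereal_inf [set LpW_opnorm W T | T in bergman_extension W].

End Weights.

End Hilbert.

Arguments separable {R} H.

(* Main.v *)
(* If [|z| <= r] or [|zeta| <= r], then [|z| * |zeta| <= r] on the disc, and the
   binomial expansion [sum_k c_k z^k (conj zeta)^k] of the Bergman kernel
   converges uniformly. Pairing [W^(1/p) f] with [W^(-1/p) h] (Hoelder) bounds the
   moments [int (conj zeta)^k f] by [C_-(W) ||f||], and [z^k] times a fixed vector
   [v] has norm at most [C_+(W) |v|]; for the kernel restricted to
   [|zeta| <= r < |z|], and to [|z| <= r], one factor [r^k] survives, so that each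
   of these two operators has norm at most
   [sum_k c_k r^k C_+(W) C_-(W) <= (1 - r)^(-eta-2) C_+(W) C_-(W)]. What is left
   of the projection lives on [r < |z|, r < |zeta|], where W and V agree.
   Likewise Carleson squares of side at most [1 - r] do not see the difference
   between W and V, and averaging over a larger square [S] has norm at most
   [C_+(W) C_-(W) / mu(S)], with [mu(S)] bounded below. *)
Require Import Defs.
From mathcomp Require Import all_boot all_order all_algebra.
From mathcomp Require Import complex.
From mathcomp Require Import all_classical all_reals all_analysis.
From mathcomp Require Import measurable_realfun ring lra.
Set Implicit Arguments.
Unset Strict Implicit.
Unset Printing Implicit Defensive.
Import Order.TTheory GRing.Theory Num.Theory numFieldNormedType.Exports.
Local Open Scope classical_set_scope.
Local Open Scope ring_scope.
Local Open Scope complex_scope.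

(** * Complex numbers and the norm of H *)

Section ComplexBasics.
Context {R : realType}.
Implicit Types (w v : R[i]) (x y : R).

(** Two features of the definitions shape the proof. First, [op_pow] is a choice among limits of
    unspecified polynomials. That such a limit exists, does not depend on the choice, is inverted by
    the opposite power and is strongly measurable in [z] has to be proved. This rests on bounding
    the norm of a polynomial in a symmetric operator by its values on the spectrum, and on a single
    sequence of polynomials that serves every positive invertible operator at once, so that
    [z |-> W(z)^s e] is a limit of strongly measurable functions. Secondly, a function in [L^p(W)]
    is integrable only when paired with a fixed vector; its norm in [H] need not be. The kernel
    integrals are therefore taken weakly, through Riesz representation, and identified with Bochner
    integrals on the dense domain. Likewise the standing assumptions speak of one vector at a time,
    and a uniform boundedness argument makes [C_+] and [C_-] finite. *)

Lemma cabsE w : cabs w = Num.sqrt (complex.Re w ^+ 2 + complex.Im w ^+ 2).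
Proof. by rewrite /cabs normc_def. Qed.

Lemma normcabs w : `|w| = (cabs w)%:C.
Proof. by rewrite cabsE normc_def. Qed.

Lemma cabs_ge0 w : 0 <= cabs w.
Proof. by rewrite cabsE sqrtr_ge0. Qed.

Lemma cabs_sqr w : cabs w ^+ 2 = complex.Re w ^+ 2 + complex.Im w ^+ 2.
Proof. by rewrite cabsE sqr_sqrtr// addr_ge0 ?sqr_ge0. Qed.

Lemma cabs0 : cabs (0 : R[i]) = 0.
Proof. by rewrite /cabs normr0. Qed.

Lemma cabs1 : cabs (1 : R[i]) = 1.
Proof. by rewrite /cabs normr1. Qed.

Lemma cabsM w v : cabs (w * v) = cabs w * cabs v.
Proof. by apply: complexI; rewrite rmorphM /= -!normcabs normrM. Qed.

Lemma cabsX w n : cabs (w ^+ n) = cabs w ^+ n.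
Proof. by elim: n => [|n IH]; rewrite ?expr0 ?cabs1// !exprS cabsM IH. Qed.

Lemma cabsD w v : cabs (w + v) <= cabs w + cabs v.
Proof. by rewrite -lecR rmorphD /= -!normcabs ler_normD. Qed.

Lemma cabsR x : cabs x%:C = `|x|.
Proof. by rewrite cabsE /= expr0n addr0 sqrtr_sqr. Qed.

Lemma cabsJ w : cabs w^* = cabs w.
Proof. by rewrite !cabsE; case: w => a b /=; rewrite sqrrN. Qed.

Lemma ge_Re w : `|complex.Re w| <= cabs w.
Proof. by rewrite -sqrtr_sqr cabsE ler_wsqrtr// lerDl sqr_ge0. Qed.

Lemma ge_Im w : `|complex.Im w| <= cabs w.
Proof. by rewrite -sqrtr_sqr cabsE ler_wsqrtr// lerDr sqr_ge0. Qed.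

Lemma cabs_le w : cabs w <= `|complex.Re w| + `|complex.Im w|.
Proof.
rewrite -ler_sqr ?nnegrE ?addr_ge0 ?cabs_ge0// cabs_sqr sqrrD !real_normK ?num_real//.
by rewrite addrAC lerDl mulrn_wge0// mulr_ge0.
Qed.

Lemma conjCE w : Num.conj w = w^*.
Proof. by []. Qed.

End ComplexBasics.

Section HilbertBasics.
Context {R : realType} {H : completeNormedModType R[i]}.
Implicit Types (x y z : H) (a : R[i]).

Lemma normhE x : `|x| = (hnorm x)%:C.
Proof.
by rewrite /hnorm; have /ger0_Im := normr_ge0 x; case: `|x| => a b /= ->.
Qed.

Lemma hnorm_ge0 x : 0 <= hnorm x.
Proof. by rewrite -ler0c -normhE. Qed.

Lemma hnorm0 : hnorm (0 : H) = 0.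
Proof. by rewrite /hnorm normr0. Qed.

Lemma hnorm_eq0 x : (hnorm x == 0) = (x == 0).
Proof. by rewrite -[RHS]normr_eq0 normhE eq_complex /= eqxx andbT. Qed.

Lemma hnorm_gt0 x : (0 < hnorm x) = (x != 0).
Proof. by rewrite lt_def hnorm_ge0 andbT hnorm_eq0. Qed.

Lemma hnormD x y : hnorm (x + y) <= hnorm x + hnorm y.
Proof. by rewrite -lecR rmorphD /= -!normhE ler_normD. Qed.

Lemma hnormN x : hnorm (- x) = hnorm x.
Proof. by rewrite /hnorm normrN. Qed.

Lemma hnormBC x y : hnorm (x - y) = hnorm (y - x).
Proof. by rewrite -hnormN opprB. Qed.

Lemma hnormB x y : hnorm (x - y) <= hnorm x + hnorm y.
Proof. by rewrite -(hnormN y) hnormD. Qed.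

Lemma hnorm_tri z x y : hnorm (x - y) <= hnorm (x - z) + hnorm (z - y).
Proof. by rewrite (le_trans _ (hnormD _ _))// addrA subrK. Qed.

Lemma hnorm_dist x y : `|hnorm x - hnorm y| <= hnorm (x - y).
Proof.
rewrite ler_norml lerBlDr; apply/andP; split; last by rewrite -{1}(subrK y x) hnormD.
by rewrite lerNl opprB lerBlDr hnormBC -{1}(subrK x y) hnormD.
Qed.

Lemma hnormZ a x : hnorm (a *: x) = cabs a * hnorm x.
Proof. by apply: complexI; rewrite rmorphM /= -!normhE -normcabs normrZ. Qed.

Lemma hnormZR (t : R) x : hnorm (t%:C *: x) = `|t| * hnorm x.
Proof. by rewrite hnormZ cabsR. Qed.

(** The norm of [H] lies in [R[i]], so the radii of neighbourhoods are positive elements of [R[i]].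
    These are real, which lets every later limit be checked with real radii. *)
Lemma cvg_hnormP (T : Type) (F : set_system T) {FF : Filter F} (u : T -> H) x :
  u @ F --> x <-> hnorm (u t - x) @[t --> F] --> (0 : R).
Proof.
split => [/cvgrPdist_lt h|/cvgrPdist_lt h]; apply/cvgrPdist_lt => e e0.
  have := h e%:C; rewrite ltcR => /(_ e0); apply: filterS => t.
  by rewrite normhE ltcR sub0r normrN ger0_norm ?hnorm_ge0// hnormBC.
have e0' : (0 : R[i]) < e by [].
have eE : e = (complex.Re e)%:C by have /gtr0_real/RRe_real := e0.
move: e0; rewrite eE ltcR => /h; apply: filterS => t.
by rewrite normhE ltcR sub0r normrN ger0_norm ?hnorm_ge0// hnormBC.
Qed.

Lemma cvg_hnorm (T : Type) (F : set_system T) {FF : Filter F} (u : T -> H) x :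
  u @ F --> x -> hnorm (u t) @[t --> F] --> hnorm x.
Proof.
move=> /cvg_hnormP/cvgrPdist_lt h; apply/cvgrPdist_lt => e /h.
apply: filterS => t; rewrite sub0r normrN ger0_norm ?hnorm_ge0//.
by apply: le_lt_trans; rewrite distrC hnorm_dist.
Qed.

Lemma hcauchy_eps (u : nat -> H) :
  (forall e, 0 < e -> exists N, forall n, (N <= n)%N -> hnorm (u n - u N) < e) ->
  exists v : H, u @ \oo --> v.
Proof.
move=> ub; apply/cvg_ex; apply/cauchy_cvgP/cauchy_ballP => e e0.
have eE : e = (complex.Re e)%:C by have /gtr0_real/RRe_real := e0.
have e2 : 0 < complex.Re e / 2 by rewrite divr_gt0// -ltcR -eE.
have [N hN] := ub _ e2.
exists ([set x | hnorm (x - u N) < complex.Re e / 2],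
        [set x | hnorm (x - u N) < complex.Re e / 2]).
  by split; exists N.
move=> [x y] [/= hx hy]; rewrite -ball_normE /= normhE eE ltcR.
rewrite (le_lt_trans (hnorm_tri (u N) _ _))// [ltRHS]splitr ltrD//.
by rewrite hnormBC.
Qed.

Lemma hcauchy (u : nat -> H) (b : nat -> R) :
  (forall n m, (n <= m)%N -> hnorm (u m - u n) <= b n) ->
  b @ \oo --> (0 : R) -> exists v : H, u @ \oo --> v.
Proof.
move=> ub /cvgrPdist_lt b0; apply: hcauchy_eps => e /b0 [N _ hN].
exists N => n Nn; apply: le_lt_trans (ub _ _ Nn) _; apply: le_lt_trans (hN N _) => //=.
by rewrite sub0r normrN ler_norm.
Qed.

End HilbertBasics.

Lemma ReD {R : realType} (w v : R[i]) :
  complex.Re (w + v) = complex.Re w + complex.Re v.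
Proof. by case: w; case: v. Qed.

Lemma ImD {R : realType} (w v : R[i]) :
  complex.Im (w + v) = complex.Im w + complex.Im v.
Proof. by case: w; case: v. Qed.

Lemma ReN {R : realType} (w : R[i]) : complex.Re (- w) = - complex.Re w.
Proof. by case: w. Qed.

Lemma ReM {R : realType} (w v : R[i]) : complex.Re (w * v) =
  complex.Re w * complex.Re v - complex.Im w * complex.Im v.
Proof. by case: w; case: v. Qed.

Lemma ImM {R : realType} (w v : R[i]) : complex.Im (w * v) =
  complex.Re w * complex.Im v + complex.Im w * complex.Re v.
Proof. by case: w; case: v. Qed.

Lemma cvg_dist_le {R : realType} (T : Type) (F : set_system T) {FF : Filter F}
    (f g : T -> R) (l : R) :
  (\forall t \near F, `|f t - l| <= g t) -> g t @[t --> F] --> (0 : R) ->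
  f t @[t --> F] --> l.
Proof.
move=> fg /cvgrPdist_lt g0; apply/cvgrPdist_lt => e /g0.
apply: filterS2 fg => t; rewrite sub0r normrN distrC => h.
by apply: le_lt_trans; apply: le_trans h (ler_norm _).
Qed.

(** * The real part of the inner product and Riesz representation *)

Section RealInnerProduct.
Context {R : realType} {H : completeNormedModType R[i]}.
Variable dot : {dot H for Num.conj}.
Hypothesis hdot : hilbert_dot dot.
Implicit Types (x y z h : H) (a : R[i]) (t : R).

(** A real inner product with the same norm. Nothing is lost: [Im_dot] recovers the imaginary part
    by rotating the second argument by ['i]. Pairings can thus be integrated as real functions. *)
Definition rdot x y : R := complex.Re (dot x y).

Lemma dotC x y : dot x y = (dot y x)^*.
Proof. by have := @hermitian_subproof _ _ _ _ dot x y; rewrite expr0 mul1r. Qed.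

Lemma rdotC x y : rdot x y = rdot y x.
Proof. by rewrite /rdot dotC; case: (dot y x). Qed.

Lemma rdotDl x y z : rdot (x + y) z = rdot x z + rdot y z.
Proof. by rewrite /rdot linearDl ReD. Qed.

Lemma rdotDr x y z : rdot x (y + z) = rdot x y + rdot x z.
Proof. by rewrite rdotC rdotDl !(rdotC x). Qed.

Lemma rdotZl t x y : rdot (t%:C *: x) y = t * rdot x y.
Proof. by rewrite /rdot linearZl_LR /= ReM /= mul0r subr0. Qed.

Lemma rdotZr t x y : rdot x (t%:C *: y) = t * rdot x y.
Proof. by rewrite rdotC rdotZl rdotC. Qed.

Lemma rdotZJ a x y : rdot (a *: x) y = rdot x (a^* *: y).
Proof.
by rewrite /rdot linearZl_LR linearZr_LR /= conjCE conjcK.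
Qed.

Lemma rdotNl x y : rdot (- x) y = - rdot x y.
Proof. by rewrite /rdot linearNl ReN. Qed.

Lemma rdotNr x y : rdot x (- y) = - rdot x y.
Proof. by rewrite rdotC rdotNl rdotC. Qed.

Lemma rdotBl x y z : rdot (x - y) z = rdot x z - rdot y z.
Proof. by rewrite rdotDl rdotNl. Qed.

Lemma rdot0l x : rdot 0 x = 0.
Proof. by rewrite -(subrr x) rdotBl subrr. Qed.

Lemma rdotxx x : rdot x x = hnorm x ^+ 2.
Proof. by rewrite /rdot -hdot normhE -rmorphXn. Qed.

Lemma Im_dot x y : complex.Im (dot x y) = rdot x ('i *: y).
Proof.
by rewrite /rdot linearZr_LR /= conjCE ReM /= mul0r mulN1r opprK add0r.
Qed.

Lemma hnorm_sqrD x y :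
  hnorm (x + y) ^+ 2 = hnorm x ^+ 2 + 2 * rdot x y + hnorm y ^+ 2.
Proof. by rewrite -!rdotxx rdotDl !rdotDr (rdotC y x); ring. Qed.

Lemma hnorm_sqrB x y :
  hnorm (x - y) ^+ 2 = hnorm x ^+ 2 - 2 * rdot x y + hnorm y ^+ 2.
Proof. by rewrite hnorm_sqrD hnormN rdotNr; ring. Qed.

Lemma rdot_CS x y : `|rdot x y| <= hnorm x * hnorm y.
Proof.
have [->|x0] := eqVneq x 0; first by rewrite rdot0l hnorm0 normr0 mul0r.
have nx : 0 < hnorm x by rewrite hnorm_gt0.
rewrite -ler_sqr ?nnegrE ?mulr_ge0 ?hnorm_ge0// real_normK ?num_real//.
have := sqr_ge0 (hnorm (((hnorm x) ^+ 2)%:C *: y - (rdot x y)%:C *: x)).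
rewrite hnorm_sqrB !hnormZR !exprMn !real_normK ?num_real// rdotZl rdotZr.
rewrite (rdotC y x) => h.
have : 0 <= hnorm x ^+ 2 * ((hnorm x * hnorm y) ^+ 2 - rdot x y ^+ 2).
  by apply: le_trans h _; rewrite le_eqVlt; apply/orP; left; apply/eqP; ring.
by rewrite pmulr_rge0 ?exprn_gt0// subr_ge0 exprMn.
Qed.

Lemma rdot_ge x y : rdot x y <= hnorm x * hnorm y.
Proof. exact: le_trans (ler_norm _) (rdot_CS _ _). Qed.

Lemma rdot_ext x y : (forall h, rdot x h = rdot y h) -> x = y.
Proof.
move=> e; apply/eqP; rewrite -subr_eq0 -hnorm_eq0 -sqrf_eq0 -rdotxx.
by rewrite rdotBl e subrr.
Qed.

Lemma hnorm_le_rdot x (C : R) : 0 <= C ->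
  (forall h, rdot x h <= C * hnorm h) -> hnorm x <= C.
Proof.
move=> C0 /(_ x); rewrite rdotxx expr2.
have [->|x0] := eqVneq x 0; first by rewrite hnorm0.
by rewrite ler_pM2r// hnorm_gt0.
Qed.

Lemma cvg_rdot (T : Type) (F : set_system T) {FF : Filter F} (u : T -> H) x y :
  u @ F --> x -> rdot (u t) y @[t --> F] --> rdot x y.
Proof.
move=> /cvg_hnormP ux.
have : hnorm (u t - x) * hnorm y @[t --> F] --> (0 : R).
  by rewrite -[0](mul0r (hnorm y)); apply: cvgMl.
move/cvgrPdist_lt => h; apply/cvgrPdist_lt => e /h; apply: filterS => t.
rewrite sub0r normrN ger0_norm ?mulr_ge0 ?hnorm_ge0//; apply: le_lt_trans.
by rewrite -rdotBl hnormBC rdot_CS.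
Qed.

Lemma parallelogram x y :
  hnorm (x - y) ^+ 2 + hnorm (x + y) ^+ 2 = 2 * (hnorm x ^+ 2 + hnorm y ^+ 2).
Proof. by rewrite hnorm_sqrB (hnorm_sqrD x y); ring. Qed.

(* The representing vector minimises [hnorm v ^+ 2 - 2 * phi v]. *)
Lemma riesz (phi : H -> R) (C : R) : 0 <= C ->
  (forall x y, phi (x + y) = phi x + phi y) ->
  (forall t x, phi (t%:C *: x) = t * phi x) ->
  (forall x, `|phi x| <= C * hnorm x) ->
  exists2 v, (forall h, rdot v h = phi h) & hnorm v <= C.
Proof.
move=> C0 phiD phiZ phib.
pose J x := hnorm x ^+ 2 - 2 * phi x.
have Jlb x : - C ^+ 2 <= J x.
  rewrite /J; have := phib x => /(le_trans (ler_norm _)) h.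
  have := sqr_ge0 (hnorm x - C); rewrite sqrrB => h2; nra.
pose S := [set J x | x in [set: H]].
have hS : has_inf S.
  by split; [exists (J 0); exists 0|exists (- C ^+ 2) => _ [x _ <-]].
have infJ x : inf S <= J x by apply: ge_inf; [case: hS|exists x].
have hx n : exists x, J x < inf S + n.+1%:R^-1.
  have n0 : 0 < n.+1%:R^-1 :> R by rewrite invr_gt0.
  by have [_ [x _ <-] h] := inf_adherent n0 hS; exists x.
have [u hu] := choice hx.
(* The linear part of [J] cancels in the parallelogram law, which gives [|u m - u n|^2 = 2 J (u m) +
   2 J (u n) - 4 J (midpoint)]. As [J (midpoint)] is at least the infimum, this is at most
   [4 / (n + 1)]. *)
have udist n m : (n <= m)%N -> hnorm (u m - u n) <= Num.sqrt (4 * n.+1%:R^-1).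
  move=> nm; rewrite -ler_sqr ?nnegrE ?hnorm_ge0 ?sqrtr_ge0// sqr_sqrtr ?mulr_ge0//.
  have := parallelogram (u m) (u n); have := infJ (2^-1%:C *: (u m + u n)).
  rewrite /J phiZ phiD hnormZR exprMn ger0_norm ?invr_ge0//.
  have := hu m; have := hu n; rewrite /J.
  have : m.+1%:R^-1 <= n.+1%:R^-1 :> R by rewrite lef_pV2 ?posrE// ler_nat.
  move: (hnorm (u m + u n)) (hnorm (u m - u n)) => a b h1 h2 h3 h4 h5.
  move: h1 h2 h3 h4 h5; rewrite exprVn; move: (n.+1%:R^-1) (m.+1%:R^-1) => c d.
  move: (a ^+ 2) (b ^+ 2) (inf S) => a' b' I.
  by move: (hnorm (u n) ^+ 2) (hnorm (u m) ^+ 2) (phi _) (phi _) => *; lra.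
have h0 : n.+1%:R^-1 @[n --> \oo] --> (0 : R) by exact: cvg_harmonic.
have sq0 : Num.sqrt (4 * n.+1%:R^-1) @[n --> \oo] --> (0 : R).
  rewrite -[X in _ --> X]sqrtr0 -[X in Num.sqrt X](mulr0 4).
  by apply: continuous_cvg; [exact: sqrt_continuous|apply: cvgMr].
have [v uv] := hcauchy udist sq0.
have phic : phi (u n) @[n --> \oo] --> phi v.
  have /cvg_hnormP uv' := uv.
  apply: (@cvg_dist_le _ _ _ _ _ (fun n => C * hnorm (u n - v))).
    apply: nearW => n; rewrite (_ : phi (u n) - phi v = phi (u n - v)) ?phib//.
    by have := phiD (u n - v) v; rewrite subrK => ->; rewrite addrK.
  by rewrite -(mulr0 C); apply: cvgMr.
have Jv : J v <= inf S.
  have Jc : J (u n) @[n --> \oo] --> J v.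
    by apply: cvgB; [apply: cvgM; apply: cvg_hnorm|apply: cvgMr].
  have Sc : inf S + n.+1%:R^-1 @[n --> \oo] --> inf S.
    by rewrite -[X in _ --> X](addr0 (inf S)); apply: cvgD => //; exact: cvg_cst.
  by apply: (ler_cvg_to Jc Sc); apply: nearW => n; exact: ltW.
have key h : rdot v h = phi h.
  have q t : 0 <= 2 * t * (rdot v h - phi h) + t ^+ 2 * hnorm h ^+ 2.
    have := le_trans Jv (infJ (v + t%:C *: h)); rewrite /J phiD phiZ hnorm_sqrD.
    by rewrite hnormZR exprMn real_normK ?num_real// rdotZr; lra.
  apply/eqP; rewrite -subr_eq0 -sqrf_eq0 eq_le sqr_ge0 andbT.
  have b0 := sqr_ge0 (hnorm h).
  move: (rdot v h - phi h) (hnorm h ^+ 2) q b0 => d b q b0.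
  have b1 : 0 < b + 1 by rewrite ltr_wpDl.
  (* Nearly the minimum in [t] of the quadratic [q]; it yields a negative multiple of [d ^+ 2]. The
     [+ 1] keeps the denominator positive when [h = 0]. *)
  have := q (- d / (b + 1)).
  have -> : 2 * (- d / (b + 1)) * d + (- d / (b + 1)) ^+ 2 * b =
    - (d ^+ 2 * ((b + 2) / (b + 1) ^+ 2)) by field; rewrite gt_eqF.
  rewrite oppr_ge0 pmulr_lle0// divr_gt0// ?exprn_gt0// ltr_wpDl//.
exists v => //; apply: hnorm_le_rdot => // h.
by rewrite key (le_trans (ler_norm _)).
Qed.
End RealInnerProduct.

(** * Bounded operators *)

Section BoundedOperators.
Context {R : realType} {H : completeNormedModType R[i]}.
Implicit Types (A B S T : H -> H) (x y : H) (a l : R[i]).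

Lemma linear_funD A x y : linear A -> A (x + y) = A x + A y.
Proof. by move=> /(_ 1 x y); rewrite !scale1r. Qed.

Lemma linear_fun0 A : linear A -> A 0 = 0.
Proof. by move=> /(_ (-1) 0 0); rewrite scaler0 addr0 scaleN1r addNr. Qed.

Lemma linear_funZ A a x : linear A -> A (a *: x) = a *: A x.
Proof. by move=> lA; have := lA a x 0; rewrite (linear_fun0 lA) !addr0. Qed.

Lemma linear_funB A x y : linear A -> A (x - y) = A x - A y.
Proof.
by move=> lA; rewrite linear_funD// -scaleN1r linear_funZ// scaleN1r.
Qed.

Lemma bounded_op_gt0 A : bounded_op A ->
  exists2 M : R, 0 < M & forall x, hnorm (A x) <= M * hnorm x.
Proof.
move=> [_ [M AM]]; exists (`|M| + 1); first by rewrite ltr_wpDl.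
move=> x; apply: le_trans (AM x) _; rewrite ler_wpM2r ?hnorm_ge0//.
by rewrite (le_trans (ler_norm _))// lerDl.
Qed.

Lemma bounded_op_cvg A (u : nat -> H) v : bounded_op A ->
  u @ \oo --> v -> A (u n) @[n --> \oo] --> A v.
Proof.
move=> bA /cvg_hnormP uv; apply/cvg_hnormP; have [lA _] := bA.
have [M _ AM] := bounded_op_gt0 bA.
apply: (@cvg_dist_le _ _ _ _ _ (fun n => M * hnorm (u n - v))).
  by apply: nearW => n; rewrite subr0 ger0_norm ?hnorm_ge0// -linear_funB.
by rewrite -(mulr0 M); apply: cvgMr.
Qed.

Lemma bounded_op_comp A B : bounded_op A -> bounded_op B -> bounded_op (A \o B).
Proof.
move=> bA bB; split.
  by move=> a x y /=; rewrite (proj1 bB) (proj1 bA).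
have [M M0 AM] := bounded_op_gt0 bA; have [N N0 BN] := bounded_op_gt0 bB.
exists (M * N) => x /=; apply: le_trans (AM _) _.
by rewrite -mulrA ler_wpM2l// ltW.
Qed.

Lemma bounded_op_scaleD A B a : bounded_op A -> bounded_op B ->
  bounded_op (fun x => a *: A x + B x).
Proof.
move=> bA bB; split.
  move=> b x y; rewrite (proj1 bB) (proj1 bA) !scalerDr !scalerA.
  by rewrite (mulrC a b) addrACA.
have [M M0 AM] := bounded_op_gt0 bA; have [N N0 BN] := bounded_op_gt0 bB.
exists (cabs a * M + N) => x; rewrite mulrDl -mulrA.
by rewrite (le_trans (hnormD _ _))// lerD// hnormZ ler_wpM2l ?cabs_ge0.
Qed.

Lemma bounded_op_id : bounded_op (fun x : H => x).
Proof. by split => //; exists 1 => x; rewrite mul1r. Qed.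

Lemma bounded_op0 : bounded_op (fun x : H => 0 : H).
Proof.
split=> [a x y|]; first by rewrite scaler0 addr0.
by exists 0 => x; rewrite hnorm0 mul0r.
Qed.

Lemma bounded_op_scale A a : bounded_op A -> bounded_op (fun x => a *: A x).
Proof.
move=> bA; have := bounded_op_scaleD a bA bounded_op0.
by congr bounded_op; apply/funext => x; rewrite addr0.
Qed.

Lemma bounded_op_shift A l : bounded_op A -> bounded_op (fun x => A x - l *: x).
Proof.
move=> bA; have := bounded_op_scaleD (- l) bounded_op_id bA.
by congr bounded_op; apply/funext => x; rewrite addrC scaleNr.
Qed.

Lemma boundedly_invertible_comp A B : boundedly_invertible A ->
  boundedly_invertible B -> boundedly_invertible (A \o B).
Proof.
move=> [A' bA' [AK A'K]] [B' bB' [BK B'K]]; exists (B' \o A').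
  exact: bounded_op_comp.
by split => x /=; rewrite ?AK ?BK ?B'K ?A'K.
Qed.

Lemma boundedly_invertible_scale A a : a != 0 -> boundedly_invertible A ->
  boundedly_invertible (fun x => a *: A x).
Proof.
move=> a0 [A' bA' [AK A'K]]; exists (fun x => a^-1 *: A' x).
  exact: bounded_op_scale.
have [lA' _] := bA'; split => x.
  by rewrite linear_funZ// scalerA mulVf// scale1r.
by rewrite -(linear_funZ _ _ lA') A'K scalerA divff// scale1r.
Qed.

Lemma hcauchy_geometric (u : nat -> H) (C q : R) : 0 <= q < 1 ->
  (forall n, hnorm (u n.+1 - u n) <= C * q ^+ n) ->
  exists v : H, u @ \oo --> v.
Proof.
move=> /andP[q0 q1] uq.
have C0 : 0 <= C by have := uq 0%N; rewrite expr0 mulr1; apply: le_trans; exact: hnorm_ge0.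
have d0 : 0 < 1 - q by rewrite subr_gt0.
apply: (@hcauchy _ _ u (fun n => C / (1 - q) * q ^+ n)).
  move=> n m /subnKC <-; elim: (m - n)%N => [|k IH].
    by rewrite addn0 subrr hnorm0 !mulr_ge0 ?invr_ge0 ?exprn_ge0 ?(ltW d0).
  (* The bound to be proved does not propagate by itself. The induction is run with the exact
     geometric partial sum, which carries the factor [1 - q ^+ k]. *)
  have {IH}: hnorm (u (n + k)%N - u n) <= C / (1 - q) * q ^+ n * (1 - q ^+ k).
    elim: k {IH} => [|k IH]; first by rewrite addn0 subrr hnorm0 expr0 subrr mulr0.
    rewrite addnS (le_trans (hnorm_tri (u (n + k)%N) _ _))//.
    apply: le_trans (lerD (uq _) IH) _; rewrite exprD le_eqVlt; apply/orP; left.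
    by apply/eqP; rewrite exprS; field; rewrite gt_eqF.
  move=> h; rewrite addnS (le_trans (hnorm_tri (u (n + k)%N) _ _))//.
  apply: le_trans (lerD (uq _) h) _; rewrite exprD.
  have -> : C * (q ^+ n * q ^+ k) + C / (1 - q) * q ^+ n * (1 - q ^+ k) =
     C / (1 - q) * q ^+ n * (1 - q ^+ k.+1) by rewrite exprS; field; rewrite gt_eqF.
  apply: ler_piMr; last by rewrite gerBl exprn_ge0.
  by rewrite !mulr_ge0 ?invr_ge0 ?exprn_ge0 ?(ltW d0).
have -> : 0 = C / (1 - q) * 0 :> R by rewrite mulr0.
apply: cvgMr; apply: cvg_expr; rewrite ger0_norm//.
Qed.

End BoundedOperators.

(** * Coercive operators, symmetry and the location of the spectrum *)

Section SymmetricOperators.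
Context {R : realType} {H : completeNormedModType R[i]}.
Variable dot : {dot H for Num.conj}.
Hypothesis hdot : hilbert_dot dot.
Implicit Types (A B S T : H -> H) (x y : H) (a l : R[i]).

Local Notation rdot := (rdot dot).

(* The solution of [S x = y] is the fixed point of the contraction
   [x |-> x - t (S x - y)] for small [t]. *)
Lemma lax_milgram S (c : R) : bounded_op S -> 0 < c ->
  (forall x, c * hnorm x ^+ 2 <= rdot (S x) x) -> boundedly_invertible S.
Proof.
move=> bS c0 coer; have [lS _] := bS.
have [M M0 SM] := bounded_op_gt0 bS.
pose K := M + c; have K0 : 0 < K by rewrite addr_gt0.
have SK x : hnorm (S x) ^+ 2 <= K ^+ 2 * hnorm x ^+ 2.
  rewrite -exprMn ler_sqr ?nnegrE ?mulr_ge0 ?hnorm_ge0 ?(ltW K0)//.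
  by rewrite (le_trans (SM x))// ler_wpM2r ?hnorm_ge0// lerDl ltW.
(* Coercivity and [|S x| <= K |x|] give [|x - t S x|^2 <= (1 - 2 t c + t^2 K^2) |x|^2]. This [t]
   minimises the factor, with value [1 - (c / K)^2 = q^2]; [K > c] keeps [q] real. *)
pose t := c / K ^+ 2; pose q := Num.sqrt (1 - (c / K) ^+ 2).
have cK : 0 < c / K < 1 by rewrite divr_gt0//= ltr_pdivrMr// mul1r ltrDr.
have q2 : 0 <= 1 - (c / K) ^+ 2 by nra.
have q01 : 0 <= q < 1.
  by rewrite sqrtr_ge0 -ltr_sqr ?nnegrE ?sqrtr_ge0// sqr_sqrtr//; nra.
have below x : c * hnorm x <= hnorm (S x).
  have [->|x0] := eqVneq x 0; first by rewrite hnorm0 mulr0 hnorm_ge0.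
  have nx : 0 < hnorm x by rewrite hnorm_gt0.
  rewrite -(ler_pM2r nx) -mulrA -expr2; apply: le_trans (coer x) _.
  exact: rdot_ge.
have Sinj : injective S.
  move=> x y /eqP; rewrite -subr_eq0 -linear_funB// => /eqP e.
  have := below (x - y); rewrite e hnorm0 pmulr_rle0// => h.
  by apply/eqP; rewrite -subr_eq0 -hnorm_eq0 eq_le h hnorm_ge0.
have surj y : exists x, S x = y.
  pose F x := x - t%:C *: (S x - y).
  have FC x z : hnorm (F x - F z) <= q * hnorm (x - z).
    have -> : F x - F z = (x - z) - t%:C *: S (x - z).
      rewrite (linear_funB _ _ lS) (_ : S x - S z = (S x - y) - (S z - y)); last first.
        by rewrite opprB addrA subrK.
      rewrite /F [X in _ = _ - X]scalerBr; move: (t%:C *: _) (t%:C *: _) => a b.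
      by rewrite !opprB addrACA [RHS]addrACA (addrC (- b)).
    rewrite -ler_sqr ?nnegrE ?mulr_ge0 ?hnorm_ge0// ?sqrtr_ge0// exprMn sqr_sqrtr//.
    rewrite (hnorm_sqrB hdot) hnormZR exprMn real_normK ?num_real// rdotZr rdotC.
    have := coer (x - z); have := SK (x - z).
    move: (hnorm (S (x - z)) ^+ 2) (hnorm (x - z) ^+ 2) (rdot _ _) => a b d h1 h2.
    have t0 : 0 < t by rewrite divr_gt0// exprn_gt0.
    have h3 : t ^+ 2 * a <= t ^+ 2 * (K ^+ 2 * b) by rewrite ler_wpM2l// sqr_ge0.
    have h4 : t * (c * b) <= t * d by rewrite ler_wpM2l// ltW.
    have e1 : t ^+ 2 * (K ^+ 2 * b) = (c / K) ^+ 2 * b by rewrite /t; field; rewrite gt_eqF.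
    have e2 : t * (c * b) = (c / K) ^+ 2 * b by rewrite /t; field; rewrite gt_eqF.
    by rewrite mulrBl mul1r; lra.
  pose u n := iter n F 0.
  have [v uv] : exists v : H, u @ \oo --> v.
    apply: (@hcauchy_geometric _ _ u (hnorm (F 0)) q) => // n.
    elim: n => [|n IH]; first by rewrite expr0 mulr1 subr0.
    by rewrite /u !iterS (le_trans (FC _ _))// exprS mulrCA ler_wpM2l// ?sqrtr_ge0.
  exists v; have /cvg_hnormP uv' := uv.
  have Fv : F v = v.
    have h1 : u n.+1 @[n --> \oo] --> v by rewrite (cvg_shiftS u).
    have h2 : u n.+1 @[n --> \oo] --> F v.
      apply/cvg_hnormP; apply: (@cvg_dist_le _ _ _ _ _ (fun n => q * hnorm (u n - v))).
        by apply: nearW => n; rewrite subr0 ger0_norm ?hnorm_ge0//; exact: FC.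
      by rewrite -(mulr0 q); apply: cvgMr.
    exact: (cvg_unique _ h2 h1).
  have /eqP : t%:C *: (S v - y) = 0.
    by move: Fv; rewrite /F => /eqP; rewrite -subr_eq0 addrAC subrr add0r oppr_eq0 => /eqP.
  rewrite scaler_eq0 subr_eq0 => /orP[|/eqP//].
  by rewrite eq_complex /= gt_eqF// divr_gt0// exprn_gt0.
have [B SB] := choice surj.
have BS : cancel S B by move=> x; apply: Sinj; rewrite SB.
exists B; last by split.
split; first by move=> a x y; apply: Sinj; rewrite SB lS !SB.
exists c^-1 => y; rewrite -ler_pdivrMl ?invr_gt0// invrK.
by apply: le_trans (below _) _; rewrite SB.
Qed.

Lemma rdot_iJ x y : rdot ('i *: x) y = - rdot x ('i *: y).
Proof.
by rewrite rdotZJ -rdotNr -scaleNr; congr (rdot _ (_ *: _)); rewrite /= -[RHS]/(Complex _ _) oppr0.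
Qed.

Definition symmetric_op A := forall x y, rdot (A x) y = rdot x (A y).

(** Positivity makes the quadratic form real. Its being real at [x], at [y] and at [x + 'i *: y]
    gives symmetry by polarisation. *)
Lemma positive_symmetric A : bounded_op A -> positive_op dot A -> symmetric_op A.
Proof.
move=> [lA _] pA x y.
have := pA (x + 'i *: y) => /ger0_Im.
have := pA x => /ger0_Im; have := pA y => /ger0_Im.
rewrite linear_funD// linear_funZ// !Im_dot => hy hx.
have iN (w : H) : 'i%C *: ('i%C *: w) = - w.
  by rewrite scalerA -expr2 sqr_i scaleN1r.
have iR := rdot_iJ.
rewrite scalerDr iN rdotDl !rdotDr !rdotNr !iR !iN hx hy !rdotNr.
rewrite (rdotC dot (A y)); lra.
Qed.

Lemma symmetric_rdot_i A x : linear A -> symmetric_op A -> rdot ('i *: A x) x = 0.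
Proof.
move=> lA sA.
have iR := rdot_iJ.
have := iR (A x) x; rewrite sA linear_funZ// (rdotC dot x); lra.
Qed.

(** Multiplied by ['i] times [b], the imaginary part of [l], the operator [A - l] becomes coercive
    with constant [b ^+ 2]: the contributions of [A] and of the real part of [l] are purely
    imaginary and disappear from the real pairing. *)
Lemma symmetric_nonreal A l : bounded_op A -> symmetric_op A ->
  complex.Im l != 0 -> boundedly_invertible (fun x => A x - l *: x).
Proof.
move=> bA sA l0; pose b := complex.Im l.
have [lA _] := bA.
pose S x := (b%:C * 'i) *: (A x - l *: x).
have c0 : b%:C * 'i != 0 :> R[i].
  by rewrite eq_complex /= !mulr1 !mul0r addr0 negb_and; apply/orP; right; exact: l0.
have bS : bounded_op S by apply: bounded_op_scale; exact: bounded_op_shift.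
have iS : boundedly_invertible S.
  apply: (@lax_milgram _ (b ^+ 2)) => //; first by rewrite exprn_even_gt0.
  move=> x; rewrite /S -scalerA rdotZl scalerBr rdotBl symmetric_rdot_i// sub0r.
  rewrite {1}(_ : l = (complex.Re l)%:C + b%:C * 'i); last first.
    by rewrite [LHS]complexE mulrC.
  rewrite scalerDl scalerDr rdotDl !scalerA.
  have -> : rdot (('i * (complex.Re l)%:C) *: x) x = 0.
    by rewrite mulrC -scalerA rdotZl (symmetric_rdot_i (A := id)) ?mulr0.
  have -> : rdot (('i * (b%:C * 'i)) *: x) x = - b * hnorm x ^+ 2.
    by rewrite mulrCA -expr2 sqr_i mulrN1 -rmorphN rdotZl rdotxx.
  by rewrite le_eqVlt; apply/orP; left; apply/eqP; rewrite /=; ring.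
have := boundedly_invertible_scale (invr_neq0 c0) iS; congr boundedly_invertible.
by apply/funext => x; rewrite /S scalerA mulVf// scale1r.
Qed.

(** Outside the interval, Lax-Milgram inverts an operator in each of three cases. For [l < 0],
    [A - l] is coercive; for [l > M], [l - A] is. For [0 <= l < 1 / (2 N)], with [N] a bound of the
    inverse [B], write [A - l = A (1 - l B)]; the factor 2 leaves [1 - l B] coercive with constant
    [1 / 2]. *)
Lemma spectrum_bounds A : bounded_op A -> positive_op dot A ->
  boundedly_invertible A -> exists2 m : R, 0 < m &
  exists M : R, forall x : R, spectrum A x%:C -> m <= x <= M.
Proof.
move=> bA pA [B bB [AK BK]]; have [lA _] := bA; have [lB _] := bB.
have [M M0 AM] := bounded_op_gt0 bA; have [N N0 BN] := bounded_op_gt0 bB.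
have rp x : 0 <= rdot (A x) x.
  by have := pA x; rewrite lecE => /andP[].
exists (2 * N)^-1; first by rewrite invr_gt0 mulr_gt0.
exists M => l sl; apply/andP; split; rewrite leNgt; apply/negP => hl; apply: sl.
  have [l0|l0] := ltP l 0.
    apply: (@lax_milgram _ (- l)); [exact: bounded_op_shift|by rewrite oppr_gt0|].
    move=> x; rewrite rdotBl rdotZl rdotxx// mulNr.
    by rewrite lerBrDr addrC subrr.
  have b2 : bounded_op (fun x => x - l%:C *: B x).
    have := bounded_op_scaleD (- l%:C) bB bounded_op_id.
    by congr bounded_op; apply/funext => x; rewrite addrC scaleNr.
  have i2 : boundedly_invertible (fun x => x - l%:C *: B x).
    apply: (@lax_milgram _ 2^-1) => //.
    move=> x; rewrite rdotBl rdotxx// rdotZl.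
    have h1 : rdot (B x) x <= N * hnorm x ^+ 2.
      rewrite (le_trans (rdot_ge hdot _ _))// expr2 mulrA ler_wpM2r ?hnorm_ge0//.
    have h2 : l * rdot (B x) x <= l * (N * hnorm x ^+ 2) by rewrite ler_wpM2l.
    have h3 : l * N <= 2^-1.
      by rewrite -ler_pdivlMr// -invfM mulrC ltW// mulrC.
    have := ler_wpM2r (sqr_ge0 (hnorm x)) h3.
    by rewrite -mulrA; lra.
  have iA : boundedly_invertible A by exists B.
  have := boundedly_invertible_comp iA i2; congr boundedly_invertible.
  by apply/funext => x /=; rewrite linear_funB// linear_funZ// BK.
have iS : boundedly_invertible (fun x => (-1) *: (A x - l%:C *: x)).
  apply: (@lax_milgram _ (l - M)).
  - by apply: bounded_op_scale; exact: bounded_op_shift.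
  - by rewrite subr_gt0.
  - move=> x; rewrite scaleN1r opprB rdotBl rdotZl rdotxx// mulrBl lerD2l lerN2.
    by rewrite (le_trans (rdot_ge hdot _ _))// expr2 mulrA ler_wpM2r ?hnorm_ge0.
have := @boundedly_invertible_scale _ _ _ (-1) _ iS; rewrite oppr_eq0 oner_eq0.
move=> /(_ isT); congr boundedly_invertible.
by apply/funext => x; rewrite scalerA mulrNN mulr1 scale1r.
Qed.

End SymmetricOperators.

(** * Functional calculus of positive operators *)

Section PolynomialCalculus.
Context {R : realType} {H : completeNormedModType R[i]}.
Variable dot : {dot H for Num.conj}.
Hypothesis hdot : hilbert_dot dot.
Implicit Types (A B S T : H -> H) (x y : H) (a l : R[i]).
Implicit Types (p q : {poly R[i]}).

Local Notation rdot := (rdot dot).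

(** Complex coefficients are allowed so that polynomials split into linear factors. *)
Definition cpoly_op p A x : H := \sum_(k < size p) p`_k *: iter k A x.

Lemma cpoly_op_wide n p A x : (size p <= n)%N ->
  cpoly_op p A x = \sum_(k < n) p`_k *: iter k A x.
Proof.
move=> pn; rewrite /cpoly_op -(subnKC pn) big_split_ord /= [X in _ = _ + X]big1 ?addr0//.
by move=> k _; rewrite nth_default ?scale0r// leq_addr.
Qed.

Lemma cpoly_opD p q A x : cpoly_op (p + q) A x = cpoly_op p A x + cpoly_op q A x.
Proof.
rewrite !(@cpoly_op_wide (maxn (size p) (size q))) ?leq_maxl ?leq_maxr ?size_polyD//.
by rewrite -big_split; apply: eq_bigr => k _; rewrite coefD scalerDl.
Qed.

Lemma cpoly_opC a A x : cpoly_op a%:P A x = a *: x.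
Proof.
by rewrite (@cpoly_op_wide 1) ?size_polyC_leq1// big_ord_recl big_ord0 coefC addr0.
Qed.

Lemma cpoly_opMX p A x : cpoly_op (p * 'X) A x = cpoly_op p A (A x).
Proof.
rewrite (@cpoly_op_wide (size p).+1); last first.
  by have [->|p0] := eqVneq p 0; rewrite ?mul0r ?size_poly0// size_mulX.
rewrite big_ord_recl coefMX scale0r add0r; apply: eq_bigr => k _.
by rewrite coefMX /= -iterSr.
Qed.

Lemma cpoly_op_linear p A : linear A -> linear (cpoly_op p A).
Proof.
move=> lA a x y; rewrite /cpoly_op scaler_sumr -big_split /=.
apply: eq_bigr => k _; rewrite scalerA (mulrC a) -scalerA -scalerDr; congr (_ *: _).
by elim: (nat_of_ord k) => [|j IH] //=; rewrite IH lA.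
Qed.

Lemma cpoly_opZ a p A x : cpoly_op (a *: p) A x = a *: cpoly_op p A x.
Proof.
rewrite (@cpoly_op_wide (size p)) ?size_scale_leq// scaler_sumr.
by apply: eq_bigr => k _; rewrite coefZ scalerA.
Qed.

Lemma cpoly_opM p q A x : linear A ->
  cpoly_op (p * q) A x = cpoly_op p A (cpoly_op q A x).
Proof.
move=> lA; elim/poly_ind: q x => [|q c IH] x.
  rewrite mulr0 /cpoly_op size_poly0 !big_ord0.
  by rewrite -/(cpoly_op p A 0) (linear_fun0 (cpoly_op_linear p lA)).
rewrite mulrDr mulrA cpoly_opD cpoly_opMX IH cpoly_opD cpoly_opMX.
rewrite (linear_funD _ _ (cpoly_op_linear p lA)); congr (_ + _).
by rewrite mulrC mul_polyC cpoly_opZ cpoly_opC (linear_funZ _ _ (cpoly_op_linear p lA)).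
Qed.

Lemma cpoly_op_bounded p A : bounded_op A -> bounded_op (cpoly_op p A).
Proof.
move=> bA; elim/poly_ind: p => [|p c IH].
  have := @bounded_op0 R H; congr bounded_op; apply/funext => x.
  by rewrite /cpoly_op size_poly0 big_ord0.
have := bounded_op_scaleD c (@bounded_op_id R H) (bounded_op_comp IH bA).
congr bounded_op; apply/funext => x.
by rewrite cpoly_opD cpoly_opMX cpoly_opC addrC.
Qed.

Lemma poly_opE (q : {poly R}) A x :
  poly_op q A x = cpoly_op (map_poly (real_complex R) q) A x.
Proof.
rewrite /poly_op /cpoly_op size_map_poly; apply: eq_bigr => k _.
by rewrite coef_map.
Qed.

Lemma poly_op_bounded (q : {poly R}) A : bounded_op A -> bounded_op (poly_op q A).
Proof.
move=> bA; have := cpoly_op_bounded (map_poly (real_complex R) q) bA.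
by congr bounded_op; apply/funext => x; rewrite poly_opE.
Qed.

Lemma poly_opM (q r : {poly R}) A x : linear A ->
  poly_op (q * r) A x = poly_op q A (poly_op r A x).
Proof. by move=> lA; rewrite !poly_opE rmorphM cpoly_opM. Qed.

Lemma poly_opB (q r : {poly R}) A x :
  poly_op (q - r) A x = poly_op q A x - poly_op r A x.
Proof.
by rewrite !poly_opE rmorphB cpoly_opD -(scaleN1r (map_poly _ r)) cpoly_opZ scaleN1r.
Qed.

Lemma poly_opC (c : R) A x : poly_op c%:P A x = c%:C *: x.
Proof. by rewrite poly_opE map_polyC cpoly_opC. Qed.

Lemma poly_opX A x : poly_op 'X A x = A x.
Proof. by rewrite poly_opE map_polyX -(mul1r 'X) cpoly_opMX -polyC1 cpoly_opC scale1r. Qed.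

Lemma poly_op_symmetric (q : {poly R}) A : symmetric_op dot A ->
  symmetric_op dot (poly_op q A).
Proof.
move=> sA x y; rewrite /poly_op.
have it k z w : rdot (iter k A z) w = rdot z (iter k A w).
  by elim: k z w => //= k IH z w; rewrite sA IH -iterSr.
elim: (index_enum _) => [|k s IH]; first by rewrite !big_nil rdot0l rdotC rdot0l.
by rewrite !big_cons rdotDl rdotDr IH rdotZl rdotZr it.
Qed.

Lemma cpoly_op_invertible (rs : seq R[i]) A : linear A ->
  (forall a, a \in rs -> boundedly_invertible (fun x => A x - a *: x)) ->
  boundedly_invertible (cpoly_op (\prod_(a <- rs) ('X - a%:P)) A).
Proof.
move=> lA; elim: rs => [|a rs IH] hrs.
  have : boundedly_invertible (fun x : H => x).
    by exists id => //; exact: bounded_op_id.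
  congr boundedly_invertible; apply/funext => x.
  by rewrite big_nil -polyC1 cpoly_opC scale1r.
have h1 := hrs a (mem_head _ _).
have h2 : boundedly_invertible (cpoly_op (\prod_(a <- rs) ('X - a%:P)) A).
  by apply: IH => b brs; apply: hrs; rewrite in_cons brs orbT.
have := boundedly_invertible_comp h1 h2; congr boundedly_invertible.
apply/funext => x; rewrite big_cons cpoly_opM//= cpoly_opD -polyCN cpoly_opC scaleNr.
by congr (_ - _); rewrite -(mul1r 'X) cpoly_opMX -polyC1 cpoly_opC scale1r.
Qed.

(** Half of the spectral mapping theorem. Over the complex numbers [q] is a product of linear
    factors; were [A - a] invertible at every root [a], so would be [q(A)]. A root where it is not
    must be real, because [A] is symmetric. *)
Lemma root_in_spectrum A (q : {poly R}) : bounded_op A -> symmetric_op dot A ->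
  q != 0 -> ~ boundedly_invertible (poly_op q A) ->
  exists2 x : R, spectrum A x%:C & root q x.
Proof.
move=> bA sA q0 ninv; have [lA _] := bA.
pose p := map_poly (real_complex R) q.
have p0 : p != 0 by rewrite map_poly_eq0.
have [rs prs] := closed_field_poly_normal p.
have [h|h] := pselect (forall a, a \in rs -> boundedly_invertible (fun x => A x - a *: x)).
  exfalso; apply: ninv.
  have := boundedly_invertible_scale _ (cpoly_op_invertible lA h).
  move=> /(_ (lead_coef p)); rewrite lead_coef_eq0 => /(_ p0).
  by congr boundedly_invertible; apply/funext => x; rewrite poly_opE -/p prs cpoly_opZ -prs.
have [a] : exists a, ~ (a \in rs -> boundedly_invertible (fun x => A x - a *: x)).
  by apply/existsNP.
move=> /not_implyP [ars na].
have aR : a = (complex.Re a)%:C.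
  have [e|/(symmetric_nonreal hdot bA sA)//] := eqVneq (complex.Im a) 0.
  by case: a e {ars na} => u v /= ->.
exists (complex.Re a); first by rewrite -aR.
rewrite -(fmorph_root (real_complex R)) [X in root _ X](esym aR) -/p prs rootZ ?lead_coef_eq0//.
by rewrite root_prod_XsubC.
Qed.

(** [N] is the operator norm. For [x] in the unit ball, [|T^2 x - N^2 x|^2 <= N^2 (N^2 - |T x|^2)],
    which is small when [|T x|] is close to [N]. A bounded inverse of [T^2 - N^2] would then force
    [|T x|] to be small as well. If [N = 0] the operator in question is zero, which is not
    invertible as [H] is nonzero. *)
Lemma opnorm_square_spectrum T : (exists e : H, e != 0) -> bounded_op T ->
  symmetric_op dot T -> exists N : R, [/\ 0 <= N,
    forall x, hnorm (T x) <= N * hnorm x &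
    ~ boundedly_invertible (fun x => T (T x) - (N ^+ 2)%:C *: x)].
Proof.
move=> [e e0] bT sT; have [lT _] := bT; have [M M0 TM] := bounded_op_gt0 bT.
pose X := [set hnorm (T x) | x in [set x | hnorm x <= 1]].
have hX : has_sup X.
  split; first by exists (hnorm (T 0)); exists 0 => //=; rewrite hnorm0.
  exists M => _ [x /= x1 <-]; rewrite (le_trans (TM x))//.
  by rewrite -[leRHS]mulr1 ler_wpM2l// ltW.
have ubX x : hnorm x <= 1 -> hnorm (T x) <= sup X.
  by move=> x1; apply: ub_le_sup; [case: hX|exists x].
set N := sup X in ubX *.
have N0 : 0 <= N.
  by apply: le_trans (ubX 0 _); rewrite ?hnorm_ge0// hnorm0.
have TN x : hnorm (T x) <= N * hnorm x.
  have [->|x0] := eqVneq x 0; first by rewrite (linear_fun0 lT) hnorm0 mulr0.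
  have nx : 0 < hnorm x by rewrite hnorm_gt0.
  have := ubX ((hnorm x)^-1%:C *: x).
  rewrite (linear_funZ _ _ lT) !hnormZR ger0_norm ?invr_ge0 ?hnorm_ge0// mulVf ?gt_eqF//.
  by move=> /(_ (lexx _)); rewrite ler_pdivrMl// mulrC.
exists N; split => // -[B bB [KB _]]; have [K K0 BK] := bounded_op_gt0 bB.
have low x : hnorm x <= K * hnorm (T (T x) - (N ^+ 2)%:C *: x).
  by rewrite -{1}(KB x) BK.
have [N00|Npos] : N = 0 \/ 0 < N.
- by move: N0; rewrite le_eqVlt => /orP[/eqP <-|]; [left|right].
- have T0 x : T x = 0.
    apply/eqP; rewrite -hnorm_eq0 eq_le hnorm_ge0 andbT.
    by rewrite (le_trans (TN x))// N00 mul0r.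
  have := low e; rewrite !T0 N00 expr0n scale0r subrr hnorm0 mulr0.
  by apply/negP; rewrite -ltNge hnorm_gt0.
have up x : hnorm x <= 1 ->
    hnorm (T x) ^+ 2 <= K ^+ 2 * N ^+ 4 * (N ^+ 2 - hnorm (T x) ^+ 2).
  move=> x1.
  have h1 : hnorm (T x) ^+ 2 <= N ^+ 2 * hnorm x ^+ 2.
    by rewrite -exprMn ler_sqr ?nnegrE ?mulr_ge0 ?hnorm_ge0.
  have h2 : hnorm x ^+ 2 <= K ^+ 2 * hnorm (T (T x) - (N ^+ 2)%:C *: x) ^+ 2.
    by rewrite -exprMn ler_sqr ?nnegrE ?mulr_ge0 ?hnorm_ge0 ?(ltW K0).
  have h3 : hnorm (T (T x)) ^+ 2 <= N ^+ 2 * hnorm (T x) ^+ 2.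
    by rewrite -exprMn ler_sqr ?nnegrE ?mulr_ge0 ?hnorm_ge0.
  move: h2; rewrite (hnorm_sqrB hdot) hnormZR exprMn real_normK ?num_real//.
  rewrite rdotZr sT (rdotxx hdot) => h2.
  have h4 : hnorm x ^+ 2 <= 1 by rewrite expr_le1 ?hnorm_ge0.
  move: h1 h2 h3 h4.
  move: (hnorm (T (T x)) ^+ 2) (hnorm (T x) ^+ 2) (hnorm x ^+ 2) => a b c h1 h2 h3 h4.
  have h5 : K ^+ 2 * (a - 2 * (N ^+ 2 * b) + (N ^+ 2) ^+ 2 * c) <=
            K ^+ 2 * (N ^+ 2 * (N ^+ 2 - b)).
    rewrite ler_wpM2l ?sqr_ge0//.
    have : (N ^+ 2) ^+ 2 * c <= (N ^+ 2) ^+ 2 by rewrite -[leRHS]mulr1 ler_wpM2l ?sqr_ge0.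
    by rewrite (_ : N ^+ 2 * (N ^+ 2 - b) = (N ^+ 2) ^+ 2 - N ^+ 2 * b); [lra|ring].
  have h6 : N ^+ 2 * c <= N ^+ 2 * (K ^+ 2 * (N ^+ 2 * (N ^+ 2 - b))).
    by rewrite ler_wpM2l ?sqr_ge0//; exact: le_trans h2 h5.
  apply: le_trans h1 (le_trans h6 _); rewrite le_eqVlt; apply/orP; left; apply/eqP; ring.
pose L := K ^+ 2 * N ^+ 4.
have L0 : 0 < L by rewrite mulr_gt0 ?exprn_gt0.
(* By [up], [(1 + L) |T x|^2 <= L N^2] on the unit ball. With [d = 1 / (4 (1 + L))], a point where
   [|T x| > N (1 - d)] has [(1 + L) |T x|^2 > (1 + L) N^2 - N^2 / 2], a contradiction. *)
have eps0 : 0 < N * (4 * (1 + L))^-1 by rewrite mulr_gt0// invr_gt0 mulr_gt0// addr_gt0.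
have [_ [x x1 <-]] := sup_adherent eps0 hX; rewrite -/N => hlt.
have := up x x1; rewrite -/L; apply/negP; rewrite -ltNge.
have e1 : (4 * (1 + L))^-1 * (1 + L) = 4^-1 by field; rewrite gt_eqF// addr_gt0.
have d0 : 0 < (4 * (1 + L))^-1 by rewrite invr_gt0 mulr_gt0// addr_gt0.
have e2 : (4 * (1 + L))^-1 < 1 by rewrite invf_lt1; lra.
move: hlt e1 e2 d0; set d := (4 * (1 + L))^-1; move=> hlt e1 e2 d0.
have hb : N ^+ 2 * (1 - 2 * d) < hnorm (T x) ^+ 2.
  have : (N * (1 - d)) ^+ 2 < hnorm (T x) ^+ 2.
    rewrite ltr_sqr ?nnegrE ?hnorm_ge0 ?mulr_ge0 ?subr_ge0 ?(ltW e2)//; lra.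
  apply: le_lt_trans; rewrite exprMn ler_wpM2l ?sqr_ge0//; nra.
have hc : N ^+ 2 * (1 - 2 * d) * (1 + L) < hnorm (T x) ^+ 2 * (1 + L).
  by rewrite ltr_pM2r ?addr_gt0.
have : N ^+ 2 * (1 - 2 * d) * (1 + L) = N ^+ 2 * (1 + L) - N ^+ 2 * 2 * (d * (1 + L)) by ring.
rewrite e1 => hd; rewrite hd in hc.
have NN : 0 < N ^+ 2 by rewrite exprn_gt0.
rewrite mulrBr; lra.
Qed.

(** With [N] the norm of [q(A)], the operator [q(A)^2 - N^2] is not invertible, so the polynomial
    [q^2 - N^2] has a root in the spectrum of [A]. There [|q| = N], hence [N <= eps]. *)
Lemma spectral_norm A (q : {poly R}) (eps : R) : (exists e : H, e != 0) ->
  bounded_op A -> symmetric_op dot A ->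
  (forall x : R, spectrum A x%:C -> `|q.[x]| <= eps) ->
  forall u, hnorm (poly_op q A u) <= eps * hnorm u.
Proof.
move=> e0 bA sA hq u; have [lA _] := bA.
have [N [N0 TN ninv]] := opnorm_square_spectrum e0 (poly_op_bounded q bA) (poly_op_symmetric q sA).
suff [x sx qx] : exists2 x : R, spectrum A x%:C & `|q.[x]| = N.
  by apply: le_trans (TN u) _; rewrite ler_wpM2r ?hnorm_ge0// -qx hq.
have fE (r : {poly R}) (n : R) :
    (fun x => poly_op r A (poly_op r A x) - (n ^+ 2)%:C *: x) =
    poly_op (r * r - (n ^+ 2)%:P) A.
  by apply/funext => x; rewrite poly_opB poly_opC poly_opM.
have sol (x : R) : root (q * q - (N ^+ 2)%:P) x -> `|q.[x]| = N.
  rewrite rootE !hornerE -expr2 subr_eq0 eqf_sqr => /orP[]/eqP->.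
    by rewrite ger0_norm.
  by rewrite normrN ger0_norm.
(* If [q^2 - N^2] is the zero polynomial, every point is a root and only some point of the spectrum
   is wanted. The norm [M] of [A] itself provides one, as a root of [X^2 - M^2]. *)
have [q0|q0] := eqVneq (q * q - (N ^+ 2)%:P) 0; last first.
  by rewrite fE in ninv; have [x sx /sol qx] := root_in_spectrum bA sA q0 ninv; exists x.
have [M [M0 _ ninvA]] := opnorm_square_spectrum e0 bA sA.
have [||x sx _] := @root_in_spectrum A ('X * 'X - (M ^+ 2)%:P) bA sA; last first.
- by exists x => //; apply: sol; rewrite q0 root0.
- move=> h; apply: ninvA; move: h; rewrite -fE.
  by congr boundedly_invertible; apply/funext => x; rewrite !poly_opX.
- by rewrite -expr2 -size_poly_gt0 size_XnsubC.
Qed.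

(** The approximating sequence [q] is given rather than chosen, because one sequence will have to
    serve a whole family of operators. *)
Lemma fun_calculus_exists A (f : R -> R) (q : nat -> {poly R}) :
  (exists e : H, e != 0) -> bounded_op A -> symmetric_op dot A ->
  (forall e : R, 0 < e -> \forall n \near \oo,
     forall x : R, spectrum A x%:C -> `|(q n).[x] - f x| <= e) ->
  exists2 B, is_fun_calculus A f B &
    forall e : R, 0 < e -> \forall n \near \oo,
       forall u : H, hnorm (poly_op (q n) A u - B u) <= e * hnorm u.
Proof.
move=> e0 bA sA qf; have [lA _] := bA.
have cau (e : R) : 0 < e -> exists N, forall n, (N <= n)%N -> forall m, (N <= m)%N ->
    forall u, hnorm (poly_op (q n) A u - poly_op (q m) A u) <= e * hnorm u.
  move=> epos; have e2 : 0 < e / 2 by rewrite divr_gt0.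
  have [N _ hN] := qf _ e2; exists N => n Nn m Nm u.
  rewrite -poly_opB; apply: spectral_norm => // x sx.
  rewrite !hornerE; have -> : (q n).[x] - (q m).[x] =
    ((q n).[x] - f x) - ((q m).[x] - f x) by ring.
  by rewrite (le_trans (ler_normB _ _))// [e]splitr lerD// hN.
have ex u : exists v : H, poly_op (q n) A u @[n --> \oo] --> v.
  apply: hcauchy_eps => e epos.
  have d0 : 0 < e / (hnorm u + 1) by rewrite divr_gt0// ltr_wpDl// hnorm_ge0.
  have [N hN] := cau _ d0; exists N => n Nn; apply: le_lt_trans (hN n Nn N (leqnn _) u) _.
  by rewrite mulrAC ltr_pdivrMr ?ltr_wpDl ?hnorm_ge0// ltr_pM2l// ltrDl.
have [B hB] := choice ex.
have conv (e : R) : 0 < e -> \forall n \near \oo,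
       forall u : H, hnorm (poly_op (q n) A u - B u) <= e * hnorm u.
  move=> epos; have [N hN] := cau _ epos; exists N => // n /= Nn u.
  have c1 : hnorm (poly_op (q n) A u - poly_op (q m) A u) @[m --> \oo] -->
            hnorm (poly_op (q n) A u - B u).
    by apply: cvg_hnorm; apply: cvgB (hB u); exact: cvg_cst.
  apply: (ler_cvg_to c1 (cvg_cst (e * hnorm u))).
  by exists N => // m Nm; exact: hN.
have bB : bounded_op B.
  split.
    move=> a x y; apply: (cvg_unique _ (hB (a *: x + y))) => //=.
    have -> : (fun n => poly_op (q n) A (a *: x + y)) =
              (fun n => a *: poly_op (q n) A x + poly_op (q n) A y).
      by apply/funext => n; rewrite (proj1 (poly_op_bounded (q n) bA)).
    apply: cvgD; last exact: hB.
    exact: (bounded_op_cvg (bounded_op_scale a (@bounded_op_id R H)) (hB x)).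
  have [N _ hN] := conv 1 ltr01.
  have [M M0 hM] := bounded_op_gt0 (poly_op_bounded (q N) bA).
  exists (1 + M) => u; rewrite mulrDl.
  have -> : B u = poly_op (q N) A u - (poly_op (q N) A u - B u) by rewrite opprB addrC subrK.
  by rewrite (le_trans (hnormB _ _))// addrC lerD// hN /=.
by exists B => //; split => //; exists q.
Qed.

(** On the spectrum [q n * r n] tends uniformly to [f * g = 1], so [q_n(A) r_n(A) u] tends to [u] by
    [spectral_norm]. It also tends to [B (C u)], as [q_n(A)] converges to [B] in operator norm and
    the vectors [r_n(A) u] stay bounded. *)
Lemma fun_calculus_inverse A (f g : R -> R) B C (K : R) :
  (exists e : H, e != 0) -> bounded_op A -> symmetric_op dot A ->
  (forall x : R, spectrum A x%:C -> [/\ `|f x| <= K, `|g x| <= K & f x * g x = 1]) ->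
  is_fun_calculus A f B -> is_fun_calculus A g C -> cancel C B.
Proof.
move=> e0 bA sA hfg [bB [q [qf qB]]] [bC [r [rg rC]]] u; have [lA _] := bA.
have c1 : poly_op (q n) A (poly_op (r n) A u) @[n --> \oo] --> u.
  apply/cvg_hnormP/cvgrPdist_le => e epos /=.
  (* If the approximants are within [d] of [f] and [g], which are bounded by [K], their product is
     within [d^2 + 2 K d] of 1. The minimum with 1 makes this bound linear in [d]. *)
  have [d d0 hd] : exists2 d : R, 0 < d & (d * (d + 2 * K)) * hnorm u <= e.
    pose k := `|K| + 1; pose d := Num.min 1 (e / ((1 + 2 * k) * (hnorm u + 1))).
    have k0 : 0 < k by rewrite ltr_wpDl.
    have D0 : 0 < (1 + 2 * k) * (hnorm u + 1).
      by rewrite mulr_gt0 ?(ltr_wpDl (hnorm_ge0 _))// addr_gt0// mulr_gt0.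
    have d0 : 0 < d by rewrite lt_min ltr01 divr_gt0.
    exists d => //.
    have : d <= e / ((1 + 2 * k) * (hnorm u + 1)) by rewrite ge_min lexx orbT.
    rewrite ler_pdivlMr//; apply: le_trans; rewrite -mulrA ler_wpM2l ?(ltW d0)//.
    have d1 : d <= 1 by rewrite ge_min lexx.
    have Kk : K <= k by rewrite (le_trans (ler_norm _))// lerDl.
    apply: (@le_trans _ _ ((1 + 2 * k) * hnorm u)).
      by rewrite ler_wpM2r ?hnorm_ge0// lerD// ler_wpM2l.
    by rewrite ler_wpM2l ?lerDl// addr_ge0// mulr_ge0// ltW.
  have [N _ hN] := qf _ d0; have [M _ hM] := rg _ d0.
  exists (maxn N M) => // n /=; rewrite geq_max => /andP[Nn Mn].
  rewrite sub0r normrN ger0_norm ?hnorm_ge0//; apply: le_trans hd.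
  rewrite -poly_opM// -{2}(scale1r u) -(rmorph1 (real_complex R)) -(poly_opC 1 A) -poly_opB.
  apply: spectral_norm => // x sx; rewrite !hornerE.
  have [fK gK fg] := hfg x sx; have := hN n Nn x sx; have := hM n Mn x sx.
  move: (q n).[x] (r n).[x] => a b hb ha.
  have -> : a * b - 1 =
    (a - f x) * (b - g x) + (a - f x) * g x + f x * (b - g x).
    by rewrite -[X in _ - X]fg; ring.
  apply: le_trans (ler_normD _ _) _; apply: le_trans (lerD (ler_normD _ _) (lexx _)) _.
  rewrite !normrM.
  have h1 : `|a - f x| * `|b - g x| <= d * d by rewrite ler_pM.
  have h2 : `|a - f x| * `|g x| <= d * K by rewrite ler_pM.
  have h3 : `|f x| * `|b - g x| <= K * d by rewrite ler_pM.
  lra.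
have c2 : poly_op (q n) A (poly_op (r n) A u) @[n --> \oo] --> B (C u).
  have c3 : poly_op (r n) A u @[n --> \oo] --> C u.
    apply/cvg_hnormP/cvgrPdist_le => e epos /=.
    have d0 : 0 < e / (hnorm u + 1) by rewrite divr_gt0// ltr_wpDl// hnorm_ge0.
    apply: filterS (rC _ d0) => n /(_ u); rewrite sub0r normrN ger0_norm ?hnorm_ge0//.
    move=> /le_trans; apply; rewrite mulrAC ler_pdivrMr ?ltr_wpDl ?hnorm_ge0//.
    by rewrite ler_pM2l// lerDl.
  have c4 := bounded_op_cvg bB c3.
  have nr : hnorm (poly_op (r n) A u) @[n --> \oo] --> hnorm (C u) by exact: cvg_hnorm c3.
  apply/cvg_hnormP.
  apply/cvgrPdist_le => e epos /=.
  have e2 : 0 < e / 2 by rewrite divr_gt0.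
  have d0 : 0 < e / 2 / (hnorm (C u) + 1) by rewrite divr_gt0// ltr_wpDl// hnorm_ge0.
  have /cvg_hnormP/cvgrPdist_le/(_ _ e2) c5 := c4.
  have /cvgrPdist_le/(_ _ ltr01) c6 := nr.
  near=> n.
  rewrite sub0r normrN ger0_norm ?hnorm_ge0// (le_trans (hnorm_tri (B (poly_op (r n) A u)) _ _))//.
  rewrite [e]splitr lerD//; last first.
    have : `|0 - hnorm (B (poly_op (r n) A u) - B (C u))| <= e / 2 by near: n.
    by rewrite sub0r normrN ger0_norm ?hnorm_ge0.
  have h1 : hnorm (poly_op (q n) A (poly_op (r n) A u) - B (poly_op (r n) A u)) <=
     e / 2 / (hnorm (C u) + 1) * hnorm (poly_op (r n) A u).
    by have : forall w, hnorm (poly_op (q n) A w - B w) <= e / 2 / (hnorm (C u) + 1) * hnorm w; [near: n; exact: qB|apply].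
  apply: le_trans h1 _; rewrite mulrAC ler_pdivrMr ?ltr_wpDl ?hnorm_ge0//.
  rewrite ler_pM2l//.
  have : `|hnorm (C u) - hnorm (poly_op (r n) A u)| <= 1 by near: n.
  rewrite ler_norml; lra.
exact: (cvg_unique _ c2 c1).
Unshelve. all: end_near. Qed.

Lemma fun_calculus_symmetric A (f : R -> R) B : symmetric_op dot A ->
  is_fun_calculus A f B -> symmetric_op dot B.
Proof.
move=> sA [bB [q [qf qB]]] x y.
have c3 u : poly_op (q n) A u @[n --> \oo] --> B u.
  apply/cvg_hnormP/cvgrPdist_le => e epos /=.
  have d0 : 0 < e / (hnorm u + 1) by rewrite divr_gt0// ltr_wpDl// hnorm_ge0.
  apply: filterS (qB _ d0) => n /(_ u); rewrite sub0r normrN ger0_norm ?hnorm_ge0//.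
  move=> /le_trans; apply; rewrite mulrAC ler_pdivrMr ?ltr_wpDl ?hnorm_ge0//.
  by rewrite ler_pM2l// lerDl.
have h1 : rdot (poly_op (q n) A x) y @[n --> \oo] --> rdot (B x) y by exact: cvg_rdot.
have h2 : rdot (poly_op (q n) A y) x @[n --> \oo] --> rdot (B y) x by exact: cvg_rdot.
suff h3 : rdot (poly_op (q n) A x) y @[n --> \oo] --> rdot (B y) x.
  by rewrite (rdotC dot x (B y)); exact: (cvg_unique _ h1 h3).
rewrite (_ : (fun t => rdot (poly_op (q t) A x) y) = fun t => rdot (poly_op (q t) A y) x)//.
by apply/funext => n; rewrite (poly_op_symmetric _ sA) rdotC.
Qed.

End PolynomialCalculus.

(** * The binomial series *)

Section PowerSeriesRadius.
Context {R : realType}.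
Implicit Types (f : nat -> R) (rho sigma x : R).

(** Radius of convergence at least [rho], in Abel's form: bounded terms are easy to compare and
    survive termwise differentiation. *)
Definition radius_ge f rho := forall sigma, 0 <= sigma < rho ->
  exists M, forall n, `|f n| * sigma ^+ n <= M.

Lemma radius_ge_cvg_norm f rho x : radius_ge f rho -> `|x| < rho ->
  cvgn (pseries (fun n => `|f n|) `|x|).
Proof.
move=> fr xr; have [sigma s1 s2] : exists2 sigma, `|x| < sigma & sigma < rho.
  by exists ((`|x| + rho) / 2); lra.
have s0 : 0 < sigma by apply: le_lt_trans s1.
have [|M hM] := fr sigma; first by rewrite s2 ltW.
apply: (@series_le_cvg _ _ (fun n => M * (`|x| / sigma) ^+ n)) => //=.
- move=> n; rewrite mulr_ge0// ?exprn_ge0// ?divr_ge0 ?(ltW s0)//.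
  by rewrite (le_trans _ (hM 0%N))// mulr_ge0// expr0.
- move=> n; rewrite expr_div_n mulrA ler_pdivlMr ?exprn_gt0// mulrAC.
  by rewrite ler_wpM2r ?exprn_ge0.
- apply: is_cvg_geometric_series.
  by rewrite ger0_norm ?divr_ge0 ?(ltW s0)// ltr_pdivrMr// mul1r.
Qed.

Lemma radius_ge_cvg f rho x : radius_ge f rho -> `|x| < rho ->
  cvgn (pseries f x).
Proof.
move=> fr xr; apply: normed_cvg.
rewrite [X in cvgn X](_ : _ = pseries (fun n => `|f n|) `|x|).
  exact: radius_ge_cvg_norm xr.
apply/funext => n; rewrite /normed_series_of /pseries /series /=.
by apply: eq_bigr => i _; rewrite normrM normrX.
Qed.

Lemma radius_ge_diffs f rho : radius_ge f rho -> radius_ge (pseries_diffs f) rho.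
Proof.
move=> fr sigma /andP[s0 sr].
have [tau t1 t2] : exists2 tau, sigma < tau & tau < rho.
  by exists ((sigma + rho) / 2); lra.
have t0 : 0 < tau by apply: le_lt_trans t1.
have [|M hM] := fr tau; first by rewrite t2 ltW.
have M0 : 0 <= M by rewrite (le_trans _ (hM 0%N))// mulr_ge0// expr0.
have q01 : 0 <= sigma / tau < 1.
  by rewrite divr_ge0 ?(ltW t0)//= ltr_pdivrMr// mul1r.
pose C := (1 - sigma / tau)^-1.
(* Each of the [n + 1] terms of the geometric sum up to index [n] is at least the last one, and the
   whole sum is at most [C]. *)
have hC n : n.+1%:R * (sigma / tau) ^+ n <= C.
  have [q0 q1] := andP q01.
  rewrite /C -[leRHS]mul1r ler_pdivlMr ?subr_gt0//.
  apply: (@le_trans _ _ ((1 - sigma / tau) * \sum_(i < n.+1) (sigma / tau) ^+ i)).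
    rewrite mulrC ler_wpM2l ?subr_ge0 ?(ltW q1)//.
    rewrite mulr_natl -[X in _ *+ X]card_ord -sumr_const ler_sum// => i _.
    by rewrite ler_wiXn2l// ?(ltW q1)// -ltnS.
  by rewrite -opprB mulNr -subrX1 opprB gerBl exprn_ge0.
exists (M / tau * C) => n; rewrite /pseries_diffs normrM ger0_norm//.
have -> : n.+1%:R * `|f n.+1| * sigma ^+ n =
  (`|f n.+1| * tau ^+ n.+1) / tau * (n.+1%:R * (sigma / tau) ^+ n).
  have tn : tau ^+ n != 0 by rewrite expf_neq0 ?gt_eqF.
  have tt : tau != 0 by rewrite gt_eqF.
  rewrite expr_div_n exprS; move: (tau ^+ n) tn (sigma ^+ n) (n.+1%:R) => x xn y z.
  by field; rewrite tt xn.
apply: ler_pM => //; last by rewrite ler_wpM2r ?invr_ge0 ?(ltW t0).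
  by rewrite divr_ge0 ?(ltW t0)// mulr_ge0// exprn_ge0// ltW.
by rewrite mulr_ge0// exprn_ge0//; case/andP: q01.
Qed.

Lemma radius_ge_derive f rho x : radius_ge f rho -> `|x| < rho ->
  is_derive x (1 : R) (fun y => limn (pseries f y))
    (limn (pseries (pseries_diffs f) x)).
Proof.
move=> fr xr; pose K := (`|x| + rho) / 2.
have K1 : `|x| < K by rewrite /K; lra.
have K2 : K < rho by rewrite /K; lra.
have K0 : 0 <= K by apply: ltW; apply: le_lt_trans K1.
have KK : `|K| = K by rewrite ger0_norm.
have dr := radius_ge_diffs fr.
by apply: (@pseries_snd_diffs _ _ K); rewrite ?KK//;
  [apply: (radius_ge_cvg fr)|apply: (radius_ge_cvg dr)|apply: (radius_ge_cvg (radius_ge_diffs dr))]; rewrite KK.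
Qed.

End PowerSeriesRadius.

(** * Derivative rules for functions written pointwise *)

Section RealDerivatives.
Context {R : realType}.
Implicit Types (f g : R -> R) (x a b : R).

Lemma is_deriveD_fun f g x a b : is_derive x (1 : R) f a -> is_derive x (1 : R) g b ->
  is_derive x (1 : R) (fun y => f y + g y) (a + b).
Proof. exact: is_deriveD. Qed.

Lemma is_deriveB_fun f g x a b : is_derive x (1 : R) f a -> is_derive x (1 : R) g b ->
  is_derive x (1 : R) (fun y => f y - g y) (a - b).
Proof. exact: is_deriveB. Qed.

Lemma is_deriveM_fun f g x a b : is_derive x (1 : R) f a -> is_derive x (1 : R) g b ->
  is_derive x (1 : R) (fun y => f y * g y) (a * g x + f x * b).
Proof.
move=> fa gb; have := is_deriveM fa gb; move/is_derive_eq; apply.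
by rewrite addrC; congr (_ + _); rewrite /GRing.scale /= mulrC.
Qed.

Lemma is_derive_cst_fun (c : R) x : is_derive x (1 : R) (fun=> c) 0.
Proof. exact: is_derive_cst. Qed.

Lemma is_derive_comp_fun f g x a b : is_derive (g x) (1 : R) f a ->
  is_derive x (1 : R) g b -> is_derive x (1 : R) (fun y => f (g y)) (a * b).
Proof. exact: is_derive1_comp. Qed.

End RealDerivatives.

Section BinomialSeries.
Context {R : realType}.
Variable s : R.
Implicit Types (w : R[i]) (t : R).

(** The coefficient [s (s + 1) ... (s + n - 1) / n!] of [w^n] in [(1 - w)^(-s)]. *)
Definition bincoef (n : nat) : R := \prod_(k < n) ((s + k%:R) / k.+1%:R).

Lemma bincoefS n : n.+1%:R * bincoef n.+1 = (s + n%:R) * bincoef n.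
Proof. by rewrite /bincoef big_ord_recr /= mulrCA (mulrC _ (_ / _)) mulrA [X in X * _]mulrCA; field; rewrite nat1r pnatr_eq0. Qed.

Lemma bincoef0 : bincoef 0 = 1.
Proof. by rewrite /bincoef big_ord0. Qed.

Lemma bincoef_radius : radius_ge bincoef 1.
Proof.
move=> sigma /andP[s0 s1].
pose u n := `|bincoef n| * sigma ^+ n.
have u0 n : 0 <= u n by rewrite mulr_ge0// exprn_ge0.
(* From this index on [sigma (|s| + n) <= n + 1], so the terms decrease; the finitely many earlier
   ones are bounded by their sum. *)
pose N := (Num.truncn (`|s| / (1 - sigma))).+1.
have hN n : (N <= n)%N -> u n.+1 <= u n.
  move=> Nn; rewrite /u.
  have -> : bincoef n.+1 = (s + n%:R) / n.+1%:R * bincoef n.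
    by apply: (@mulfI _ n.+1%:R); rewrite ?pnatr_eq0// bincoefS; field; rewrite nat1r pnatr_eq0.
  rewrite normrM exprS mulrCA mulrA -[leRHS]mul1r mulrA ler_wpM2r ?exprn_ge0//.
  rewrite mulrA ler_wpM2r// normrM [`|n.+1%:R^-1|]ger0_norm ?invr_ge0// mulrA ler_pdivrMr// mul1r.
  have h1 : `|s| / (1 - sigma) < n%:R.
    apply: lt_le_trans (truncnS_gt _) _; by rewrite ler_nat.
  have h2 : `|s| < n%:R * (1 - sigma) by rewrite -ltr_pdivrMr// subr_gt0.
  have h3 : `|s + n%:R| <= `|s| + n%:R by rewrite (le_trans (ler_normD _ _))// [`|n%:R|]ger0_norm.
  have h4 : sigma * `|s + n%:R| <= sigma * (`|s| + n%:R) by rewrite ler_wpM2l.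
  have h5 : sigma * `|s| <= `|s| by rewrite ler_piMl// ltW.
  rewrite -nat1r; lra.
exists (\sum_(k < N.+1) u k) => n; rewrite -/(u n).
have hsum k : (k <= N)%N -> u k <= \sum_(k < N.+1) u k.
  move=> kN; rewrite (bigD1 (Ordinal (kN : (k < N.+1)%N)))//= lerDl.
  by rewrite sumr_ge0.
have [/hsum//|Nn] := leqP n N.
apply: le_trans (hsum N (leqnn _)); rewrite -(subnKC (ltnW Nn)).
elim: (n - N)%N => [|k IH]; first by rewrite addn0.
by rewrite addnS (le_trans (hN _ _))// leq_addr.
Qed.

Lemma bincoef_ge0 n : 0 <= s -> 0 <= bincoef n.
Proof. by move=> s0; apply: prodr_ge0 => i _; rewrite divr_ge0// addr_ge0. Qed.

(** * The binomial series at a complex point, by a differential equation along the segment from 0 *)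

Section Complex.
Variable w : R[i].
Hypothesis w1 : cabs w < 1.

Let al := complex.Re w.
Let be := complex.Im w.
Let a n := bincoef n * complex.Re (w ^+ n).
Let b n := bincoef n * complex.Im (w ^+ n).
(** A number above 1 with [rho |w| <= 1]: as power series in [t], the real and imaginary parts of
    the binomial series at [t w] then converge on a neighbourhood of [[0, 1]]. *)
Let rho := 2 / (1 + cabs w).

Let rho0 : 0 < 1 + cabs w.
Proof. by rewrite ltr_pwDl// cabs_ge0. Qed.

Let rho1 : 1 < rho.
Proof. by rewrite /rho ltr_pdivlMr// mul1r; move: w1; lra. Qed.

Let wrho : cabs w * rho <= 1.
Proof. by rewrite /rho mulrA ler_pdivrMr// mul1r; move: w1; lra. Qed.

Let radius_aux (f : nat -> R) : (forall n, `|f n| <= `|bincoef n| * cabs w ^+ n) ->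
  radius_ge f rho.
Proof.
move=> hf sigma /andP[s0 s1].
have [|M hM] := bincoef_radius (sigma := cabs w * sigma).
  rewrite mulr_ge0 ?cabs_ge0//=.
  have [->|w0] := eqVneq (cabs w) 0; first by rewrite mul0r.
  by apply: lt_le_trans wrho; rewrite ltr_pM2l// lt_def w0 cabs_ge0.
exists M => n; apply: le_trans (hM n); rewrite exprMn mulrA.
by rewrite ler_wpM2r ?exprn_ge0.
Qed.

Let ra : radius_ge a rho.
Proof.
by apply: radius_aux => n; rewrite normrM ler_wpM2l// -cabsX ge_Re.
Qed.

Let rb : radius_ge b rho.
Proof.
by apply: radius_aux => n; rewrite normrM ler_wpM2l// -cabsX ge_Im.
Qed.

Let A t := limn (pseries a t).
Let B t := limn (pseries b t).
Let A' t := limn (pseries (pseries_diffs a) t).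
Let B' t := limn (pseries (pseries_diffs b) t).

Let diffs_a n : pseries_diffs a n =
  al * (s * a n + n%:R * a n) - be * (s * b n + n%:R * b n).
Proof.
rewrite /pseries_diffs /a /b exprS ReM mulrA bincoefS -/al -/be; ring.
Qed.

Let diffs_b n : pseries_diffs b n =
  al * (s * b n + n%:R * b n) + be * (s * a n + n%:R * a n).
Proof.
rewrite /pseries_diffs /a /b exprS ImM mulrA bincoefS -/al -/be; ring.
Qed.

Let sum_n (f : nat -> R) t : radius_ge f rho -> `|t| < rho ->
  [series n%:R * f n * t ^+ n]_n @ \oo --> t * limn (pseries (pseries_diffs f) t).
Proof.
move=> fr tr.
have h := pseries_diffs_equiv (radius_ge_cvg (radius_ge_diffs fr) tr).
have : t \*o [series n%:R * f n * t ^+ n.-1]_n @ \oo --> t * limn (pseries (pseries_diffs f) t).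
  by apply: cvgMr.
rewrite (_ : t \*o _ = [series n%:R * f n * t ^+ n]_n)//.
apply/funext => n; rewrite /= /series /= mulr_sumr.
apply: eq_bigr => -[|i] _; first by rewrite !mul0r mulr0.
by rewrite exprS /=; ring.
Qed.

(** For [F = A + i B], the recursion [bincoefS] says [F' = w (s F + t F')], that is
    [(1 - t w) F' = s w F]. This is its real part, and [odeB] its imaginary part. *)
Let odeA t : `|t| < rho -> A' t = al * (s * A t + t * A' t) - be * (s * B t + t * B' t).
Proof.
move=> tr.
have c1 : pseries a t @ \oo --> A t by exact: (radius_ge_cvg ra tr).
have c2 : pseries b t @ \oo --> B t by exact: (radius_ge_cvg rb tr).
have c3 := sum_n ra tr; have c4 := sum_n rb tr.
apply: cvg_lim => //.
have -> : pseries (pseries_diffs a) t = fun n =>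
   al * (s * pseries a t n + [series n%:R * a n * t ^+ n]_n n) -
   be * (s * pseries b t n + [series n%:R * b n * t ^+ n]_n n).
  apply/funext => n; rewrite /pseries /series /= !mulr_sumr -!big_split /= !mulr_sumr -sumrB.
  by apply: eq_bigr => i _; rewrite diffs_a; ring.
by apply: cvgB; apply: cvgMr; apply: cvgD => //; apply: cvgMr.
Qed.

Let odeB t : `|t| < rho -> B' t = al * (s * B t + t * B' t) + be * (s * A t + t * A' t).
Proof.
move=> tr.
have c1 : pseries a t @ \oo --> A t by exact: (radius_ge_cvg ra tr).
have c2 : pseries b t @ \oo --> B t by exact: (radius_ge_cvg rb tr).
have c3 := sum_n ra tr; have c4 := sum_n rb tr.
apply: cvg_lim => //.
have -> : pseries (pseries_diffs b) t = fun n =>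
   al * (s * pseries b t n + [series n%:R * b n * t ^+ n]_n n) +
   be * (s * pseries a t n + [series n%:R * a n * t ^+ n]_n n).
  apply/funext => n; rewrite /pseries /series /= !mulr_sumr -!big_split /= !mulr_sumr -big_split /=.
  by apply: eq_bigr => i _; rewrite diffs_b; ring.
by apply: cvgD; apply: cvgMr; apply: cvgD => //; apply: cvgMr.
Qed.

Let u t := 1 - t * al.
Let v t := - (t * be).
(** Since [u + i v = 1 - t w] has positive real part, [G1 + i G2] is [(1 - t w)^s], written with
    [expR], [ln] and [atan] so that it can be differentiated. *)
Let G1 t := expR (s * (2^-1 * ln (u t ^+ 2 + v t ^+ 2))) * cos (s * atan (v t / u t)).
Let G2 t := expR (s * (2^-1 * ln (u t ^+ 2 + v t ^+ 2))) * sin (s * atan (v t / u t)).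

Let u0 t : `|t| < rho -> 0 < u t.
Proof.
move=> tr; rewrite subr_gt0 (le_lt_trans (ler_norm _))// normrM.
apply: le_lt_trans (_ : `|t| * cabs w < 1); first by rewrite ler_wpM2l// ge_Re.
have [->|w0] := eqVneq (cabs w) 0; first by rewrite mulr0.
by apply: lt_le_trans wrho; rewrite mulrC ltr_pM2l// lt_def w0 cabs_ge0.
Qed.

Let n0 t : `|t| < rho -> 0 < u t ^+ 2 + v t ^+ 2.
Proof. by move=> /u0 ut; rewrite ltr_pwDl ?sqr_ge0// exprn_gt0. Qed.

Let du t : is_derive t (1 : R) u (- al).
Proof.
have := is_deriveB_fun (is_derive_cst_fun 1 t)
  (is_deriveM_fun (is_derive_id t (1 : R)) (is_derive_cst_fun al t)).
by move/is_derive_eq; apply; ring.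
Qed.

Let dv t : is_derive t (1 : R) v (- be).
Proof.
have := is_deriveB_fun (is_derive_cst_fun 0 t)
  (is_deriveM_fun (is_derive_id t (1 : R)) (is_derive_cst_fun be t)).
rewrite (_ : (fun y => 0 - id y * be) = v); last by apply/funext => y; rewrite sub0r.
by move/is_derive_eq; apply; ring.
Qed.

(** [P + i Q] is [- w / (1 - t w)], the logarithmic derivative of [1 - t w]. *)
Let P t := - (al * u t + be * v t) / (u t ^+ 2 + v t ^+ 2).
Let Q t := (al * v t - be * u t) / (u t ^+ 2 + v t ^+ 2).

Let dE t : `|t| < rho -> is_derive t (1 : R)
  (fun t => expR (s * (2^-1 * ln (u t ^+ 2 + v t ^+ 2))))
  (expR (s * (2^-1 * ln (u t ^+ 2 + v t ^+ 2))) * (s * P t)).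
Proof.
move=> tr; apply: is_derive_comp_fun.
have d4 := is_deriveD_fun (is_deriveM_fun (du t) (du t)) (is_deriveM_fun (dv t) (dv t)).
have d5 := is_derive_comp_fun (g := fun t => u t ^+ 2 + v t ^+ 2) (is_derive1_ln (n0 tr)) d4.
have := is_deriveM_fun (is_derive_cst_fun s t) (is_deriveM_fun (is_derive_cst_fun 2^-1 t) d5).
move/is_derive_eq; apply; rewrite /P; have := n0 tr; move: (u t) (v t) => x y.
by move=> nn; field; rewrite gt_eqF.
Qed.

Let dT t : `|t| < rho -> is_derive t (1 : R) (fun t => s * atan (v t / u t)) (s * Q t).
Proof.
move=> tr; have ut := u0 tr; have un : u t != 0 by rewrite gt_eqF.
have d1 := is_deriveM_fun (dv t) (is_deriveV un (du t)).
have := is_deriveM_fun (is_derive_cst_fun s t) (is_derive_comp_fun (is_derive1_atan _) d1).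
move/is_derive_eq; apply; rewrite /Q; have := n0 tr; move: un.
rewrite /GRing.scale /=.
by move: (u t) (v t) => x y un nn; field; rewrite un gt_eqF//=.
Qed.

Let dG1 t : `|t| < rho -> is_derive t (1 : R) G1 (s * (P t * G1 t - Q t * G2 t)).
Proof.
move=> tr; have d1 := is_derive_comp_fun (is_derive_cos _) (dT tr).
by have := is_deriveM_fun (dE tr) d1; move/is_derive_eq; apply; rewrite /G1 /G2; ring.
Qed.

Let dG2 t : `|t| < rho -> is_derive t (1 : R) G2 (s * (P t * G2 t + Q t * G1 t)).
Proof.
move=> tr; have d1 := is_derive_comp_fun (is_derive_sin _) (dT tr).
by have := is_deriveM_fun (dE tr) d1; move/is_derive_eq; apply; rewrite /G1 /G2; ring.
Qed.

Let solve_ode t : `|t| < rho ->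
  A' t = - s * (P t * A t - Q t * B t) /\ B' t = - s * (P t * B t + Q t * A t).
Proof.
move=> tr; have n := n0 tr; have eA := odeA tr; have eB := odeB tr.
have e1 : A' t * u t - B' t * v t = s * (al * A t - be * B t).
  by rewrite /u /v mulrBr mulr1 {1}eA; ring.
have e2 : B' t * u t + A' t * v t = s * (al * B t + be * A t).
  by rewrite /u /v mulrBr mulr1 {1}eB; ring.
have nn : u t ^+ 2 + v t ^+ 2 != 0 by rewrite gt_eqF.
split; apply: (mulIf nn).
  transitivity ((A' t * u t - B' t * v t) * u t + (B' t * u t + A' t * v t) * v t); first ring.
  by rewrite e1 e2 /P /Q; field.
transitivity ((B' t * u t + A' t * v t) * u t - (A' t * u t - B' t * v t) * v t); first ring.
by rewrite e1 e2 /P /Q; field.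
Qed.

Let cst_on_01 (f : R -> R) : (forall t, `|t| < rho -> is_derive t (1 : R) f 0) -> f 1 = f 0.
Proof.
move=> df.
have tr t : t \in `[0, 1] -> `|t| < rho.
  rewrite in_itv /= => /andP[t0 t1]; rewrite ger0_norm//.
  exact: le_lt_trans t1 rho1.
have [|||c _] := @MVT R f (fun=> 0) 0 1; rewrite ?mul0r//.
- by move=> t t01; apply: df; apply: tr; exact: subset_itv_oo_cc t01.
- apply: derivable_within_continuous => t t01; apply: ex_derive; exact: df (tr _ t01).
- by move=> /eqP; rewrite subr_eq0 => /eqP.
Qed.

Let pseries0 (f : nat -> R) : limn (pseries f 0) = f 0%N.
Proof.
apply: cvg_lim => //; rewrite -(cvg_shiftS (pseries f 0)).
rewrite (_ : (fun n => _) = cst (f 0%N)); first exact: cvg_cst.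
apply/funext => n; rewrite /pseries /series /= big_nat_recl//= expr0 mulr1 big1 ?addr0//.
by move=> i _; rewrite exprS mul0r mulr0.
Qed.

Let G_at_1 : cpowr (1 - w) s = Complex (G1 1) (G2 1).
Proof.
have u1 : u 1 = complex.Re (1 - w) by rewrite /u mul1r /al; case: (w).
have v1 : v 1 = complex.Im (1 - w) by rewrite /v mul1r /be; case: (w) => x y /=; rewrite sub0r.
have r1 : `|1 : R| < rho by rewrite normr1.
have -> : cpowr (1 - w) s = (cabs (1 - w) `^ s)%:C * expi (s * atan (v 1 / u 1)).
  by rewrite u1 v1.
have -> : cabs (1 - w) `^ s = expR (s * (2^-1 * ln (u 1 ^+ 2 + v 1 ^+ 2))).
  have cp : 0 < cabs (1 - w) by rewrite cabsE sqrtr_gt0 -u1 -v1 n0.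
  rewrite /powR gt_eqF// u1 v1 -cabs_sqr; congr expR; congr (_ * _).
  have -> : ln (cabs (1 - w) ^+ 2) = 2 * ln (cabs (1 - w)) by rewrite lnXn// mulr_natl.
  by rewrite mulrA mulVf// mul1r.
by rewrite /expi; apply/eqP; rewrite eq_complex /= !mul0r subr0 addr0 !eqxx.
Qed.

(** The product of [A + i B] and [G1 + i G2] has derivative zero, because their logarithmic
    derivatives are opposite. It equals 1 at [t = 0], hence at [t = 1]. *)
Lemma binomial_sum : (cpowr (1 - w) s)^-1 = Complex (A 1) (B 1).
Proof.
have c1 := @cst_on_01 (fun t => A t * G1 t - B t * G2 t).
have c2 := @cst_on_01 (fun t => A t * G2 t + B t * G1 t).
have e0 : u 0 ^+ 2 + v 0 ^+ 2 = 1 by rewrite /u /v !mul0r subr0 oppr0 expr1n expr0n addr0.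
have g1 : G1 0 = 1 by rewrite /G1 e0 ln1 !mulr0 expR0 /v mul0r oppr0 mul0r atan0 mulr0 cos0 mulr1.
have g2 : G2 0 = 0 by rewrite /G2 e0 ln1 !mulr0 expR0 /v mul0r oppr0 mul0r atan0 mulr0 sin0 mulr0.
have a0 : A 0 = 1 by rewrite /A pseries0 /a bincoef0 expr0 mulr1.
have b0 : B 0 = 0 by rewrite /B pseries0 /b expr0 /= mulr0.
rewrite g1 g2 a0 b0 in c1 c2.
have {}c1 : A 1 * G1 1 - B 1 * G2 1 = 1.
  apply: etrans (c1 _) _; last by rewrite mul0r mulr1 subr0.
  move=> t tr; have [eA eB] := solve_ode tr.
  have dA := radius_ge_derive ra tr; have dB := radius_ge_derive rb tr.
  have := is_deriveB_fun (is_deriveM_fun dA (dG1 tr)) (is_deriveM_fun dB (dG2 tr)).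
  by move/is_derive_eq; apply; rewrite -/(A' t) -/(B' t) -/(A t) -/(B t) eA eB; ring.
have {}c2 : A 1 * G2 1 + B 1 * G1 1 = 0.
  apply: etrans (c2 _) _; last by rewrite mul0r mulr0 addr0.
  move=> t tr; have [eA eB] := solve_ode tr.
  have dA := radius_ge_derive ra tr; have dB := radius_ge_derive rb tr.
  have := is_deriveD_fun (is_deriveM_fun dA (dG2 tr)) (is_deriveM_fun dB (dG1 tr)).
  by move/is_derive_eq; apply; rewrite -/(A' t) -/(B' t) -/(A t) -/(B t) eA eB; ring.
have e : Complex (A 1) (B 1) * cpowr (1 - w) s = 1.
  by rewrite G_at_1; apply/eqP; rewrite eq_complex /= c1 c2 !eqxx.
have n : cpowr (1 - w) s != 0 by apply: contra_eq_neq e => ->; rewrite mulr0 eq_sym oner_neq0.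
by apply: (mulIf n); rewrite mulVf// e.
Qed.

Lemma binomial_series_cvg :
  (fun n => \sum_(0 <= k < n) (bincoef k * complex.Re (w ^+ k))) @ \oo --> complex.Re (cpowr (1 - w) s)^-1 /\
  (fun n => \sum_(0 <= k < n) (bincoef k * complex.Im (w ^+ k))) @ \oo --> complex.Im (cpowr (1 - w) s)^-1.
Proof.
have r1 : `|1 : R| < rho by rewrite normr1.
rewrite binomial_sum /=; split.
  have : pseries a 1 @ \oo --> A 1 by exact: (radius_ge_cvg ra r1).
  rewrite (_ : pseries a 1 = fun n => \sum_(0 <= k < n) (bincoef k * complex.Re (w ^+ k)))//.
  by apply/funext => n; rewrite /pseries /series /=; apply: eq_bigr => i _; rewrite expr1n mulr1.
have : pseries b 1 @ \oo --> B 1 by exact: (radius_ge_cvg rb r1).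
rewrite (_ : pseries b 1 = fun n => \sum_(0 <= k < n) (bincoef k * complex.Im (w ^+ k)))//.
by apply/funext => n; rewrite /pseries /series /=; apply: eq_bigr => i _; rewrite expr1n mulr1.
Qed.

End Complex.

(** The remainder after [N] terms of the series with absolute coefficients. Absolute values are
    taken because [s] may be negative, as it can be in approximating real powers; [N = 0] gives the
    full sum, which bounds the kernel. *)
Definition bintail (N : nat) (x : R) : R :=
  limn (pseries (fun n => `|bincoef n|) x) - \sum_(0 <= k < N) `|bincoef k| * x ^+ k.

Lemma bintail_cvg0 x : 0 <= x < 1 -> bintail N x @[N --> \oo] --> (0 : R).
Proof.
move=> /andP[x0 x1]; rewrite -[X in _ --> X](subrr (limn (pseries (fun n => `|bincoef n|) x))).
apply: cvgB; first exact: cvg_cst.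
have := radius_ge_cvg_norm bincoef_radius (x := x); rewrite !ger0_norm//; exact.
Qed.

Lemma binomial_tail w (x : R) N : cabs w <= x -> x < 1 ->
  cabs ((cpowr (1 - w) s)^-1 - \sum_(0 <= k < N) (bincoef k)%:C * w ^+ k) <= bintail N x.
Proof.
move=> wx x1; have x0 : 0 <= x := le_trans (cabs_ge0 w) wx.
have [cRe cIm] := binomial_series_cvg (le_lt_trans wx x1).
have cT : pseries (fun n => `|bincoef n|) x @ \oo --> limn (pseries (fun n => `|bincoef n|) x).
  by have := radius_ge_cvg_norm bincoef_radius (x := x); rewrite !ger0_norm//; exact.
pose Sm (m : nat) : R[i] := \sum_(0 <= k < m) (bincoef k)%:C * w ^+ k.
have SmE m : Sm m = Complex (\sum_(0 <= k < m) (bincoef k * complex.Re (w ^+ k)))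
   (\sum_(0 <= k < m) (bincoef k * complex.Im (w ^+ k))).
  rewrite /Sm; elim: m => [|m IH]; first by rewrite !big_geq.
  rewrite !big_nat_recr//= IH; apply/eqP; rewrite eq_complex /= ?mul0r ?subr0 ?addr0.
  by case: (w ^+ m) => x' y' /=; rewrite !mul0r subr0 addr0 !eqxx.
have fin m : (N <= m)%N -> cabs (Sm m - Sm N) <=
    pseries (fun n => `|bincoef n|) x m - \sum_(0 <= k < N) `|bincoef k| * x ^+ k.
  move=> Nm; rewrite /Sm /pseries /series /= !(big_cat_nat (leq0n N) Nm)//= addrAC subrr add0r.
  rewrite addrAC subrr add0r; elim/big_ind2 : _ => [|y1 z1 y2 z2 h1 h2|k _].
  - by rewrite cabs0.
  - by apply: le_trans (cabsD _ _) _; exact: lerD.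
  - by rewrite cabsM cabsR cabsX ler_wpM2l// lerXn2r ?nnegrE ?cabs_ge0.
have cR : complex.Re (Sm m - Sm N) @[m --> \oo] --> complex.Re ((cpowr (1 - w) s)^-1 - Sm N).
  rewrite ReD (_ : (fun m => _) = fun m =>
    \sum_(0 <= k < m) (bincoef k * complex.Re (w ^+ k)) + complex.Re (- Sm N)).
    by apply: cvgD => //; exact: cvg_cst.
  by apply/funext => m; rewrite ReD SmE.
have cI : complex.Im (Sm m - Sm N) @[m --> \oo] --> complex.Im ((cpowr (1 - w) s)^-1 - Sm N).
  rewrite ImD (_ : (fun m => _) = fun m =>
    \sum_(0 <= k < m) (bincoef k * complex.Im (w ^+ k)) + complex.Im (- Sm N)).
    by apply: cvgD => //; exact: cvg_cst.
  by apply/funext => m; rewrite ImD SmE.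
have cN : cabs (Sm m - Sm N) @[m --> \oo] --> cabs ((cpowr (1 - w) s)^-1 - Sm N).
  rewrite cabsE; under eq_fun do rewrite cabsE.
  apply: continuous_cvg; first exact: sqrt_continuous.
  by apply: cvgD; apply: cvgM.
apply: (ler_cvg_to cN).
  apply: cvgB; [exact: cT|exact: cvg_cst].
by exists N => // m /= Nm; exact: fin.
Qed.

(** The origin of the constant [(1 - r)^(-eta-2)]: for [s >= 0] the coefficients are nonnegative, so
    at a real point the partial sums stay below the sum of the series. *)
Lemma binomial_sum_le (x : R) N : 0 <= s -> 0 <= x < 1 ->
  \sum_(0 <= k < N) bincoef k * x ^+ k <= (1 - x) `^ (- s).
Proof.
move=> s0 /andP[x0 x1].
have w1 : cabs x%:C < 1 by rewrite cabsR ger0_norm.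
have [cRe _] := binomial_series_cvg w1.
have -> : (1 - x) `^ (- s) = complex.Re (cpowr (1 - x%:C) s)^-1.
  have -> : cpowr (1 - x%:C) s = ((1 - x) `^ s)%:C.
    rewrite /cpowr -(rmorph1 (real_complex R)) -rmorphB /= mul0r atan0 mulr0 /expi cos0 sin0.
    by rewrite cabsR ger0_norm ?subr_ge0 ?(ltW x1)// mulr1.
  by rewrite -fmorphV /= powRN.
have XE k : complex.Re (x%:C ^+ k) = x ^+ k by rewrite -rmorphXn.
apply: (ler_cvg_to (cvg_cst _) cRe); exists N => // m /= Nm.
under [leRHS]eq_bigr do rewrite XE.
rewrite (big_cat_nat (leq0n N) Nm)//= lerDl sumr_ge0// => k _.
by rewrite mulr_ge0 ?bincoef_ge0// exprn_ge0.
Qed.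

End BinomialSeries.

(** * Polynomial approximation of real powers *)

Section RealPowers.
Context {R : realType}.
Implicit Types (s m M x e : R).

(** Write [x = M (1 - y)] with [0 <= y <= 1 - m / M < 1]. The binomial series of [(1 - y)^s],
    truncated, is a polynomial in [x] whose error is bounded by the tail at [1 - m / M], uniformly
    in [x]. *)
Lemma powR_poly_approx s m M e : 0 < m -> 0 < M -> 0 < e ->
  exists q : {poly R}, forall x, m <= x <= M -> `|q.[x] - x `^ s| <= e.
Proof.
move=> m0 M0 e0; pose y1 := 1 - m / M.
have [Mm|mM] := ltP M m.
  by exists 0 => x /andP[h1 h2]; have := le_lt_trans (le_trans h1 h2) Mm; rewrite ltxx.
have y01 : 0 <= y1 < 1.
  by rewrite /y1 subr_ge0 ler_pdivrMr// mul1r mM/= gtrBl divr_gt0.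
have Ms : 0 < M `^ s by rewrite powR_gt0.
have /cvgrPdist_le := bintail_cvg0 (- s) y01.
move=> /(_ (e / M `^ s)); rewrite divr_gt0// => /(_ isT) [N _ hN].
exists (\sum_(k < N) (M `^ s * bincoef (- s) k) *: (1 - M^-1 *: 'X) ^+ k) => x /andP[mx xM].
have x0 : 0 < x := lt_le_trans m0 mx.
pose y := 1 - x / M.
have y0 : 0 <= y by rewrite subr_ge0 ler_pdivrMr// mul1r.
have yy1 : y <= y1 by rewrite lerD2l lerN2 ler_wpM2r// invr_ge0 ltW.
have wy : cabs y%:C <= y1 by rewrite cabsR ger0_norm.
have := binomial_tail (- s) N wy (proj2 (andP y01)).
have -> : (cpowr (1 - y%:C) (- s))^-1 = ((x / M) `^ s)%:C.
  rewrite /cpowr -(rmorph1 (real_complex R)) -rmorphB /= mul0r atan0 mulr0 /expi cos0 sin0 mulr1.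
  by rewrite -fmorphV -powRN opprK cabsR /y opprB addrC subrK ger0_norm// divr_ge0 ?ltW.
have -> : \sum_(0 <= k < N) (bincoef (- s) k)%:C * y%:C ^+ k =
   (\sum_(0 <= k < N) (bincoef (- s) k) * y ^+ k)%:C.
  by rewrite rmorph_sum; apply: eq_bigr => k _; rewrite rmorphM rmorphXn.
rewrite -rmorphB cabsR distrC => h.
have -> : (\sum_(k < N) (M `^ s * bincoef (- s) k) *: (1 - M^-1 *: 'X) ^+ k).[x] - x `^ s =
  M `^ s * (\sum_(0 <= k < N) bincoef (- s) k * y ^+ k - (x / M) `^ s).
  have -> : x `^ s = M `^ s * (x / M) `^ s.
    by rewrite -powRM ?divr_ge0 ?ltW// mulrCA divff ?mulr1// gt_eqF.
  rewrite mulrBr; congr (_ - _).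
  rewrite horner_sum big_mkord mulr_sumr; apply: eq_bigr => k _.
  rewrite hornerZ horner_exp -mulrA; congr (_ * (_ * _ ^+ _)).
  by rewrite !hornerE /y mulrC.
rewrite normrM gtr0_norm// mulrC -ler_pdivlMr// (le_trans h)//.
have := hN N (leqnn _); rewrite sub0r normrN; exact/le_trans/ler_norm.
Qed.

(** The intervals [[1 / (n + 1), n + 1]] exhaust the positive half-line, so this one sequence
    computes the power [s] of every positive, boundedly invertible operator. Strong measurability of
    [z |-> W(z)^s e] depends on this uniformity. *)
Definition powR_poly s (n : nat) : {poly R} :=
  xget 0 [set q | forall x, n.+1%:R^-1 <= x <= n.+1%:R ->
     `|q.[x] - x `^ s| <= n.+1%:R^-1].

Lemma powR_polyP s n x : n.+1%:R^-1 <= x <= n.+1%:R ->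
  `|(powR_poly s n).[x] - x `^ s| <= n.+1%:R^-1.
Proof.
have [|||q hq] := @powR_poly_approx s n.+1%:R^-1 n.+1%:R n.+1%:R^-1; rewrite ?invr_gt0//.
by move: x; rewrite /powR_poly; case: xgetP => [p _ //|/(_ q)]; case.
Qed.

Lemma powR_poly_unif s m M e : 0 < m -> 0 < e -> \forall n \near \oo,
  forall x, m <= x <= M -> `|(powR_poly s n).[x] - x `^ s| <= e.
Proof.
move=> m0 e0.
have h0 : n.+1%:R^-1 @[n --> \oo] --> (0 : R) by exact: cvg_harmonic.
have /cvgrPdist_le/(_ _ m0) hm := h0; have /cvgrPdist_le/(_ _ e0) he := h0.
pose L := `|M| + 1.
have L0 : 0 < L^-1 by rewrite invr_gt0 ltr_wpDl.
have /cvgrPdist_le/(_ _ L0) hL := h0.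
near=> n => x /andP[mx xM].
have nn (c : R) : `|0 - n.+1%:R^-1| <= c -> n.+1%:R^-1 <= c.
  by rewrite sub0r normrN => /(le_trans (ler_norm _)).
have h1 : n.+1%:R^-1 <= m by apply: nn; near: n.
have h2 : n.+1%:R^-1 <= e by apply: nn; near: n.
have h3 : n.+1%:R^-1 <= L^-1 by apply: nn; near: n.
apply: le_trans h2; apply: powR_polyP; rewrite (le_trans h1 mx)/=.
apply: le_trans xM _; rewrite lef_pV2 ?posrE// in h3; last by rewrite ltr_wpDl.
by apply: le_trans h3; rewrite (le_trans (ler_norm _))// lerDl.
Unshelve. all: end_near. Qed.

Lemma powR_bounded s m M : 0 < m -> exists K, forall x, m <= x <= M -> `|x `^ s| <= K.
Proof.
move=> m0; exists (expR (`|s| * (`|ln m| + `|ln M|))) => x /andP[mx xM].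
have x0 := lt_le_trans m0 mx; have M0 := lt_le_trans x0 xM.
rewrite ger0_norm ?powR_ge0// /powR gt_eqF// ler_expR.
rewrite (le_trans (ler_norm _))// normrM ler_wpM2l//.
have h1 : ln m <= ln x by rewrite ler_ln.
have h2 : ln x <= ln M by rewrite ler_ln.
have := ler_norm (ln M); have := ler_norm (- ln m); rewrite normrN => h3 h4.
have := normr_ge0 (ln m); have := normr_ge0 (ln M) => h5 h6.
by rewrite ler_norml; lra.
Qed.

End RealPowers.

(** * Powers of positive invertible operators *)

Section OperatorPowers.
Context {R : realType} {H : completeNormedModType R[i]}.
Variable dot : {dot H for Num.conj}.
Hypothesis hdot : hilbert_dot dot.
Hypothesis hnz : exists e : H, e != 0.
Implicit Types (A B : H -> H) (s : R) (u v : H).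

Lemma op_pow_bounded A s : bounded_op (op_pow A s).
Proof.
rewrite /op_pow; case: xgetP => [B _ []//|_]; exact: bounded_op0.
Qed.

Section Positive.
Variable A : H -> H.
Hypotheses (bA : bounded_op A) (pA : positive_op dot A) (iA : boundedly_invertible A).

Lemma powR_poly_calculus s : exists2 B, is_fun_calculus A (fun x : R => x `^ s) B &
  forall u, poly_op (powR_poly s n) A u @[n --> \oo] --> B u.
Proof.
have sA := positive_symmetric bA pA.
have [m m0 [M sp]] := spectrum_bounds hdot bA pA iA.
have [e e0|B fB cB] := fun_calculus_exists (f := fun x : R => x `^ s) (q := powR_poly s) hdot hnz bA sA.
  by apply: filterS (powR_poly_unif s M m0 e0) => n h x /sp; exact: h.
exists B => // u; apply/cvg_hnormP/cvgrPdist_le => e epos /=.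
have d0 : 0 < e / (hnorm u + 1) by rewrite divr_gt0// ltr_wpDl// hnorm_ge0.
apply: filterS (cB _ d0) => n /(_ u); rewrite sub0r normrN ger0_norm ?hnorm_ge0//.
move=> /le_trans; apply; rewrite mulrAC ler_pdivrMr ?ltr_wpDl ?hnorm_ge0//.
by rewrite ler_pM2l// lerDl.
Qed.

Lemma op_powP s : is_fun_calculus A (fun x : R => x `^ s) (op_pow A s).
Proof.
have [B fB _] := powR_poly_calculus s.
by rewrite /op_pow; case: xgetP => [C _ //|/(_ B)].
Qed.

Lemma fun_calculus_powNK s B C : is_fun_calculus A (fun x : R => x `^ s) B ->
  is_fun_calculus A (fun x : R => x `^ (- s)) C -> cancel C B.
Proof.
have sA := positive_symmetric bA pA.
have [m m0 [M sp]] := spectrum_bounds hdot bA pA iA.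
have [K hK] := powR_bounded s M m0; have [L hL] := powR_bounded (- s) M m0.
apply: (fun_calculus_inverse hdot (K := Num.max K L) hnz bA sA) => x /sp xmM.
have x0 : 0 < x by case/andP: xmM => /(lt_le_trans m0).
split; rewrite ?le_max ?hK ?hL ?orbT//.
by rewrite powRN divff// gt_eqF// powR_gt0.
Qed.

Lemma op_powNK s : cancel (op_pow A (- s)) (op_pow A s).
Proof. by apply: fun_calculus_powNK; exact: op_powP. Qed.

Lemma op_powKN s : cancel (op_pow A s) (op_pow A (- s)).
Proof. by have := @op_powNK (- s); rewrite opprK. Qed.

(** [op_pow] selects an operator obtained from some approximating sequence. It agrees with the limit
    along [powR_poly] because both operators invert [op_pow A (- s)]. *)
Lemma op_pow_cvg s u : poly_op (powR_poly s n) A u @[n --> \oo] --> op_pow A s u.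
Proof.
have [B fB cB] := powR_poly_calculus s.
suff -> : op_pow A s u = B u by exact: cB.
have h1 := fun_calculus_powNK fB (op_powP (- s)).
have h2 := op_powNK s.
by rewrite -{2}(op_powKN s u) h1.
Qed.

Lemma op_pow_symmetric s u v : rdot dot (op_pow A s u) v = rdot dot u (op_pow A s v).
Proof.
have sA := positive_symmetric bA pA.
exact: (fun_calculus_symmetric hdot sA (op_powP s)).
Qed.

End Positive.
End OperatorPowers.

(** * Integrals of functions known up to null sets *)

Lemma powR_cvg {R : realType} (q : R) (u : nat -> R) (l : R) : 0 < q ->
  (forall n, 0 <= u n) -> u @ \oo --> l -> u n `^ q @[n --> \oo] --> l `^ q.
Proof.
move=> q0 u0 ul.
have l0 : 0 <= l by apply: (ler_cvg_to (cvg_cst 0) ul); exact: nearW.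
move: l0; rewrite le_eqVlt => /orP[/eqP l0|l0]; last first.
  have c : {for l, continuous (fun x : R => expR (q * ln x))}.
    apply: continuous_comp; last exact: continuous_expR.
    by apply: continuousM; [exact: cst_continuous|exact: continuous_ln].
  have h : expR (q * ln (u n)) @[n --> \oo] --> expR (q * ln l) by exact: (continuous_cvg _ c ul).
  rewrite [X in _ --> X]/powR gt_eqF//.
  apply: (cvg_trans _ h); apply: near_eq_cvg.
  move/cvgrPdist_lt : ul => /(_ _ l0); apply: filterS => n.
  by rewrite ltr_norml => /andP[_ h']; rewrite /powR gt_eqF//; lra.
rewrite -l0 powR0 ?gt_eqF// in ul *; apply/cvgrPdist_lt => e e0.
have e1 : 0 < e `^ q^-1 by rewrite powR_gt0.
move/cvgrPdist_lt : ul => /(_ _ e1); apply: filterS => n.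
rewrite !sub0r !normrN (ger0_norm (u0 n)) ger0_norm ?powR_ge0// => h.
have -> : e = (e `^ q^-1) `^ q by rewrite -powRrM mulVf ?gt_eqF// powRr1// ltW.
by apply: gt0_ltr_powR; rewrite ?nnegrE// ltW.
Qed.

Section AlmostEverywhere.
Context {d : measure_display} {T : measurableType d} {R : realType}.
Variable mu : {measure set T -> \bar R}.
Implicit Types (f g : T -> R) (q : R).

Lemma aeP (P : T -> Prop) : {ae mu, forall z, P z} ->
  exists B, [/\ measurable B, mu B = 0%E & forall z, ~ B z -> P z].
Proof.
move=> [B [mB B0 PB]]; exists B; split=> // z Bz.
by apply: contrapT => Pz; exact: (Bz (PB z Pz)).
Qed.

Lemma aeI (P : T -> Prop) B : measurable B -> mu B = 0%E ->
  (forall z, ~ B z -> P z) -> {ae mu, forall z, P z}.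
Proof.
move=> mB B0 hP; exists B; split=> // z /= nP.
by apply: contrapT => /hP.
Qed.

Import HBNNSimple.

(* The integral of a nonnegative function is a supremum over simple functions
   below it, so no measurability is needed. *)
Lemma ge0_ae_le_integral (f g : T -> \bar R) : (forall z, 0 <= f z)%E ->
  (forall z, 0 <= g z)%E -> {ae mu, forall z, (f z <= g z)%E} ->
  (\int[mu]_z f z <= \int[mu]_z g z)%E.
Proof.
move=> f0 g0 /aeP[B [mB B0 fg]].
rewrite [in leLHS]ge0_integralTE//; apply: ge_ereal_sup => _ [h hf <-].
have mCB : measurable (~` B) by exact: measurableC.
rewrite -integralT_nnsfun.
rewrite (ge0_negligible_integral mB)//; last first.
- by move=> x _; rewrite lee_fin.
- by apply: measurableT_comp => //; exact: measurable_funPT.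
rewrite setTD (integral_nnsfun mu mCB) (mrestrict h mCB).
rewrite [in leRHS]ge0_integralTE//; apply: ereal_sup_ubound; exists (proj_nnsfun h mCB) => //= z.
rewrite mindicE; have [|] := boolP (z \in ~` B); rewrite ?mulr0// mulr1 inE /= => Bz.
by rewrite (le_trans (hf z))// fg.
Qed.

Lemma ge0_ae_eq_integral' (f g : T -> \bar R) : (forall z, 0 <= f z)%E ->
  (forall z, 0 <= g z)%E -> {ae mu, forall z, f z = g z} ->
  (\int[mu]_z f z = \int[mu]_z g z)%E.
Proof.
move=> f0 g0 fg; apply/eqP; rewrite eq_le !ge0_ae_le_integral//.
  by apply: filterS fg => z ->.
by apply: filterS fg => z ->.
Qed.

Lemma ae_integral_eq (f g : T -> \bar R) : {ae mu, forall z, f z = g z} ->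
  (\int[mu]_z f z = \int[mu]_z g z)%E.
Proof.
move=> fg; rewrite [LHS]integralE [RHS]integralE; congr (_ - _)%E;
  apply: ge0_ae_eq_integral'; rewrite ?funeposE ?funenegE//.
- by apply: filterS fg => z; rewrite !funeposE => ->.
- by apply: filterS fg => z; rewrite !funenegE => ->.
Qed.

(** The measure is not assumed complete, so an almost everywhere limit of measurable functions need
    not be measurable itself. Strong measurability therefore yields a measurable representative
    only. *)
Definition ae_measurable f := exists2 g : T -> R, measurable_fun setT g &
  {ae mu, forall z, f z = g z}.

Lemma measurable_ae_measurable f : measurable_fun setT f -> ae_measurable f.
Proof. by move=> mf; exists f => //; exact: aeW. Qed.

Lemma ae_measurable_eq f g : {ae mu, forall z, f z = g z} ->
  ae_measurable g -> ae_measurable f.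
Proof.
by move=> fg [h mh gh]; exists h => //; apply: filterS2 fg gh => z -> ->.
Qed.

Lemma ae_measurable_comp (F : R -> R) f : measurable_fun setT F ->
  ae_measurable f -> ae_measurable (fun z => F (f z)).
Proof.
move=> mF [g mg fg]; exists (F \o g); first exact: measurableT_comp.
by apply: filterS fg => z /= ->.
Qed.

Lemma ae_measurableD f g : ae_measurable f -> ae_measurable g ->
  ae_measurable (fun z => f z + g z).
Proof.
move=> [f' mf ff] [g' mg gg]; exists (fun z => f' z + g' z); first exact: measurable_funD.
by apply: filterS2 ff gg => z -> ->.
Qed.

Lemma ae_measurableM f g : ae_measurable f -> ae_measurable g ->
  ae_measurable (fun z => f z * g z).
Proof.
move=> [f' mf ff] [g' mg gg]; exists (fun z => f' z * g' z); first exact: measurable_funM.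
by apply: filterS2 ff gg => z -> ->.
Qed.

Lemma ae_measurable_cst (c : R) : ae_measurable (fun=> c).
Proof. exact/measurable_ae_measurable/measurable_cst. Qed.

Lemma ae_measurableZ (c : R) f : ae_measurable f -> ae_measurable (fun z => c * f z).
Proof. by move=> mf; apply: ae_measurableM => //; exact: ae_measurable_cst. Qed.

Lemma ae_measurableB f g : ae_measurable f -> ae_measurable g ->
  ae_measurable (fun z => f z - g z).
Proof.
move=> mf mg; have := ae_measurableD mf (ae_measurableZ (-1) mg).
by apply: ae_measurable_eq; apply: aeW => z /=; rewrite mulN1r.
Qed.

Lemma ae_measurable_powR f q : ae_measurable f -> ae_measurable (fun z => f z `^ q).
Proof. exact: (ae_measurable_comp (measurable_powR q)). Qed.

(* A common null set outside of which representatives converge everywhere. *)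
Lemma ae_cvg_rep (f_ : nat -> T -> R) f : (forall n, ae_measurable (f_ n)) ->
  {ae mu, forall z, f_ n z @[n --> \oo] --> f z} ->
  exists (g_ : nat -> T -> R) (g : T -> R), [/\ forall n, measurable_fun setT (g_ n), measurable_fun setT g,
    forall z, g_ n z @[n --> \oo] --> g z, forall n, {ae mu, forall z, f_ n z = g_ n z} &
    {ae mu, forall z, f z = g z}].
Proof.
move=> mf cf; have /choice[h hh] : forall n, exists g, measurable_fun setT g /\ {ae mu, forall z, f_ n z = g z}.
  by move=> n; have [g mg fg] := mf n; exists g.
have /aeP[B [mB B0 hB]] : {ae mu, forall z, (forall n, f_ n z = h n z) /\ f_ n z @[n --> \oo] --> f z}.
  have : {ae mu, forall z, forall n, f_ n z = h n z}.
    by apply: ae_foralln => n; exact: (hh n).2.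
  by move=> h1; apply: filterS2 h1 cf.
have mg n : measurable_fun setT (fun z => \1_(~` B) z * h n z).
  apply: measurable_funM; last exact: (hh n).1.
  exact/measurable_indic/measurableC.
have cg z : \1_(~` B) z * h n z @[n --> \oo] --> \1_(~` B) z * f z.
  rewrite indicE; have [zB|zB] := boolP (z \in ~` B).
    rewrite inE /= in zB; have [e c] := hB z zB; apply: cvgMr.
    by rewrite (_ : h ^~ z = f_ ^~ z)//; apply/funext => n; rewrite e.
  by rewrite mul0r; under eq_fun do rewrite mul0r; exact: cvg_cst.
exists (fun n z => \1_(~` B) z * h n z), (fun z => \1_(~` B) z * f z); split => //.
- by apply: (measurable_fun_cvg mg) => z _.
- move=> n; apply: (aeI mB B0) => z Bz; rewrite indicE mem_set//= mul1r.
  by have [e _] := hB z Bz.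
- by apply: (aeI mB B0) => z Bz; rewrite indicE mem_set//= mul1r.
Qed.

Lemma ae_measurable_cvg (f_ : nat -> T -> R) f : (forall n, ae_measurable (f_ n)) ->
  {ae mu, forall z, f_ n z @[n --> \oo] --> f z} -> ae_measurable f.
Proof.
by move=> mf cf; have [g_ [g [_ mg _ _ fg]]] := ae_cvg_rep mf cf; exists g.
Qed.

Definition Lpnorm q f : \bar R := ((\int[mu]_z (f z `^ q)%:E) `^ q^-1)%E.

Lemma LpnormE q f : Lpnorm q f = ((\int[mu]_z (f z `^ q)%:E) `^ q^-1)%E.
Proof. by []. Qed.

Lemma Lpnorm_ge0 q f : (0 <= Lpnorm q f)%E.
Proof. exact: poweR_ge0. Qed.

Lemma Lpnorm_ae_le q f g : 0 < q -> (forall z, 0 <= f z) -> (forall z, 0 <= g z) ->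
  {ae mu, forall z, f z <= g z} -> (Lpnorm q f <= Lpnorm q g)%E.
Proof.
move=> q0 f0 g0 fg; apply: gt0_ler_poweR.
- by rewrite invr_ge0 ltW.
- by rewrite in_itv /= leey andbT integral_ge0// => z _; rewrite lee_fin powR_ge0.
- by rewrite in_itv /= leey andbT integral_ge0// => z _; rewrite lee_fin powR_ge0.
apply: ge0_ae_le_integral => [z|z|]; rewrite ?lee_fin ?powR_ge0//.
apply: filterS fg => z fg; rewrite lee_fin; apply: ge0_ler_powR; rewrite ?nnegrE//.
exact: ltW.
Qed.

Lemma Lpnorm_ae_eq q f g : {ae mu, forall z, f z = g z} -> Lpnorm q f = Lpnorm q g.
Proof.
by move=> fg; rewrite /Lpnorm (@ae_integral_eq _ (fun z => (g z `^ q)%:E))//; apply: filterS fg => z ->.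
Qed.

Lemma Lpnorm_Lnorm q f : (forall z, 0 <= f z) -> 0 < q ->
  Lpnorm q f = Lnorm mu q%:E (EFin \o f).
Proof.
move=> f0 q0; rewrite unlock /Lpnorm; congr (_ `^ _)%E; apply: eq_integral => z _ /=.
by rewrite ger0_norm.
Qed.

Lemma Lpnorm_minkowski q f g : 1 <= q -> (forall z, 0 <= f z) -> (forall z, 0 <= g z) ->
  ae_measurable f -> ae_measurable g ->
  (Lpnorm q (fun z => f z + g z)%R <= Lpnorm q f + Lpnorm q g)%E.
Proof.
move=> q1 f0 g0 [f' mf ff] [g' mg gg]; have q0 : 0 < q by exact: lt_le_trans q1.
have mf' : measurable_fun setT (fun z => `|f' z|) by exact: measurableT_comp.
have mg' : measurable_fun setT (fun z => `|g' z|) by exact: measurableT_comp.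
have ff' : {ae mu, forall z, f z = `|f' z|} by apply: filterS ff => z <-; rewrite ger0_norm.
have gg' : {ae mu, forall z, g z = `|g' z|} by apply: filterS gg => z <-; rewrite ger0_norm.
rewrite (Lpnorm_ae_eq q ff') (Lpnorm_ae_eq q gg').
rewrite (@Lpnorm_ae_eq q _ (fun z => `|f' z| + `|g' z|)); last first.
  by apply: filterS2 ff' gg' => z -> ->.
have fg0 z : 0 <= `|f' z| + `|g' z| by rewrite addr_ge0.
rewrite !Lpnorm_Lnorm//.
exact: minkowski_EFin.
Qed.

Lemma LpnormZ q (c : R) f : 0 < q -> 0 <= c -> (forall z, 0 <= f z) -> ae_measurable f ->
  Lpnorm q (fun z => c * f z) = (c%:E * Lpnorm q f)%E.
Proof.
move=> q0 c0 f0 [f' mf ff].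
have mf' : measurable_fun setT (fun z => `|f' z|) by exact: measurableT_comp.
have ff' : {ae mu, forall z, f z = `|f' z|} by apply: filterS ff => z <-; rewrite ger0_norm.
rewrite (Lpnorm_ae_eq q ff') (@Lpnorm_ae_eq q _ (fun z => c * `|f' z|)); last first.
  by apply: filterS ff' => z ->.
rewrite /Lpnorm; under eq_integral do rewrite powRM// EFinM.
rewrite ge0_integralZl//; last first.
- by rewrite lee_fin powR_ge0.
- by apply/measurable_EFinP; apply: (measurableT_comp (measurable_powR q)).
rewrite poweRM; last 2 first.
- by rewrite lee_fin powR_ge0.
- by apply: integral_ge0 => z _; rewrite lee_fin powR_ge0.
by rewrite poweR_EFin -powRrM mulfV ?gt_eqF// powRr1.
Qed.

Lemma hoelder_ae p f g : 1 < p -> (forall z, 0 <= f z) -> (forall z, 0 <= g z) ->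
  ae_measurable f -> ae_measurable g ->
  (\int[mu]_z (f z * g z)%:E <= Lpnorm p f * Lpnorm (p / (p - 1))%R g)%E.
Proof.
move=> p1 f0 g0 [f' mf ff] [g' mg gg]; have p0 : 0 < p by exact: lt_trans p1.
have mf' : measurable_fun setT (fun z => `|f' z|) by exact: measurableT_comp.
have mg' : measurable_fun setT (fun z => `|g' z|) by exact: measurableT_comp.
have ff' : {ae mu, forall z, f z = `|f' z|} by apply: filterS ff => z <-; rewrite ger0_norm.
have gg' : {ae mu, forall z, g z = `|g' z|} by apply: filterS gg => z <-; rewrite ger0_norm.
have pp : 0 < p - 1 by rewrite subr_gt0.
rewrite (Lpnorm_ae_eq p ff') (Lpnorm_ae_eq _ gg').
rewrite (@ae_integral_eq _ (fun z => (`|f' z| * `|g' z|)%:E)); last first.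
  by apply: filterS2 ff' gg' => z -> ->.
have q0 : 0 < p / (p - 1) by rewrite divr_gt0.
rewrite !Lpnorm_Lnorm//.
have := @hoelder _ _ _ mu _ _ p (p / (p - 1)) mf' mg' p0.
rewrite divr_gt0// => /(_ isT).
have -> : p^-1 + (p / (p - 1))^-1 = 1 by field; rewrite !gt_eqF.
move=> /(_ erefl); rewrite Lnorm1; apply: le_trans.
apply: ge0_ae_le_integral => [z|z|]; rewrite ?lee_fin ?mulr_ge0//.
by apply: filterE => z; rewrite /= lee_fin; exact: ler_norm.
Qed.

Lemma limn_einf_le_bound (u : (\bar R)^nat) (C : \bar R) : (forall n, u n <= C)%E ->
  (limn_einf u <= C)%E.
Proof.
move=> uC; rewrite limn_einf_lim; apply: lime_le; first exact: is_cvg_einfs.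
apply: nearW => n; apply: le_trans (uC n); apply: ereal_inf_lbound.
by exists n => //=.
Qed.

Lemma fatou_ae (f_ : nat -> T -> R) f (C : \bar R) : (forall n z, 0 <= f_ n z) ->
  (forall n, ae_measurable (f_ n)) ->
  {ae mu, forall z, f_ n z @[n --> \oo] --> f z} -> (forall z, 0 <= f z) ->
  (forall n, \int[mu]_z (f_ n z)%:E <= C)%E -> (\int[mu]_z (f z)%:E <= C)%E.
Proof.
move=> f_0 mf cf f0 fC; have [g_ [g [mg_ mg cg fg_ fg]]] := ae_cvg_rep mf cf.
rewrite (@ae_integral_eq _ (fun z => `|g z|%:E)); last first.
  by apply: filterS fg => z <-; rewrite ger0_norm.
have e : (fun z => `|g z|%:E) = (fun z => limn_einf (fun n => `|g_ n z|%:E)).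
  apply/funext => z; have : `|g_ n z|%:E @[n --> \oo] --> `|g z|%:E.
    by apply: cvg_EFin; [exact: nearW|apply: cvg_norm; exact: cg].
  by move/cvg_limn_einf_sup => [-> _].
rewrite e; apply: le_trans (fatou _ _ _ _) _ => //.
  by move=> n; apply/measurable_EFinP; exact: measurableT_comp.
apply: limn_einf_le_bound => n; apply: le_trans (fC n).
rewrite (@ae_integral_eq (fun z => `|g_ n z|%:E) (fun z => (f_ n z)%:E))//.
by apply: filterS (fg_ n) => z <-; rewrite ger0_norm.
Qed.

Lemma Lpnorm_fatou q (f_ : nat -> T -> R) f (C : \bar R) : 0 < q -> (forall n z, 0 <= f_ n z) ->
  (forall n, ae_measurable (f_ n)) ->
  {ae mu, forall z, f_ n z @[n --> \oo] --> f z} -> (forall z, 0 <= f z) ->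
  (forall n, Lpnorm q (f_ n) <= C)%E -> (Lpnorm q f <= C)%E.
Proof.
move=> q0 f_0 mf cf f0 fC.
have i0 g : (0 <= \int[mu]_z (g z `^ q)%:E)%E.
  by apply: integral_ge0 => z _; rewrite lee_fin powR_ge0.
have C0 : (0 <= C)%E by apply: le_trans (fC 0%N); exact: Lpnorm_ge0.
have : (\int[mu]_z (f z `^ q)%:E <= C `^ q)%E.
  apply: (@fatou_ae (fun n z => f_ n z `^ q)) => //.
  - by move=> n z; exact: powR_ge0.
  - by move=> n; exact: ae_measurable_powR.
  - by apply: filterS cf => z; apply: powR_cvg.
  - by move=> z; exact: powR_ge0.
  - move=> n; have := fC n => h.
    have : (Lpnorm q (f_ n) `^ q <= C `^ q)%E.
      by apply: gt0_ler_poweR; rewrite ?in_itv/= ?leey ?andbT ?Lpnorm_ge0 ?(ltW q0).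
    by rewrite /Lpnorm -poweRrM mulVf ?gt_eqF// poweRe1.
move=> h; have : (Lpnorm q f <= (C `^ q) `^ q^-1)%E.
  by apply: gt0_ler_poweR; rewrite ?in_itv/= ?leey ?andbT ?poweR_ge0 ?invr_ge0 ?(ltW q0).
by rewrite -poweRrM mulfV ?gt_eqF// poweRe1.
Qed.

Definition ae_integrable f := ae_measurable f /\ (\int[mu]_z `|f z|%:E < +oo)%E.

Lemma ae_integrableP f : ae_integrable f ->
  exists2 g : T -> R, mu.-integrable setT (EFin \o g) & {ae mu, forall z, f z = g z}.
Proof.
move=> [[g mg fg] fi]; exists g => //; apply/integrableP; split.
  exact/measurable_EFinP.
by rewrite (@ae_integral_eq _ (fun z => `|f z|%:E))//; apply: filterS fg => z ->.
Qed.

Lemma ae_Rintegral_eq f g : {ae mu, forall z, f z = g z} ->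
  \int[mu]_z f z = \int[mu]_z g z.
Proof.
by move=> fg; congr fine; apply: ae_integral_eq; apply: filterS fg => z ->.
Qed.

Lemma ae_RintegralD f g : ae_integrable f -> ae_integrable g ->
  \int[mu]_z (f z + g z) = \int[mu]_z f z + \int[mu]_z g z.
Proof.
move=> /ae_integrableP[f' mf ff] /ae_integrableP[g' mg gg].
rewrite (ae_Rintegral_eq ff) (ae_Rintegral_eq gg) -RintegralD//.
by apply: ae_Rintegral_eq; apply: filterS2 ff gg => z -> ->.
Qed.

Lemma ae_RintegralZ (c : R) f : ae_integrable f ->
  \int[mu]_z (c * f z) = c * \int[mu]_z f z.
Proof.
move=> /ae_integrableP[f' mf ff]; rewrite (ae_Rintegral_eq ff) -RintegralZl//.
by apply: ae_Rintegral_eq; apply: filterS ff => z ->.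
Qed.

Lemma ae_Rintegral_le f (C : R) : ae_integrable f ->
  (\int[mu]_z `|f z|%:E <= C%:E)%E -> `|\int[mu]_z f z| <= C.
Proof.
move=> fi fC; have [f' mf ff] := ae_integrableP fi.
rewrite (ae_Rintegral_eq ff); apply: le_trans (le_normr_Rintegral _ mf) _ => //.
rewrite /Rintegral -lee_fin fineK; last first.
  by rewrite integrable_fin_num//; exact: integrable_norm.
apply: le_trans fC; rewrite le_eqVlt; apply/orP; left; apply/eqP.
by apply: ae_integral_eq; apply: filterS ff => z ->.
Qed.

Lemma ae_integrable_le f g : ae_measurable f -> {ae mu, forall z, `|f z| <= g z} ->
  (forall z, 0 <= g z) -> (\int[mu]_z (g z)%:E < +oo)%E -> ae_integrable f.
Proof.
move=> mf fg g0 gi; split => //; apply: le_lt_trans gi.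
by apply: ge0_ae_le_integral => [z|z|]; rewrite ?lee_fin//; apply: filterS fg => z; rewrite lee_fin.
Qed.

End AlmostEverywhere.

(* Keeps unification from comparing the integrals behind two such norms. *)
#[global] Opaque Lpnorm.

(** * Strong measurability *)

Section SimpleFunctions.
Context {R : realType} {H : completeNormedModType R[i]}.
Context {d : measure_display} {T : measurableType d}.
Variable mu : {measure set T -> \bar R}.
Implicit Types (s t : T -> H) (e v : H).

Lemma simple_fun_preimage s (A : set H) : simple_fun s -> measurable (s @^-1` A).
Proof.
move=> [fs ms].
have -> : s @^-1` A = \bigcup_(v in range s `&` A) (s @^-1` [set v]).
  apply/seteqP; split => [z Az|z [v [_ Av] /= sv]]; last by rewrite /preimage /= sv.
  by exists (s z) => //; split => //; exists z.
by apply: fin_bigcup_measurable => //; exact: finite_setIl.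
Qed.

Lemma simple_fun_cst e : simple_fun (fun _ : T => e).
Proof.
split; first by apply: (sub_finite_set _ (finite_set1 e)) => _ [z _ <-].
move=> v; have [->|ev] := eqVneq e v.
  by rewrite (_ : _ @^-1` _ = setT); [exact: measurableT|apply/seteqP].
rewrite (_ : _ @^-1` _ = set0); first exact: measurable0.
by apply/seteqP; split => // z /= /eqP; rewrite (negbTE ev).
Qed.

Lemma simple_fun_if (B : set T) s t : measurable B -> simple_fun s -> simple_fun t ->
  simple_fun (fun z => if z \in B then s z else t z).
Proof.
move=> mB hs ht; split.
  apply: (@sub_finite_set _ _ (range s `|` range t)); last by rewrite finite_setU; split; [case: hs|case: ht].
  by move=> _ [z _ <-]; case: ifP => _; [left|right]; exists z.
move=> v; rewrite (_ : _ @^-1` _ = (B `&` s @^-1` [set v]) `|` (~` B `&` t @^-1` [set v])).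
  apply: measurableU; apply: measurableI => //; [exact: hs.2|exact: measurableC|exact: ht.2].
apply/seteqP; split => z /=.
  have [|] := boolP (z \in B); rewrite ?inE ?notin_setE => zB <-; by [left|right].
by move=> [[zB <-]|[zB <-]]; [rewrite mem_set|rewrite memNset].
Qed.

Lemma simple_fun_map2 (F : H -> H -> H) s t : simple_fun s -> simple_fun t ->
  simple_fun (fun z => F (s z) (t z)).
Proof.
move=> hs ht; split.
  apply: (@sub_finite_set _ _ [set F v w | v in range s & w in range t]).
    move=> _ [z _ <-]; exists (s z); first by exists z.
    by exists (t z) => //; exists z.
  by apply: finite_image2; [case: hs|case: ht].
move=> v; rewrite (_ : _ @^-1` _ = \bigcup_(w in range s) (s @^-1` [set w] `&` t @^-1` [set y | F w y = v])).
  apply: fin_bigcup_measurable; first by case: hs.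
  by move=> w _; apply: measurableI; [exact: hs.2|exact: simple_fun_preimage].
apply/seteqP; split => z /=.
  by move=> Fv; exists (s z); [exists z|].
by move=> [w _ [/= <-]].
Qed.

Lemma measurable_simple_select (g : H -> T -> R) s : simple_fun s ->
  (forall v, measurable_fun setT (g v)) -> measurable_fun setT (fun z => g (s z) z).
Proof.
move=> hs mg _ Y mY; rewrite setTI.
rewrite (_ : _ @^-1` _ = \bigcup_(w in range s) (s @^-1` [set w] `&` g w @^-1` Y)).
  apply: fin_bigcup_measurable; first by case: hs.
  move=> w _; apply: measurableI; first exact: hs.2.
  by rewrite -[X in measurable X]setTI; exact: mg.
apply/seteqP; split => z /=.
  by move=> Fv; exists (s z); [exists z|].
by move=> [w _ [/= <-]].
Qed.

Lemma ae_finite_forall (A : set H) (P : H -> T -> Prop) : finite_set A ->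
  (forall v, A v -> {ae mu, forall z, P v z}) ->
  {ae mu, forall z, forall v, A v -> P v z}.
Proof.
move=> /finite_seqP[X ->]; elim: X => [|x X IH] hP; first by apply: aeW.
have h1 : {ae mu, forall z, P x z} by apply: hP; rewrite /= mem_head.
have h2 : {ae mu, forall z, forall v, [set` X] v -> P v z}.
  by apply: IH => v /= vX; apply: hP; rewrite /= in_cons vX orbT.
apply: filterS2 h1 h2 => z Px PX v /=; rewrite in_cons => /predU1P[->//|]; exact: PX.
Qed.

(** Each [g v] comes with its own exceptional null set, but only the finitely many values of [s] are
    selected, so the union of those that matter is null. *)
Lemma ae_measurable_simple_select (g : H -> T -> R) s : simple_fun s ->
  (forall v, ae_measurable mu (g v)) -> ae_measurable mu (fun z => g (s z) z).
Proof.
move=> hs mg; have /choice[g' hg'] : forall v, exists g' : T -> R,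
    measurable_fun setT g' /\ {ae mu, forall z, g v z = g' z}.
  by move=> v; have [g' ? ?] := mg v; exists g'.
exists (fun z => g' (s z) z); first by apply: measurable_simple_select => // v; exact: (hg' v).1.
have : {ae mu, forall z, forall v, range s v -> g v z = g' v z}.
  by apply: ae_finite_forall => [|v _]; [exact: hs.1|exact: (hg' v).2].
by apply: filterS => z; apply; exists z.
Qed.

Lemma measurable_simple_fun (phi : H -> R) s : simple_fun s ->
  measurable_fun setT (fun z => phi (s z)).
Proof. by move=> hs; apply: (measurable_simple_select (g := fun v _ => phi v)). Qed.

End SimpleFunctions.

(** * Strong measurability in a separable space *)

Section StrongMeasurability.
Context {R : realType} {H : completeNormedModType R[i]}.
Variable dot : {dot H for Num.conj}.
Hypothesis hdot : hilbert_dot dot.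
Hypothesis hsep : separable H.
Context {d : measure_display} {T : measurableType d}.
Variable mu : {measure set T -> \bar R}.
Implicit Types (s t : T -> H) (e v : H) (f g : T -> H).

Local Notation rdot := (rdot dot).
Local Notation smeas := (strongly_measurable mu).

Lemma dense_sequence : exists dn : nat -> H, forall (x : H) (eps : R), 0 < eps ->
  exists n, hnorm (x - dn n) < eps.
Proof.
have [D cD dD] := hsep; have /countable_injP[k kinj] := cD.
(* The inverse of the injection [k] of the dense set into the natural numbers; indices that are not
   hit get the harmless value 0. *)
pose dn n := xget 0 [set x | D x /\ k x = n].
exists dn => x eps eps0.
have eps0' : (0 : R[i]) < eps%:C by rewrite ltcR.
have [||y [Oy Dy]] := dD (ball x eps%:C)°.
- by exists x; apply: nbhsx_ballx.
- exact: open_interior.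
exists (k y); have -> : dn (k y) = y.
  rewrite /dn; case: xgetP => [z _ [Dz kz]|/(_ y)]; last by case.
  by apply: kinj; rewrite ?inE.
have := interior_subset Oy; rewrite -ball_normE /= normhE ltcR; exact.
Qed.

Lemma smeas_fun (phi : H -> R) f : smeas f ->
  (forall (u : nat -> H) v, u @ \oo --> v -> phi (u n) @[n --> \oo] --> phi v) ->
  ae_measurable mu (fun z => phi (f z)).
Proof.
move=> [s hs sf] cphi; apply: (@ae_measurable_cvg _ _ _ _ (fun n z => phi (s n z))).
  by move=> n; apply: measurable_ae_measurable; exact: measurable_simple_fun.
by apply: filterS sf => z; exact: cphi.
Qed.

Lemma smeas_hnorm f : smeas f -> ae_measurable mu (fun z => hnorm (f z)).
Proof. by move=> mf; apply: smeas_fun => // u v uv; exact: cvg_hnorm. Qed.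

Lemma smeas_dist f e : smeas f -> ae_measurable mu (fun z => hnorm (f z - e)).
Proof.
move=> mf; apply: (smeas_fun (phi := fun v => hnorm (v - e))) => // u v uv.
by apply: cvg_hnorm; apply: cvgB => //; exact: cvg_cst.
Qed.

Lemma smeas_rdot f h : smeas f -> ae_measurable mu (fun z => rdot (f z) h).
Proof. by move=> mf; apply: (smeas_fun (phi := rdot^~ h)) => // u v uv; exact: cvg_rdot. Qed.

(* Approximate [f z] by the closest among the first n points of a dense sequence. *)
Lemma smeas_char f : (forall e, ae_measurable mu (fun z => hnorm (f z - e))) -> smeas f.
Proof.
move=> mf; have [dn hd] := dense_sequence.
have /choice[g hg] : forall n, exists g : T -> R, measurable_fun setT g /\
    {ae mu, forall z, hnorm (f z - dn n) = g z}.
  by move=> n; have [g mg fg] := mf (dn n); exists g.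
(* [st n] carries the closest among [dn 0, ..., dn n] and the representative of its distance to
   [f z]; [B n] is where the next point is strictly closer. Working with the representatives [g]
   keeps the sets [B n] measurable. *)
pose B n (st : (T -> H) * (T -> R)) := [set z | g n.+1 z < st.2 z].
pose st := fix st n : (T -> H) * (T -> R) := match n with
  | 0%N => (fun=> dn 0%N, g 0%N)
  | n.+1 => (fun z => if z \in B n (st n) then dn n.+1 else (st n).1 z,
           fun z => if z \in B n (st n) then g n.+1 z else (st n).2 z) end.
have inv n : simple_fun (st n).1 /\ measurable_fun setT (st n).2.
  elim: n => [|n [IH1 IH2]] /=; first by split; [exact: simple_fun_cst|exact: (hg 0%N).1].
  have mb : measurable_fun setT (fun z => g n.+1 z < (st n).2 z).
    by apply: measurable_fun_ltr => //; exact: (hg n.+1).1.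
  have mB : measurable (B n (st n)).
    have := mb measurableT [set true] I; rewrite setTI.
    by congr (measurable _); apply/seteqP.
  split; first exact: simple_fun_if mB (simple_fun_cst _) IH1.
  apply: measurable_fun_ifT => //; last exact: (hg n.+1).1.
  rewrite (_ : (fun z => z \in B n (st n)) = (fun z => g n.+1 z < (st n).2 z))//.
  by apply/funext => z; apply/idP/idP; rewrite inE.
exists (fun n => (st n).1); first by move=> n; exact: (inv n).1.
have : {ae mu, forall z, forall n, hnorm (f z - dn n) = g n z}.
  by apply: ae_foralln => n; exact: (hg n).2.
apply: filterS => z fz.
have e1 n : hnorm (f z - (st n).1 z) = (st n).2 z.
  by elim: n => [|n IH] /=; [exact: fz|case: ifP].
have e2 n k : (k <= n)%N -> (st n).2 z <= g k z.
  elim: n => [|n IH] /=; first by rewrite leqn0 => /eqP ->.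
  have [|] := boolP (z \in B n (st n)); rewrite ?inE ?notin_setE /B /= => zB.
    by rewrite leq_eqVlt => /predU1P[->//|/IH h]; exact: le_trans (ltW zB) h.
  move/negP: zB; rewrite -leNgt => zB.
  by rewrite leq_eqVlt => /predU1P[->//|/IH].
apply/cvg_hnormP/cvgrPdist_lt => eps eps0; have [N hN] := hd (f z) eps eps0.
exists N => // n /= Nn; rewrite sub0r normrN ger0_norm ?hnorm_ge0//.
by rewrite hnormBC e1 (le_lt_trans (e2 _ _ Nn))// -fz.
Qed.

Lemma smeas_cvg (f_ : nat -> T -> H) f : (forall n, smeas (f_ n)) ->
  {ae mu, forall z, f_ n z @[n --> \oo] --> f z} -> smeas f.
Proof.
move=> mf cf; apply: smeas_char => e.
apply: (@ae_measurable_cvg _ _ _ _ (fun n z => hnorm (f_ n z - e))).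
  by move=> n; exact: smeas_dist.
apply: filterS cf => z cz; apply: cvg_hnorm; apply: cvgB => //; exact: cvg_cst.
Qed.

Lemma smeas_eq f g : {ae mu, forall z, f z = g z} -> smeas g -> smeas f.
Proof.
by move=> fg [s hs sg]; exists s => //; apply: filterS2 fg sg => z ->.
Qed.

Lemma smeas_simple s : simple_fun s -> smeas s.
Proof. by move=> hs; exists (fun=> s) => //; apply: aeW => z; exact: cvg_cst. Qed.

Lemma smeas_cst e : smeas (fun=> e).
Proof. exact/smeas_simple/simple_fun_cst. Qed.

Lemma smeasD f g : smeas f -> smeas g -> smeas (fun z => f z + g z).
Proof.
move=> [s hs sf] [t ht tg]; exists (fun n z => s n z + t n z).
  by move=> n; exact: simple_fun_map2.
by apply: filterS2 sf tg => z; exact: cvgD.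
Qed.

Lemma smeas_indic (D : set T) f : measurable D -> smeas f ->
  smeas (fun z => if z \in D then f z else 0).
Proof.
move=> mD [s hs sf]; exists (fun n z => if z \in D then s n z else 0).
  by move=> n; apply: simple_fun_if => //; exact: simple_fun_cst.
by apply: filterS sf => z cz; case: ifP => // _; exact: cvg_cst.
Qed.

(** By [smeas_char] only distances to fixed vectors matter. Expanding the square of [|a f - e|]
    expresses them through the real and imaginary parts of [a], the norm of [f] and pairings of [f]
    with [e] and ['i *: e]. *)
Lemma smeasZ (a : T -> R[i]) f : ae_measurable mu (fun z => complex.Re (a z)) ->
  ae_measurable mu (fun z => complex.Im (a z)) -> smeas f ->
  smeas (fun z => a z *: f z).
Proof.
move=> ma mb mf; apply: smeas_char => e.
have E z : hnorm (a z *: f z - e) = Num.sqrt (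
   (complex.Re (a z) * complex.Re (a z) + complex.Im (a z) * complex.Im (a z)) * (hnorm (f z) * hnorm (f z)) -
   2 * (complex.Re (a z) * rdot (f z) e - complex.Im (a z) * rdot (f z) ('i *: e)) + hnorm e * hnorm e).
  rewrite -[LHS]ger0_norm ?hnorm_ge0// -sqrtr_sqr (hnorm_sqrB hdot) hnormZ exprMn cabs_sqr.
  congr Num.sqrt; rewrite !expr2; congr (_ - 2 * _ + _).
  rewrite {1}(complexE (a z)) scalerDl -scalerA rdotDl rdotZl; congr (_ + _).
  by rewrite rdot_iJ rdotZl.
apply: (@ae_measurable_eq _ _ _ _ _ (fun z => Num.sqrt _)); first by apply: aeW => z; exact: E.
apply: (ae_measurable_comp (F := Num.sqrt)).
  exact: (continuous_measurable_fun (@sqrt_continuous R)).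
apply: ae_measurableD; last exact: ae_measurable_cst.
apply: ae_measurableB.
  by apply: ae_measurableM; [apply: ae_measurableD|]; apply: ae_measurableM => //; exact: smeas_hnorm.
by apply: ae_measurableZ; apply: ae_measurableB; apply: ae_measurableM => //; exact: smeas_rdot.
Qed.

Lemma smeasZ_cst (a : R[i]) f : smeas f -> smeas (fun z => a *: f z).
Proof. by apply: smeasZ; exact: ae_measurable_cst. Qed.

Lemma smeas_op (W : T -> H -> H) f : {ae mu, forall z, bounded_op (W z)} ->
  (forall e, smeas (fun z => W z e)) -> smeas f -> smeas (fun z => W z (f z)).
Proof.
move=> bW mW [s hs sf]; apply: (@smeas_cvg (fun n z => W z (s n z))).
  move=> n; apply: smeas_char => e.
  by apply: (ae_measurable_simple_select (g := fun v z => hnorm (W z v - e))) => // v; exact: smeas_dist.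
by apply: filterS2 bW sf => z; exact: bounded_op_cvg.
Qed.

Lemma smeas_poly_op (W : T -> H -> H) (q : {poly R}) e : {ae mu, forall z, bounded_op (W z)} ->
  (forall e, smeas (fun z => W z e)) -> smeas (fun z => poly_op q (W z) e).
Proof.
move=> bW mW; rewrite /poly_op.
have mk k : smeas (fun z => iter k (W z) e).
  by elim: k => [|k IH] /=; [exact: smeas_cst|exact: smeas_op].
elim: (index_enum _) => [|k l IH].
  by under eq_fun do rewrite big_nil; exact: smeas_cst.
under eq_fun do rewrite big_cons; apply: smeasD => //; exact: smeasZ_cst.
Qed.

Definition good_op (A : H -> H) :=
  [/\ bounded_op A, positive_op dot A & boundedly_invertible A].

Lemma smeas_op_pow (W : T -> H -> H) (s : R) f : (exists e : H, e != 0) ->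
  {ae mu, forall z, good_op (W z)} -> (forall e, smeas (fun z => W z e)) ->
  smeas f -> smeas (fun z => op_pow (W z) s (f z)).
Proof.
move=> hnz gW mW mf; apply: (@smeas_op (fun z => op_pow (W z) s)) => //; first by apply: aeW => z; exact: op_pow_bounded.
move=> e; apply: (@smeas_cvg (fun n z => poly_op (powR_poly s n) (W z) e)).
  by move=> n; apply: smeas_poly_op => //; apply: filterS gW => z [].
by apply: filterS gW => z [bW pW iW]; exact: (op_pow_cvg hdot).
Qed.

End StrongMeasurability.

(** * Weak and Bochner integrals *)

Section UniformBoundedness.
Context {R : realType} {H : completeNormedModType R[i]}.
Implicit Types (x y v : H).

(* Baire's argument: were [N] unbounded on the unit ball, nested closed balls
   on which [N > n] would meet in a point. *)
Lemma seminorm_bounded (N : H -> R) :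
  (forall x y, N (x + y) <= N x + N y) ->
  (forall (t : R) x, N (t%:C *: x) = `|t| * N x) ->
  (forall (u : nat -> H) v (c : R), (forall n, N (u n) <= c) -> u @ \oo --> v -> N v <= c) ->
  exists2 C, 0 <= C & forall x, N x <= C * hnorm x.
Proof.
move=> ND NZ Nlsc; apply: contrapT => nC.
have N0 : N 0 = 0 by rewrite -(scale0r (0 : H)) -(rmorph0 (real_complex R)) NZ normr0 mul0r.
have NN x : N (- x) = N x.
  by rewrite -scaleN1r -(rmorph1 (real_complex R)) -rmorphN NZ normrN normr1 mul1r.
have Nge x : 0 <= N x.
  by have := ND x (- x); rewrite subrr N0 NN -mulr2n pmulrn_lge0.
have big (K r : R) : 0 <= K -> 0 < r -> exists2 x, hnorm x <= r & K < N x.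
  move=> K0 r0; apply: contrapT => nx; apply: nC; exists (K / r); first by rewrite divr_ge0// ltW.
  move=> x; have [->|x0] := eqVneq x 0; first by rewrite N0 hnorm0 mulr0.
  have nx0 : 0 < hnorm x by rewrite hnorm_gt0.
  rewrite leNgt; apply/negP => h; apply: nx.
  have t0 : 0 < r / hnorm x by rewrite divr_gt0.
  exists ((r / hnorm x)%:C *: x); first by rewrite hnormZR gtr0_norm// divfK ?gt_eqF.
  rewrite NZ gtr0_norm// mulrC; move: h.
  by rewrite -(ltr_pM2r t0); apply: le_lt_trans; rewrite le_eqVlt; apply/orP; left; apply/eqP; field; rewrite !gt_eqF.
have opn x (K : R) : K < N x -> exists2 r, 0 < r & forall y, hnorm (y - x) <= r -> K < N y.
  move=> Kx; apply: contrapT => nr.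
  have /choice[u hu] : forall n, exists y, hnorm (y - x) <= n.+1%:R^-1 /\ N y <= K.
    move=> n; apply: contrapT => ny; apply: nr; exists n.+1%:R^-1; first by rewrite invr_gt0.
    by move=> y yx; rewrite ltNge; apply/negP => Ny; apply: ny; exists y.
  have : N x <= K.
    apply: (Nlsc u) => [n|]; first exact: (hu n).2.
    apply/cvg_hnormP; apply: (@cvg_dist_le _ _ _ _ _ (fun n => n.+1%:R^-1)).
      by apply: nearW => n; rewrite subr0 ger0_norm ?hnorm_ge0//; exact: (hu n).1.
    exact: cvg_harmonic.
  by rewrite leNgt Kx.
(* One refinement of the ball [(x, r)], to a ball of at most half the radius on which [N > n].
   Positivity of the radius is a premise inside the statement, so that [choice] returns a total
   function. *)
have step (nxr : nat * (H * R)) : exists yr : H * R, 0 < nxr.2.2 ->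
    [/\ 0 < yr.2, yr.2 <= nxr.2.2 / 2,
      forall z, hnorm (z - yr.1) <= yr.2 -> hnorm (z - nxr.2.1) <= nxr.2.2 &
      forall z, hnorm (z - yr.1) <= yr.2 -> nxr.1%:R < N z].
  case: nxr => n [x r] /=; have [r0|r0] := ltP 0 r; last by exists (x, r).
  have r2 : 0 < r / 2 by rewrite divr_gt0.
  have [y yr Ny] := @big n%:R (r / 2) (ler0n _ _) r2.
  (* Since [2 N y <= N (x + y) + N (x - y)] and [N y > n], at least one of [x + y] and [x - y] has
     [N] above [n]. *)
  have [w wx Nw] : exists2 w, hnorm (w - x) <= r / 2 & n%:R < N w.
    have [h|h] := ltP n%:R (N (x + y)).
      by exists (x + y) => //; rewrite addrAC subrr add0r.
    exists (x - y); first by rewrite addrAC subrr add0r hnormN.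
    have : N ((2 : R)%:C *: y) <= N (x + y) + N (x - y).
      rewrite -[N (x - y)]NN opprB; apply: le_trans (ND _ _).
      rewrite [x + y]addrC addrACA subrr addr0 rmorphD rmorph1 scalerDl scale1r.
      exact: lexx.
    rewrite NZ ger0_norm//; lra.
  have [q q0 hq] := opn _ _ Nw.
  exists (w, Num.min q (r / 2)) => _; split => /=.
  - by rewrite lt_min q0.
  - by rewrite ge_min lexx orbT.
  - move=> z; rewrite le_min => /andP[_ h].
    by rewrite (le_trans (hnorm_tri w _ _))// [leRHS]splitr lerD.
  - by move=> z; rewrite le_min => /andP[h _]; exact: hq.
have [S hS] := choice step.
pose b := fix b n : H * R := if n is n.+1 then S (n, b n) else (0, 1).
have bpos n : 0 < (b n).2.
  by elim: n => [|n IH] //=; have [] := hS (n, b n) IH.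
have brad n : (b n).2 <= 2^-1 ^+ n.
  elim: n => [|n IH] /=; first by rewrite expr0.
  have [_ h _ _] := hS (n, b n) (bpos n).
  by rewrite (le_trans h)// exprS mulrC ler_wpM2l.
have bnest n m z : (n <= m)%N -> hnorm (z - (b m).1) <= (b m).2 -> hnorm (z - (b n).1) <= (b n).2.
  move=> /subnKC <-; elim: (m - n)%N => [|k IH]; first by rewrite addn0.
  rewrite addnS => h; apply: IH; have [_ _ h' _] := hS ((n + k)%N, b (n + k)%N) (bpos _).
  exact: h'.
have bself n : hnorm ((b n).1 - (b n).1) <= (b n).2 by rewrite subrr hnorm0 ltW.
have [v bv] : exists v : H, (fun n => (b n).1) @ \oo --> v.
  apply: (@hcauchy _ _ _ (fun n => 2^-1 ^+ n)).
    by move=> n m nm; rewrite (le_trans _ (brad n))// (bnest n m)//.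
  by apply: cvg_expr; rewrite ger0_norm// invf_lt1// ltr1n.
have vin n : hnorm (v - (b n).1) <= (b n).2.
  have c : hnorm ((b m).1 - (b n).1) @[m --> \oo] --> hnorm (v - (b n).1).
    by apply: cvg_hnorm; apply: cvgB => //; exact: cvg_cst.
  apply: (ler_cvg_to c (cvg_cst _)); exists n => // m /= nm; exact: (bnest n m).
have Nv n : n%:R < N v.
  have [_ _ _ h] := hS (n, b n) (bpos n); apply: h; exact: (vin n.+1).
have := Nv (Num.truncn (N v)).+1; apply/negP; rewrite -leNgt ltW//.
exact: truncnS_gt.
Qed.

End UniformBoundedness.

(** * Weighted norms given by operator fields, and weak integrals *)

Section OperatorFields.
Context {R : realType} {H : completeNormedModType R[i]}.
Variable dot : {dot H for Num.conj}.
Hypothesis hdot : hilbert_dot dot.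
Hypothesis hsep : separable H.
Context {d : measure_display} {T : measurableType d}.
Variable mu : {measure set T -> \bar R}.
Implicit Types (f g : T -> H) (v h : H).

Local Notation rdot := (rdot dot).
Local Notation smeas := (strongly_measurable mu).

Definition Lpop (q : R) (A : T -> H -> H) f := Lpnorm mu q (fun z => hnorm (A z (f z))).

Section Field.
Variables (q : R) (A : T -> H -> H).
Hypotheses (q1 : 1 <= q) (bA : {ae mu, forall z, bounded_op (A z)})
  (mA : forall f, smeas f -> smeas (fun z => A z (f z))).

Let q0 : 0 < q := lt_le_trans ltr01 q1.

Lemma Lpop_ge0 f : (0 <= Lpop q A f)%E.
Proof. exact: Lpnorm_ge0. Qed.

Lemma Lpop_eq f g : {ae mu, forall z, f z = g z} -> Lpop q A f = Lpop q A g.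
Proof. by move=> fg; apply: Lpnorm_ae_eq; apply: filterS fg => z ->. Qed.

Lemma LpopD f g : smeas f -> smeas g ->
  (Lpop q A (fun z => f z + g z)%R <= Lpop q A f + Lpop q A g)%E.
Proof.
move=> mf mg; apply: le_trans (Lpnorm_minkowski q1 _ _ _ _) => //; last 4 first.
- by move=> z; exact: hnorm_ge0.
- by move=> z; exact: hnorm_ge0.
- by apply: smeas_hnorm; exact: mA.
- by apply: smeas_hnorm; exact: mA.
apply: Lpnorm_ae_le => //.
- by move=> z; exact: hnorm_ge0.
- by move=> z; rewrite addr_ge0 ?hnorm_ge0.
- by apply: filterS bA => z [lA _]; rewrite linear_funD// hnormD.
Qed.

Lemma Lpop_dom (M : R) f g : 0 <= M -> smeas g ->
  {ae mu, forall z, exists2 a : R[i], cabs a <= M & f z = a *: g z} ->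
  (Lpop q A f <= M%:E * Lpop q A g)%E.
Proof.
move=> M0 mg fg; rewrite /Lpop -LpnormZ//; last 2 first.
- by move=> z; exact: hnorm_ge0.
- by apply: smeas_hnorm; exact: mA.
apply: Lpnorm_ae_le => //.
- by move=> z; exact: hnorm_ge0.
- by move=> z; rewrite mulr_ge0 ?hnorm_ge0.
apply: filterS2 bA fg => z [lA _] [a aM ->].
by rewrite linear_funZ// hnormZ ler_wpM2r ?hnorm_ge0.
Qed.

Lemma Lpop_fatou (f_ : nat -> T -> H) f (C : \bar R) : (forall n, smeas (f_ n)) ->
  {ae mu, forall z, f_ n z @[n --> \oo] --> f z} ->
  (forall n, Lpop q A (f_ n) <= C)%E -> (Lpop q A f <= C)%E.
Proof.
move=> mf cf; apply: Lpnorm_fatou => //.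
- by move=> n z; exact: hnorm_ge0.
- by move=> n; apply: smeas_hnorm; exact: mA.
- apply: filterS2 bA cf => z bz cz; apply: cvg_hnorm; exact: bounded_op_cvg.
- by move=> z; exact: hnorm_ge0.
Qed.

(** Finiteness is assumed for each vector separately. The norm of constants is a seminorm on [H],
    lower semicontinuous by Fatou's lemma, so [seminorm_bounded] makes the bound uniform. *)
Lemma Lpop_bounded : (forall e, Lpop q A (fun=> e) < +oo)%E ->
  exists2 C : R, 0 <= C & forall e, (Lpop q A (fun=> e) <= (C * hnorm e)%:E)%E.
Proof.
move=> fin.
have /choice[nf nfE] : forall e, exists r : R, Lpop q A (fun=> e) = r%:E.
  by move=> e; exists (fine (Lpop q A (fun=> e))); rewrite fineK// ge0_fin_numE ?Lpop_ge0.
have nfD x y : nf (x + y) <= nf x + nf y.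
  have := LpopD (smeas_cst mu x) (smeas_cst mu y).
  by rewrite nfE (nfE x) (nfE y) -EFinD lee_fin.
have nfZ (t : R) x : nf (t%:C *: x) = `|t| * nf x.
  apply: EFin_inj; rewrite -nfE EFinM -nfE.
  rewrite -[RHS](LpnormZ q0 (normr_ge0 t)); last 2 first.
  - by move=> z; exact: hnorm_ge0.
  - by apply: smeas_hnorm; apply: mA; exact: smeas_cst.
  by apply: Lpnorm_ae_eq; apply: filterS bA => z [lA _]; rewrite linear_funZ// hnormZR.
have nfc (u : nat -> H) v (c : R) : (forall n, nf (u n) <= c) -> u @ \oo --> v -> nf v <= c.
  move=> uc uv; rewrite -lee_fin -nfE.
  apply: (Lpop_fatou (f_ := fun n _ => u n)) => [n||n]; first exact: smeas_cst.
    exact: aeW.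
  by rewrite nfE lee_fin.
have [C C0 hC] := seminorm_bounded nfD nfZ nfc.
by exists C => // e; rewrite nfE lee_fin.
Qed.

Definition Lpop_const : \bar R :=
  ereal_sup [set Lpop q A (fun=> e) | e in [set e : H | hnorm e = 1]].

Lemma Lpop_constP : (exists e : H, e != 0) -> (forall e, Lpop q A (fun=> e) < +oo)%E ->
  exists2 C : R, 0 <= C & Lpop_const = C%:E /\
    forall e, (Lpop q A (fun=> e) <= (C * hnorm e)%:E)%E.
Proof.
move=> [e0 e00] fin; have [C C0 hC] := Lpop_bounded fin.
have n0 : 0 < hnorm e0 by rewrite hnorm_gt0.
have ge0 : (0 <= Lpop_const)%E.
  apply: (@le_trans _ _ (Lpop q A (fun=> (hnorm e0)^-1%:C *: e0))); first exact: Lpop_ge0.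
  apply: ereal_sup_ubound; exists ((hnorm e0)^-1%:C *: e0) => //=.
  by rewrite hnormZR gtr0_norm ?invr_gt0// mulVf ?gt_eqF.
have leC : (Lpop_const <= C%:E)%E.
  by apply: ge_ereal_sup => _ [e /= e1 <-]; rewrite (le_trans (hC e))// e1 mulr1.
have cE : Lpop_const = (fine Lpop_const)%:E.
  by rewrite fineK// ge0_fin_numE// (le_lt_trans leC)// ltry.
exists (fine Lpop_const); first by rewrite fine_ge0.
split => // e; have [->|en] := eqVneq e 0.
  rewrite hnorm0 mulr0 (le_trans (hC 0))//; by rewrite hnorm0 mulr0.
have ne : 0 < hnorm e by rewrite hnorm_gt0.
rewrite mulrC EFinM -cE.
apply: (@le_trans _ _ ((hnorm e)%:E * Lpop q A (fun=> (hnorm e)^-1%:C *: e))%E).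
  apply: Lpop_dom; [exact: ltW|exact: smeas_cst|].
  apply: aeW => z; exists (hnorm e)%:C; first by rewrite cabsR gtr0_norm.
  by rewrite scalerA -rmorphM mulfV ?gt_eqF// rmorph1 scale1r.
apply: lee_wpmul2l; first by rewrite lee_fin ltW.
apply: ereal_sup_ubound; exists ((hnorm e)^-1%:C *: e) => //=.
by rewrite hnormZR gtr0_norm ?invr_gt0// mulVf ?gt_eqF.
Qed.

End Field.

(** Real pairings determine [v]: testing with ['i *: h] covers the imaginary part. *)
Definition weak_integral f v := forall h, rdot v h = \int[mu]_z rdot (f z) h.

Definition weakly_integrable f := forall h, ae_integrable mu (fun z => rdot (f z) h).

Lemma weak_integral_inj f v w : weak_integral f v -> weak_integral f w -> v = w.
Proof. by move=> fv fw; apply: (rdot_ext hdot) => h; rewrite fv fw. Qed.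

Lemma weak_integral_eq f g v : {ae mu, forall z, f z = g z} ->
  weak_integral f v -> weak_integral g v.
Proof.
move=> fg fv h; rewrite fv; apply: ae_Rintegral_eq.
by apply: filterS fg => z ->.
Qed.

Lemma weak_integralD f g v w : weakly_integrable f -> weakly_integrable g ->
  weak_integral f v -> weak_integral g w -> weak_integral (fun z => f z + g z) (v + w).
Proof.
move=> fi gi fv gw h; rewrite rdotDl fv gw -ae_RintegralD//.
by apply: ae_Rintegral_eq; apply: aeW => z /=; rewrite rdotDl.
Qed.

Lemma weak_integralZ (a : R[i]) f v : weak_integral f v ->
  weak_integral (fun z => a *: f z) (a *: v).
Proof.
move=> fv h; rewrite rdotZJ fv; apply: ae_Rintegral_eq.
by apply: aeW => z /=; rewrite rdotZJ.
Qed.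

Lemma weakly_integrableD f g : weakly_integrable f -> weakly_integrable g ->
  weakly_integrable (fun z => f z + g z).
Proof.
move=> fi gi h; have [mf If] := fi h; have [mg Ig] := gi h.
have e : {ae mu, forall z, rdot (f z + g z) h = rdot (f z) h + rdot (g z) h}.
  by apply: aeW => z; rewrite rdotDl.
have mfg : ae_measurable mu (fun z => rdot (f z + g z) h).
  by apply: ae_measurable_eq e _; exact: ae_measurableD.
have [f' If' ff] := ae_integrableP (fi h); have [g' Ig' gg] := ae_integrableP (gi h).
split => //; rewrite (@ae_integral_eq _ _ _ mu _ (fun z => `|((f' z)%:E + (g' z)%:E)|)%E).
  by have /integrableP[] := integrableD measurableT If' Ig'.
by apply: filterS3 e ff gg => z -> -> ->.
Qed.

Lemma weakly_integrableZ (a : R[i]) f : weakly_integrable f ->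
  weakly_integrable (fun z => a *: f z).
Proof.
move=> fi h; have := fi (a^* *: h); rewrite /ae_integrable.
rewrite (_ : (fun z => rdot (f z) (a^* *: h)) = (fun z => rdot (a *: f z) h)).
  rewrite (_ : (fun z => `|rdot (f z) (a^* *: h)|%:E) = (fun z => `|rdot (a *: f z) h|%:E))//.
  by apply/funext => z; rewrite rdotZJ.
by apply/funext => z; rewrite rdotZJ.
Qed.

(** Riesz representation of [h |-> int <f, h>]. Only the pairings are assumed integrable, so this
    covers functions whose norm is not. *)
Lemma weak_integral_exists f (C : R) : 0 <= C -> smeas f ->
  (forall h, \int[mu]_z `|rdot (f z) h|%:E <= (C * hnorm h)%:E)%E ->
  weakly_integrable f /\ exists2 v, weak_integral f v & hnorm v <= C.
Proof.
move=> C0 mf fC.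
have fi : weakly_integrable f.
  move=> h; split; first exact: smeas_rdot.
  by apply: le_lt_trans (fC h) _; rewrite ltry.
split=> //; have [|||v hv vC] := @riesz _ _ dot hdot (fun h => \int[mu]_z rdot (f z) h) C C0.
- move=> x y; rewrite -ae_RintegralD//; apply: ae_Rintegral_eq.
  by apply: aeW => z /=; rewrite rdotDr.
- move=> t x; rewrite -ae_RintegralZ//; apply: ae_Rintegral_eq.
  by apply: aeW => z /=; rewrite rdotZr.
- by move=> x; apply: ae_Rintegral_le.
by exists v.
Qed.

End OperatorFields.

(** * Bochner integrals and their agreement with weak integrals *)

Section BochnerWeak.
Context {R : realType} {H : completeNormedModType R[i]}.
Variable dot : {dot H for Num.conj}.
Hypothesis hdot : hilbert_dot dot.
Hypothesis hsep : separable H.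
Context {d : measure_display} {T : measurableType d}.
Variable mu : {measure set T -> \bar R}.
Hypothesis mufin : (mu setT < +oo)%E.
Implicit Types (f g s : T -> H) (v h : H).

Local Notation rdot := (rdot dot).
Local Notation smeas := (strongly_measurable mu).

Lemma finite_measure_le (A : set T) : measurable A -> (mu A < +oo)%E.
Proof.
by move=> mA; apply: le_lt_trans mufin; apply: le_measure; rewrite ?inE//; exact: measurableT.
Qed.

Lemma ae_integrable_bounded (k : T -> R) (M : R) : ae_measurable mu k ->
  {ae mu, forall z, `|k z| <= M} -> ae_integrable mu k.
Proof.
move=> mk kM; apply: (@ae_integrable_le _ _ _ _ k (fun=> `|M|)) => //.
  by apply: filterS kM => z /le_trans; apply; exact: ler_norm.
by rewrite (integral_cst mu measurableT) lte_mul_pinfty// lee_fin.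
Qed.

Lemma Lpnorm1 (k : T -> R) : (forall z, 0 <= k z) -> Lpnorm mu 1 k = (\int[mu]_z (k z)%:E)%E.
Proof.
move=> k0; rewrite LpnormE invr1 poweRe1; last by apply: integral_ge0 => z _; rewrite lee_fin powR_ge0.
by apply: eq_integral => z _; rewrite powRr1.
Qed.

Lemma ge0_ae_integralZ (c : R) (k : T -> R) : 0 <= c -> (forall z, 0 <= k z) ->
  ae_measurable mu k -> (\int[mu]_z (c * k z)%:E = c%:E * \int[mu]_z (k z)%:E)%E.
Proof.
move=> c0 k0 mk; rewrite -!Lpnorm1//; first exact: LpnormZ.
by move=> z; rewrite mulr_ge0.
Qed.

Lemma ae_dominated_cvg0 (k : nat -> T -> R) (G : T -> R) :
  (forall n, ae_measurable mu (k n)) -> (forall n z, 0 <= k n z) ->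
  {ae mu, forall z, k n z @[n --> \oo] --> (0 : R)} ->
  (forall n, {ae mu, forall z, k n z <= G z}) -> ae_integrable mu G ->
  (\int[mu]_z (k n z)%:E @[n --> \oo] --> 0)%E.
Proof.
move=> mk k0 kc kG Gi.
have [k' [l [mk' ml cl kk' l0]]] := ae_cvg_rep mk kc.
have [G' Gi' GG'] := ae_integrableP Gi.
have [|||||_ _] := @dominated_convergence _ _ _ mu setT measurableT
   (fun n z => (k' n z)%:E) (fun z => (l z)%:E) (EFin \o G').
- by move=> n; exact/measurable_EFinP.
- exact/measurable_EFinP.
- by apply: aeW => z _; apply: cvg_EFin; [exact: nearW|exact: cl].
- exact: Gi'.
- have h1 : {ae mu, forall z, forall n, k n z = k' n z} by exact: ae_foralln.
  have h2 : {ae mu, forall z, forall n, k n z <= G z} by exact: ae_foralln.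
  apply: filterS3 h1 h2 GG' => z h1 h2 h3 n _ /=.
  by rewrite lee_fin -h1 ger0_norm// -h3.
rewrite (_ : (fun n => \int[mu]_z (k' n z)%:E)%E = (fun n => \int[mu]_z (k n z)%:E)%E); last first.
  by apply/funext => n; apply: ae_integral_eq; apply: filterS (kk' n) => z ->.
rewrite (_ : \int[mu]_z (l z)%:E = 0)%E//.
rewrite (@ae_integral_eq _ _ _ mu _ (fun=> 0%E)); first exact: integral0.
by apply: filterS l0 => z <-.
Qed.

Lemma ae_integrable_rdot f h : smeas f -> (\int[mu]_z (hnorm (f z))%:E < +oo)%E ->
  ae_integrable mu (fun z => rdot (f z) h).
Proof.
move=> mf fi; apply: (@ae_integrable_le _ _ _ _ _ (fun z => hnorm h * hnorm (f z))).
- exact: smeas_rdot.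
- by apply: aeW => z; rewrite mulrC rdot_CS.
- by move=> z; rewrite mulr_ge0 ?hnorm_ge0.
rewrite ge0_ae_integralZ ?hnorm_ge0//; last 2 first.
- by move=> z; exact: hnorm_ge0.
- exact: smeas_hnorm.
by apply: lte_mul_pinfty; rewrite ?lee_fin ?hnorm_ge0.
Qed.

Lemma ae_Rintegral_rdot_le f h (C : R) : smeas f -> (\int[mu]_z (hnorm (f z))%:E <= C%:E)%E ->
  `|\int[mu]_z rdot (f z) h| <= C * hnorm h.
Proof.
move=> mf fC; have fi : (\int[mu]_z (hnorm (f z))%:E < +oo)%E by rewrite (le_lt_trans fC)// ltry.
apply: ae_Rintegral_le; first exact: ae_integrable_rdot.
apply: (@le_trans _ _ (\int[mu]_z (hnorm h * hnorm (f z))%:E)%E).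
  apply: ge0_ae_le_integral => [z|z|]; rewrite ?lee_fin ?mulr_ge0 ?hnorm_ge0//.
  by apply: aeW => z; rewrite lee_fin mulrC; exact: rdot_CS.
rewrite ge0_ae_integralZ ?hnorm_ge0//; last 2 first.
- by move=> z; exact: hnorm_ge0.
- exact: smeas_hnorm.
by rewrite mulrC EFinM; apply: lee_wpmul2l; rewrite ?lee_fin ?hnorm_ge0.
Qed.

Lemma simple_fun_bounded s : simple_fun s -> exists M, forall z, hnorm (s z) <= M.
Proof.
move=> [/finite_seqP[X sX] _]; exists (\sum_(v <- X) hnorm v) => z.
have : s z \in X by have : range s (s z) by [exists z]; rewrite sX.
elim: X {sX} => // x X IH; rewrite in_cons big_cons => /predU1P[<-|/IH h].
  by rewrite lerDl sumr_ge0// => v _; exact: hnorm_ge0.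
by rewrite (le_trans h)// lerDr hnorm_ge0.
Qed.

Lemma simple_fun_integrable s : simple_fun s -> (\int[mu]_z (hnorm (s z))%:E < +oo)%E.
Proof.
move=> hs; have [M hM] := simple_fun_bounded hs.
have [] := @ae_integrable_bounded (fun z => hnorm (s z)) M.
- by apply: measurable_ae_measurable; exact: measurable_simple_fun.
- by apply: aeW => z; rewrite ger0_norm ?hnorm_ge0.
move=> _; congr (_ < _)%E; apply: eq_integral => z _.
by rewrite ger0_norm ?hnorm_ge0.
Qed.

Lemma simple_integral_weak s : simple_fun s -> weak_integral dot mu s (simple_integral mu s).
Proof.
move=> hs h; have [fs ms] := hs.
rewrite /simple_integral fsbig_finite//=.
set X : seq H := finmap.enum_fset (fset_set (range s)).
pose c z v := rdot v h * \1_(s @^-1` [set v]) z.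
have e z : rdot (s z) h = \sum_(v <- X) c z v.
  have sX : s z \in X by rewrite [_ \in _](in_fset_set fs) inE; exists z.
  have uX : uniq X := finmap.fset_uniq _.
  rewrite (bigD1_seq (s z))//= big1 ?addr0.
    by rewrite /c indicE mem_set//= mulr1.
  move=> v vs; rewrite /c indicE memNset ?mulr0//= => sv.
  by rewrite sv eqxx in vs.
have ci v : ae_integrable mu (c ^~ v).
  apply: (@ae_integrable_bounded _ `|rdot v h|).
    by apply: measurable_ae_measurable; apply: measurable_funM.
  apply: aeW => z; rewrite normrM ler_piMr// indicE.
  by case: (_ \in _); rewrite ?normr1 ?normr0.
have cE v : \int[mu]_z c z v = fine (mu (s @^-1` [set v])) * rdot v h.
  rewrite (@ae_RintegralZ _ _ _ mu); last first.
    apply: (@ae_integrable_bounded _ 1); first exact/measurable_ae_measurable/measurable_indic/ms.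
    by apply: aeW => z; rewrite indicE; case: (_ \in _); rewrite ?normr1 ?normr0.
  by rewrite mulrC /Rintegral (integral_indic _ _ (ms v)) ?setIT//; exact: measurableT.
rewrite (@ae_Rintegral_eq _ _ _ mu _ (fun z => \sum_(v <- X) c z v)); last exact: aeW.
(* Integrability is carried through the induction, since additivity of the integral requires it of
   each partial sum. *)
have [] : ae_integrable mu (fun z => \sum_(v <- X) c z v) /\
  rdot (\sum_(v <- X) (fine (mu (s @^-1` [set v])))%:C *: v) h =
  \int[mu]_z \sum_(v <- X) c z v; last by [].
elim: (X : seq H) => [|v l [IH1 IH2]].
  split.
    apply: (@ae_integrable_bounded _ 0); last by apply: aeW => z; rewrite big_nil normr0.
    by under eq_fun do rewrite big_nil; exact: ae_measurable_cst.
  rewrite big_nil rdot0l; under eq_Rintegral do rewrite big_nil.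
  by rewrite /Rintegral integral0.
split.
  have [mv _] := ci v; have [ml _] := IH1.
  have [f1 If1 e1] := ae_integrableP (ci v); have [f2 If2 e2] := ae_integrableP IH1.
  split; first by under eq_fun do rewrite big_cons; exact: ae_measurableD.
  rewrite (@ae_integral_eq _ _ _ mu _ (fun z => `|((f1 z)%:E + (f2 z)%:E)|)%E).
    by have /integrableP[] := integrableD measurableT If1 If2.
  by apply: filterS2 e1 e2 => z <- <-; rewrite big_cons.
rewrite big_cons rdotDl IH2 rdotZl -cE -ae_RintegralD//.
by apply: ae_Rintegral_eq; apply: aeW => z; rewrite big_cons.
Qed.

Lemma weak_integralB f g v w : smeas f -> smeas g ->
  (\int[mu]_z (hnorm (f z))%:E < +oo)%E -> (\int[mu]_z (hnorm (g z))%:E < +oo)%E ->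
  weak_integral dot mu f v -> weak_integral dot mu g w ->
  weak_integral dot mu (fun z => f z - g z) (v - w).
Proof.
move=> mf mg fi gi fv gw.
have gw' := weak_integralZ (-1) gw; rewrite scaleN1r in gw'.
have gi' : weakly_integrable dot mu (fun z => -1 *: g z).
  by apply: weakly_integrableZ => h; exact: ae_integrable_rdot.
have := weak_integralD (fun h => ae_integrable_rdot h mf fi) gi' fv gw'.
by apply: weak_integral_eq; apply: aeW => z; rewrite scaleN1r.
Qed.

Lemma weak_integral_hnorm_le f v (C : R) : 0 <= C -> smeas f ->
  (\int[mu]_z (hnorm (f z))%:E <= C%:E)%E -> weak_integral dot mu f v -> hnorm v <= C.
Proof.
move=> C0 mf fC fv; apply: (hnorm_le_rdot hdot) => // h.
by rewrite fv (le_trans (ler_norm _))// ae_Rintegral_rdot_le.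
Qed.

Lemma smeasB f g : smeas f -> smeas g -> smeas (fun z => f z - g z).
Proof.
move=> mf mg; have := smeasD mf (smeasZ_cst hdot hsep (-1) mg).
by apply: smeas_eq; apply: aeW => z; rewrite scaleN1r.
Qed.

Lemma bochner_weak f v : is_bochner_integral mu f v -> weak_integral dot mu f v.
Proof.
move=> [mf [s hs [sf sv]]].
have ms n : smeas (s n) by apply: smeas_simple; exact: hs.
have md n : smeas (fun z => f z - s n z) by exact: smeasB.
have nearle (e : R) : 0 < e -> \forall n \near \oo, (\int[mu]_z (hnorm (f z - s n z))%:E <= e%:E)%E.
  move=> e0; have := sf; move/fine_cvgP => [h1 /cvgrPdist_le h2].
  apply: filterS2 h1 (h2 _ e0) => n h1; rewrite sub0r normrN => h3.
  by rewrite -(fineK h1) lee_fin (le_trans (ler_norm _) h3).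
have fi : (\int[mu]_z (hnorm (f z))%:E < +oo)%E.
  have [N _ hN] := nearle 1 ltr01.
  have h1 : (Lpnorm mu 1 (fun z => hnorm (f z)) <=
      Lpnorm mu 1 (fun z => hnorm (f z - s N z)%R) + Lpnorm mu 1 (fun z => hnorm (s N z)))%E.
    apply: le_trans (Lpnorm_minkowski (lexx 1) _ _ _ _).
    - apply: Lpnorm_ae_le => //.
      + by move=> z; exact: hnorm_ge0.
      + by move=> z; rewrite addr_ge0 ?hnorm_ge0.
      + by apply: aeW => z; rewrite -{1}(subrK (s N z) (f z)) hnormD.
    - by move=> z; exact: hnorm_ge0.
    - by move=> z; exact: hnorm_ge0.
    - exact: smeas_hnorm.
    - exact: smeas_hnorm.
  rewrite !Lpnorm1 in h1; try by move=> z; exact: hnorm_ge0.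
  apply: le_lt_trans h1 _; apply: lte_add_pinfty.
    by apply: le_lt_trans (hN N (leqnn _)) _; rewrite ltry.
  exact: simple_fun_integrable.
move=> h.
have c1 : rdot (simple_integral mu (s n)) h @[n --> \oo] --> rdot v h by exact: cvg_rdot.
have c2 : rdot (simple_integral mu (s n)) h @[n --> \oo] --> \int[mu]_z rdot (f z) h.
  apply/cvgrPdist_le => e e0.
  have e0' : 0 < e / (hnorm h + 1) by rewrite divr_gt0// ltr_wpDl// hnorm_ge0.
  apply: filterS (nearle _ e0') => n hn.
  rewrite simple_integral_weak//.
  have -> : \int[mu]_z rdot (f z) h - \int[mu]_z rdot (s n z) h = \int[mu]_z rdot (f z - s n z) h.
    have := ae_RintegralD (ae_integrable_rdot h (md n) (le_lt_trans hn (ltry _)))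
      (ae_integrable_rdot h (ms n) (simple_fun_integrable (hs n))).
    under eq_Rintegral do rewrite -rdotDl subrK.
    by move=> ->; rewrite addrK.
  apply: le_trans (ae_Rintegral_rdot_le h (md n) hn) _.
  by rewrite mulrAC ler_pdivrMr ?ltr_wpDl ?hnorm_ge0// ler_pM2l// lerDl.
exact: (cvg_unique _ c1 c2).
Qed.

(* Truncating the approximants where they exceed twice the norm of the limit
   makes dominated convergence applicable. *)
Lemma bochner_exists f : smeas f -> (\int[mu]_z (hnorm (f z))%:E < +oo)%E ->
  exists v, is_bochner_integral mu f v.
Proof.
move=> mf fi; have [s hs sf] := mf; have [g mg fg] := smeas_hnorm mf.
pose B n := [set z | hnorm (s n z) <= 2 * g z].
have mB n : measurable (B n).
  have : measurable_fun setT (fun z => hnorm (s n z) <= 2 * g z).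
    apply: measurable_fun_ler; first exact: measurable_simple_fun.
    by apply: measurable_funM.
  move=> /(_ measurableT [set true] I); rewrite setTI.
  by congr (measurable _); apply/seteqP.
pose t n z := if z \in B n then s n z else 0.
have ht n : simple_fun (t n) by apply: simple_fun_if => //; exact: simple_fun_cst.
have mt n : smeas (t n) by exact: smeas_simple.
have md n : smeas (fun z => f z - t n z) by exact: smeasB.
have tb n : {ae mu, forall z, hnorm (t n z) <= 2 * hnorm (f z)}.
  apply: filterS fg => z fgz; rewrite /t.
  by have [|] := boolP (z \in B n); rewrite ?inE ?fgz// hnorm0 -fgz mulr_ge0 ?hnorm_ge0.
have tc : {ae mu, forall z, t n z @[n --> \oo] --> f z}.
  apply: filterS2 fg sf => z fgz sz.
  have [f0|f0] := eqVneq (f z) 0.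
    rewrite f0 (_ : (fun n => t n z) = fun=> 0); first exact: cvg_cst.
    apply/funext => n; rewrite /t; have [|//] := boolP (z \in B n).
    rewrite inE /B /= -fgz f0 hnorm0 mulr0 => h.
    by apply/eqP; rewrite -hnorm_eq0 eq_le h hnorm_ge0.
  have nf : 0 < hnorm (f z) by rewrite hnorm_gt0.
  have cs : hnorm (s n z) @[n --> \oo] --> hnorm (f z) by exact: cvg_hnorm.
  apply: cvg_trans sz; apply: near_eq_cvg.
  move: cs => /cvgrPdist_lt/(_ _ nf); apply: filterS => n; rewrite ltr_norml => /andP[h _].
  by rewrite /t mem_set// /B /= -fgz; lra.
have G : ae_integrable mu (fun z => 3 * hnorm (f z)).
  split; first by apply: ae_measurableZ; exact: smeas_hnorm.
  rewrite (@ae_integral_eq _ _ _ mu _ (fun z => (3 * hnorm (f z))%:E)); last first.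
    by apply: aeW => z; rewrite ger0_norm// mulr_ge0// hnorm_ge0.
  rewrite ge0_ae_integralZ//; last 2 first.
  - by move=> z; exact: hnorm_ge0.
  - exact: smeas_hnorm.
  by apply: lte_mul_pinfty.
have c0 : (\int[mu]_z (hnorm (f z - t n z))%:E @[n --> \oo] --> 0)%E.
  apply: (@ae_dominated_cvg0 _ (fun z => 3 * hnorm (f z))) => //.
  - by move=> n; exact: smeas_hnorm.
  - by move=> n z; exact: hnorm_ge0.
  - apply: filterS tc => z /cvg_hnormP.
    by under eq_fun do rewrite hnormBC.
  - move=> n; apply: filterS (tb n) => z h; rewrite (le_trans (hnormB _ _))//; lra.
have fE : (\int[mu]_z (hnorm (f z))%:E)%E = (fine (\int[mu]_z (hnorm (f z))%:E))%:E.
  by rewrite fineK// ge0_fin_numE//; apply: integral_ge0 => z _; rewrite lee_fin hnorm_ge0.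
(* The candidate is the weak integral. The integrals of the [t n] converge to it, since
   [v - simple_integral (t n)] is the weak integral of [f - t n] and is bounded by the integral of
   its norm. *)
have [|||_ [v fv _]] := @weak_integral_exists _ _ dot hdot _ _ mu f (fine (\int[mu]_z (hnorm (f z))%:E)).
- by apply: fine_ge0; apply: integral_ge0 => z _; rewrite lee_fin hnorm_ge0.
- exact: mf.
- move=> h; rewrite mulrC EFinM -fE -ge0_ae_integralZ ?hnorm_ge0//; last 2 first.
  + by move=> z; exact: hnorm_ge0.
  + exact: smeas_hnorm.
  apply: ge0_ae_le_integral => [z|z|]; rewrite ?lee_fin ?mulr_ge0 ?hnorm_ge0//.
  by apply: aeW => z; rewrite lee_fin mulrC; exact: rdot_CS.
exists v; split=> //; exists t => //; split=> //.
apply/cvg_hnormP.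
have c0' : fine (\int[mu]_z (hnorm (f z - t n z))%:E) @[n --> \oo] --> (0 : R).
  exact: fine_cvg c0.
apply: (cvg_dist_le _ c0'); move/fine_cvgP : c0 => [h1 _].
apply: filterS h1 => n h1; rewrite subr0 ger0_norm ?hnorm_ge0// hnormBC.
apply: (@weak_integral_hnorm_le (fun z => f z - t n z)) => //.
- by apply: fine_ge0; apply: integral_ge0 => z _; rewrite lee_fin hnorm_ge0.
- by rewrite fineK.
- apply: weak_integralB => //; first exact: simple_fun_integrable.
  exact: simple_integral_weak.
Qed.

Lemma bochner_integralE f v : smeas f -> (\int[mu]_z (hnorm (f z))%:E < +oo)%E ->
  weak_integral dot mu f v -> bochner_integral mu f = v.
Proof.
move=> mf fi fv; have [w fw] := bochner_exists mf fi.
rewrite /bochner_integral; case: xgetP => [u _ fu|/(_ w)//].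
exact: (weak_integral_inj hdot (bochner_weak fu) fv).
Qed.

End BochnerWeak.

(** * Operator weights *)

Section Weights.
Context {R : realType} {H : completeNormedModType R[i]}.
Variable dot : {dot H for Num.conj}.
Hypothesis hdot : hilbert_dot dot.
Hypothesis hsep : separable H.
Hypothesis hnz : exists e : H, e != 0.
Context {d : measure_display} {T : measurableType d}.
Variable mu : {measure set T -> \bar R}.
Variable p : R.
Hypothesis hp : 1 < p.
Implicit Types (W V : T -> H -> H) (f g : T -> H) (v h e : H).

Local Notation rdot := (rdot dot).
Local Notation smeas := (strongly_measurable mu).
Local Notation p' := (p / (p - 1)).

Let p0 : 0 < p := lt_trans ltr01 hp.
Let p1 : 1 <= p := ltW hp.
Let pp0 : 0 < p - 1.
Proof. by rewrite subr_gt0. Qed.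
Let p'0 : 0 < p'.
Proof. exact: divr_gt0. Qed.
Let p'1 : 1 <= p'.
Proof. by rewrite ler_pdivlMr// mul1r gerBl. Qed.

Record weight W : Prop := Weight {
  weight_good : {ae mu, forall z, good_op dot (W z)};
  weight_smeas : forall e, smeas (fun z => W z e);
  weight_fin : forall e, (Lpop mu p (fun z => op_pow (W z) p^-1) (fun=> e) < +oo)%E;
  weight_cofin : forall e, (Lpop mu p' (fun z => op_pow (W z) (- p^-1)) (fun=> e) < +oo)%E }.

Definition Lpw W f := Lpop mu p (fun z => op_pow (W z) p^-1) f.
Definition Lpw_const W := Lpop_const mu p (fun z => op_pow (W z) p^-1).
Definition Lpw_coconst W := Lpop_const mu p' (fun z => op_pow (W z) (- p^-1)).

Definition Lpw_mem W f := smeas f /\ (Lpw W f < +oo)%E.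

Lemma op_pow_ae_bounded W s : {ae mu, forall z, bounded_op (op_pow (W z) s)}.
Proof. by apply: aeW => z; exact: op_pow_bounded. Qed.

Section OneWeight.
Variable W : T -> H -> H.
Hypothesis hW : weight W.

Lemma weight_op_pow s f : smeas f -> smeas (fun z => op_pow (W z) s (f z)).
Proof.
move=> mf; apply: (smeas_op_pow hdot) => //; [exact: weight_good hW|exact: weight_smeas hW].
Qed.

Lemma Lpw_ge0 f : (0 <= Lpw W f)%E. Proof. exact: Lpop_ge0. Qed.

Lemma Lpw_eq f g : {ae mu, forall z, f z = g z} -> Lpw W f = Lpw W g.
Proof. exact: Lpop_eq. Qed.

Lemma LpwD f g : smeas f -> smeas g -> (Lpw W (fun z => f z + g z)%R <= Lpw W f + Lpw W g)%E.
Proof.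
by move=> mf mg; apply: LpopD => //; [exact: op_pow_ae_bounded|move=> k; exact: weight_op_pow].
Qed.

Lemma Lpw_dom (M : R) f g : 0 <= M -> smeas g ->
  {ae mu, forall z, exists2 a : R[i], cabs a <= M & f z = a *: g z} ->
  (Lpw W f <= M%:E * Lpw W g)%E.
Proof.
by move=> M0 mg fg; apply: Lpop_dom => //; [exact: op_pow_ae_bounded|move=> k; exact: weight_op_pow].
Qed.

Lemma Lpw_fatou (f_ : nat -> T -> H) f (C : \bar R) : (forall n, smeas (f_ n)) ->
  {ae mu, forall z, f_ n z @[n --> \oo] --> f z} ->
  (forall n, Lpw W (f_ n) <= C)%E -> (Lpw W f <= C)%E.
Proof.
by move=> mf cf fC; apply: Lpop_fatou cf fC => //; [exact: op_pow_ae_bounded|move=> k; exact: weight_op_pow].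
Qed.

Lemma Lpw_constP : exists2 C : R, 0 <= C & Lpw_const W = C%:E /\
  forall e, (Lpw W (fun=> e) <= (C * hnorm e)%:E)%E.
Proof.
apply: Lpop_constP => //; [exact: op_pow_ae_bounded|move=> k; exact: weight_op_pow|].
exact: weight_fin hW.
Qed.

Lemma Lpw_coconstP : exists2 C : R, 0 <= C & Lpw_coconst W = C%:E /\
  forall e, (Lpop mu p' (fun z => op_pow (W z) (- p^-1)) (fun=> e) <= (C * hnorm e)%:E)%E.
Proof.
apply: Lpop_constP => //; [exact: op_pow_ae_bounded|move=> k; exact: weight_op_pow|].
exact: weight_cofin hW.
Qed.

Lemma weight_pairing f h : smeas f ->
  (\int[mu]_z `|rdot (f z) h|%:E <=
   Lpw W f * Lpop mu p' (fun z => op_pow (W z) (- p^-1)) (fun=> h))%E.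
Proof.
move=> mf; apply: le_trans (hoelder_ae hp _ _ _ _).
- apply: ge0_ae_le_integral => [z|z|]; rewrite ?lee_fin ?mulr_ge0 ?hnorm_ge0//.
  have := weight_good hW; apply: filterS => z [bW pW iW]; rewrite lee_fin.
  rewrite -{1}(op_powKN hdot hnz bW pW iW p^-1 (f z)).
  rewrite (op_pow_symmetric hdot hnz bW pW iW).
  exact: rdot_CS.
- by move=> z; exact: hnorm_ge0.
- by move=> z; exact: hnorm_ge0.
- by apply: smeas_hnorm; exact: weight_op_pow.
- by apply: smeas_hnorm; apply: weight_op_pow; exact: smeas_cst.
Qed.

(** Pairing a nonzero constant [e] with itself gives [|e|^2 mu(T) <= |e|_(L^p(W)) |e|_(dual)], which
    is finite. The existence of a weight thus replaces a computation of the total mass of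
    [mu_eta]. *)
Lemma weight_finite_measure : (mu setT < +oo)%E.
Proof.
have [e e0] := hnz; have n0 : 0 < hnorm e by rewrite hnorm_gt0.
have := weight_pairing e (smeas_cst mu e).
under eq_integral do rewrite (rdotxx hdot).
rewrite (integral_cst mu measurableT) => h.
have : ((`|hnorm e ^+ 2|)%:E * mu setT < +oo)%E.
  have h1 := weight_fin hW e; have h2 := weight_cofin hW e.
  apply: le_lt_trans h _; apply: lte_mul_pinfty => //; first exact: Lpw_ge0.
  by rewrite ge0_fin_numE ?Lpw_ge0.
case E : (mu setT) => [r||//]; first by move=> _; rewrite ltry.
by rewrite mulry gtr0_sg ?mul1e// normr_gt0 expf_neq0// gt_eqF.
Qed.

Lemma weight_weak_integral f (N C : R) : smeas f -> 0 <= N -> (Lpw W f <= N%:E)%E ->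
  0 <= C -> (forall e, (Lpop mu p' (fun z => op_pow (W z) (- p^-1)) (fun=> e) <= (C * hnorm e)%:E)%E) ->
  weakly_integrable dot mu f /\ exists2 v, weak_integral dot mu f v & hnorm v <= N * C.
Proof.
move=> mf N0 fN C0 hC; apply: weak_integral_exists => //; first by rewrite mulr_ge0.
move=> h; apply: le_trans (weight_pairing h mf) _.
rewrite -mulrA EFinM; apply: lee_pmul => //; [exact: Lpw_ge0|exact: Lpop_ge0].
Qed.

Lemma Lpw_mem_indic (D : set T) f : measurable D -> Lpw_mem W f ->
  Lpw_mem W (fun z => if z \in D then f z else 0) /\
  (Lpw W (fun z => if z \in D then f z else 0%R) <= Lpw W f)%E.
Proof.
move=> mD [mf fi].
have le : (Lpw W (fun z => if z \in D then f z else 0%R) <= Lpw W f)%E.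
  rewrite -[leRHS]mul1e; apply: Lpw_dom => //.
  apply: aeW => z; have [zD|zD] := boolP (z \in D).
    by exists 1; rewrite ?cabs1 ?scale1r.
  by exists 0; rewrite ?cabs0 ?scale0r.
split; last exact: le.
split; first exact: smeas_indic mD mf.
exact: le_lt_trans le fi.
Qed.

Lemma Lpw_memD f g : Lpw_mem W f -> Lpw_mem W g -> Lpw_mem W (fun z => f z + g z).
Proof.
move=> [mf fi] [mg gi]; split; first exact: smeasD mf mg.
exact: le_lt_trans (LpwD mf mg) (lte_add_pinfty fi gi).
Qed.

Lemma Lpw_mem_eq f g : {ae mu, forall z, f z = g z} -> Lpw_mem W g -> Lpw_mem W f.
Proof. by move=> fg [mg gi]; split; [exact: smeas_eq fg mg|rewrite (Lpw_eq fg)]. Qed.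

Lemma Lpw_fineK f : Lpw_mem W f -> Lpw W f = (fine (Lpw W f))%:E.
Proof. by move=> [_ fi]; rewrite fineK// ge0_fin_numE// Lpw_ge0. Qed.

(** Used for the existence of the Bochner integrals in [bergman] on the dense domain. The norm of
    [W^(-1/p) F] is dominated by the finite sum of the norms of [W^(-1/p) v] over the values [v] of
    [F], each integrable by Hoelder against 1. *)
Lemma op_pow_simple_integrable (F : T -> H) : simple_fun F ->
  (\int[mu]_z (hnorm (op_pow (W z) (- p^-1) (F z)))%:E < +oo)%E.
Proof.
move=> hF; have mufin := weight_finite_measure.
have mB (v : H) : ae_measurable mu (fun z => hnorm (op_pow (W z) (- p^-1) v)).
  by apply: smeas_hnorm; apply: weight_op_pow; exact: smeas_cst.
have int1 (v : H) : ae_integrable mu (fun z => hnorm (op_pow (W z) (- p^-1) v)).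
  split => //.
  have : (\int[mu]_z (hnorm (op_pow (W z) (- p^-1) v) * 1)%:E < +oo)%E.
    (* Hoelder is applied with exponent [p'] on the weight side, so the constant 1 is measured with
       the conjugate of [p'], which is [p]. *)
    have p'E : p' / (p' - 1) = p by field; rewrite ?gt_eqF//; lra.
    have p'2 : 1 < p' by rewrite ltr_pdivlMr// mul1r gtrBl.
    apply: le_lt_trans (hoelder_ae p'2 (fun z => hnorm_ge0 _) (fun=> ler01) (mB v) (ae_measurable_cst mu 1)) _.
    rewrite p'E; apply: lte_mul_pinfty; first exact: Lpnorm_ge0.
      by rewrite ge0_fin_numE ?Lpnorm_ge0//; exact: (weight_cofin hW v).
    rewrite LpnormE powR1 (integral_cst mu measurableT) mul1e.
    by rewrite poweR_lty.
  by congr (_ < _)%E; apply: eq_integral => z _; rewrite mulr1 ger0_norm ?hnorm_ge0.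
have [fs _] := hF; have /finite_seqP[X rX] := fs.
have dom z : hnorm (op_pow (W z) (- p^-1) (F z)) <= \sum_(v <- X) hnorm (op_pow (W z) (- p^-1) v).
  have : F z \in X by have : range F (F z) by [exists z]; rewrite rX.
  elim: X {rX} => // x X IH; rewrite in_cons big_cons => /predU1P[<-|/IH h].
    by rewrite lerDl sumr_ge0// => v _; exact: hnorm_ge0.
  by rewrite (le_trans h)// lerDr hnorm_ge0.
apply: (@le_lt_trans _ _ (\int[mu]_z (\sum_(v <- X) hnorm (op_pow (W z) (- p^-1) v))%:E)%E).
  apply: ge0_ae_le_integral => [z|z|]; rewrite ?lee_fin ?hnorm_ge0//.
    by rewrite sumr_ge0// => v _; exact: hnorm_ge0.
  by apply: aeW => z; rewrite lee_fin.
have : ae_measurable mu (fun z => \sum_(v <- X) hnorm (op_pow (W z) (- p^-1) v)) /\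
  (\int[mu]_z (\sum_(v <- X) hnorm (op_pow (W z) (- p^-1) v))%:E < +oo)%E.
  elim: X {rX dom} => [|v X [IH1 IH2]].
    under eq_fun do rewrite big_nil; split; first exact: ae_measurable_cst.
    by under eq_integral do rewrite big_nil; rewrite integral0.
  under eq_fun do rewrite big_cons; split; first exact: ae_measurableD.
  under eq_integral do rewrite big_cons.
  rewrite -Lpnorm1; last by move=> z; rewrite addr_ge0 ?hnorm_ge0// sumr_ge0// => u _; exact: hnorm_ge0.
  apply: le_lt_trans (Lpnorm_minkowski (lexx 1) _ _ _ _) _ => //.
  - by move=> z; exact: hnorm_ge0.
  - by move=> z; rewrite sumr_ge0// => u _; exact: hnorm_ge0.
  rewrite !Lpnorm1; last 2 first.
  - by move=> z; rewrite sumr_ge0// => u _; exact: hnorm_ge0.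
  - by move=> z; exact: hnorm_ge0.
  apply: lte_add_pinfty => //; have [_] := int1 v.
  by congr (_ < _)%E; apply: eq_integral => z _; rewrite ger0_norm ?hnorm_ge0.
by case.
Qed.

(** [W^(1/p)] undoes [W^(-1/p)], leaving the bounded function [F] on a space of finite measure. *)
Lemma op_pow_simple_mem (F : T -> H) : simple_fun F ->
  Lpw_mem W (fun z => op_pow (W z) (- p^-1) (F z)).
Proof.
move=> hF; split; first by apply: weight_op_pow; exact: smeas_simple.
have [M hM] := simple_fun_bounded hF.
have M0 : 0 <= `|M| by [].
rewrite /Lpw /Lpop; apply: (@le_lt_trans _ _ (Lpnorm mu p (fun=> `|M|))).
  apply: Lpnorm_ae_le => //; first by move=> z; exact: hnorm_ge0.
  have := weight_good hW; apply: filterS => z [bW pW iW].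
  by rewrite (op_powNK hdot hnz bW pW iW) (le_trans (hM z))// ler_norm.
rewrite LpnormE (integral_cst mu measurableT); apply: poweR_lty.
by apply: lte_mul_pinfty; rewrite ?lee_fin ?powR_ge0//; exact: weight_finite_measure.
Qed.

End OneWeight.

Section TwoWeights.
Variables W V : T -> H -> H.
Hypotheses (hW : weight W) (hV : weight V).
Variable D : set T.
Hypothesis mD : measurable D.
Hypothesis WV : {ae mu, forall z, D z -> W z = V z}.

Lemma Lpw_agree f : {ae mu, forall z, ~ D z -> f z = 0} -> Lpw W f = Lpw V f.
Proof.
move=> f0; apply: Lpnorm_ae_eq; apply: filterS2 WV f0 => z e f0.
have [/e ->//|/f0 ->] := pselect (D z).
by rewrite !(linear_fun0 (proj1 (op_pow_bounded _ _))).
Qed.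

Lemma Lpw_mem_agree f : {ae mu, forall z, ~ D z -> f z = 0} -> Lpw_mem W f -> Lpw_mem V f.
Proof. by move=> f0 [mf fi]; split; [exact: mf|rewrite -(Lpw_agree f0); exact: fi]. Qed.

End TwoWeights.

End Weights.

(** * The Bergman projection *)

Section ComplexMeasurable.
Context {R : realType}.

Definition cmeasurable {d} {T : measurableType d} (g : T -> R[i]) :=
  measurable_fun setT (fun z => complex.Re (g z)) /\ measurable_fun setT (fun z => complex.Im (g z)).

Section Cmeasurable.
Context {d : measure_display} {T : measurableType d}.
Implicit Types g h : T -> R[i].

Lemma cmeasurable_cst (a : R[i]) : cmeasurable (fun _ : T => a).
Proof. by split; exact: measurable_cst. Qed.

Lemma cmeasurableD g h : cmeasurable g -> cmeasurable h -> cmeasurable (fun z => g z + h z).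
Proof.
move=> [g1 g2] [h1 h2]; split.
  by under eq_fun do rewrite ReD; exact: measurable_funD.
by under eq_fun do rewrite ImD; exact: measurable_funD.
Qed.

Lemma cmeasurableM g h : cmeasurable g -> cmeasurable h -> cmeasurable (fun z => g z * h z).
Proof.
move=> [g1 g2] [h1 h2]; split.
  by under eq_fun do rewrite ReM; apply: measurable_funB; exact: measurable_funM.
by under eq_fun do rewrite ImM; apply: measurable_funD; exact: measurable_funM.
Qed.

Lemma cmeasurableX g n : cmeasurable g -> cmeasurable (fun z => g z ^+ n).
Proof.
move=> mg; elim: n => [|n IH]; first by under eq_fun do rewrite expr0; exact: cmeasurable_cst.
by under eq_fun do rewrite exprS; exact: cmeasurableM.
Qed.

Lemma cmeasurable_sum (F : nat -> T -> R[i]) n : (forall k, cmeasurable (F k)) ->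
  cmeasurable (fun z => \sum_(0 <= k < n) F k z).
Proof.
move=> mF; elim: n => [|n IH]; first by under eq_fun do rewrite big_geq//; exact: cmeasurable_cst.
by under eq_fun do rewrite big_nat_recr//=; exact: cmeasurableD.
Qed.

End Cmeasurable.

Lemma cmeasurable_cplx : cmeasurable (@cplx R).
Proof. by split; [exact: measurable_fst|exact: measurable_snd]. Qed.

Lemma cmeasurable_cplxJ : cmeasurable (fun z : R * R => (cplx z)^*).
Proof.
split; first exact: measurable_fst.
rewrite (_ : (fun z : R * R => _) = (fun z : R * R => - z.2)); last by apply/funext => -[].
by apply: measurableT_comp => //; exact: measurable_snd.
Qed.

End ComplexMeasurable.

(** * The Bergman kernel as a power series *)

Section KernelExpansion.
Context {R : realType}.
Variables (eta : R) (heta : -1 < eta).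
Local Notation mu := (mu_eta heta).
Local Notation s := (eta + 2).

Lemma mu_eta_disc : {ae mu, forall z : R * R, cabs (cplx z) < 1}.
Proof.
have mD : measurable (~` @unit_disc R) by apply: measurableC; exact: measurable_unit_disc.
have m0 : mu (~` @unit_disc R) = 0%E by rewrite /= /mu_eta setICl integral_set0.
by exact: (aeI mD m0 (fun z => @contrapT _)).
Qed.

Lemma kernel_tail (z zeta : R * R) (x : R) N : cabs (cplx zeta) * cabs (cplx z) <= x -> x < 1 ->
  cabs (bergman_kernel eta z zeta -
    \sum_(0 <= k < N) (bincoef s k)%:C * ((cplx zeta)^* ^+ k * cplx z ^+ k)) <= bintail s N x.
Proof.
move=> zx x1; have := @binomial_tail R s ((cplx zeta)^* * cplx z) x N.
rewrite cabsM cabsJ => /(_ zx x1); apply: le_trans.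
rewrite le_eqVlt; apply/orP; left; apply/eqP; congr (cabs (_ - _)).
by apply: eq_bigr => k _; rewrite exprMn.
Qed.

Lemma bintail_ge0 N x : 0 <= x < 1 -> 0 <= bintail s N x.
Proof.
move=> /andP[x0 x1]; have := @binomial_tail R s x%:C x N.
by rewrite cabsR ger0_norm// => /(_ (lexx _) x1); apply: le_trans; exact: cabs_ge0.
Qed.

Lemma kernel_bounded (z zeta : R * R) (x : R) : cabs (cplx zeta) * cabs (cplx z) <= x -> x < 1 ->
  cabs (bergman_kernel eta z zeta) <= bintail s 0 x.
Proof. by move=> zx x1; have := kernel_tail 0 zx x1; rewrite big_geq// subr0. Qed.

(** The kernel is a limit of the partial sums, polynomials in the conjugate of [zeta], so
    measurability need not be read off the formula for [cpowr]. *)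
Lemma kernel_measurable (z : R * R) : cabs (cplx z) < 1 ->
  ae_measurable mu (fun zeta => complex.Re (bergman_kernel eta z zeta)) /\
  ae_measurable mu (fun zeta => complex.Im (bergman_kernel eta z zeta)).
Proof.
move=> z1.
pose S N (zeta : R * R) := \sum_(0 <= k < N) (bincoef s k)%:C * ((cplx zeta)^* ^+ k * cplx z ^+ k).
have mS N : cmeasurable (S N).
  apply: cmeasurable_sum => k; apply: cmeasurableM; first exact: cmeasurable_cst.
  by apply: cmeasurableM; [apply: cmeasurableX; exact: cmeasurable_cplxJ|exact: cmeasurable_cst].
have cS : {ae mu, forall zeta, forall N,
   cabs (bergman_kernel eta z zeta - S N zeta) <= bintail s N (cabs (cplx z))}.
  apply: filterS mu_eta_disc => zeta zeta1 N; apply: kernel_tail => //.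
  by rewrite ler_piMl ?cabs_ge0// ltW.
have t0 : bintail s N (cabs (cplx z)) @[N --> \oo] --> (0 : R).
  by apply: bintail_cvg0; rewrite cabs_ge0.
split.
  apply: (@ae_measurable_cvg _ _ _ _ (fun N zeta => complex.Re (S N zeta))).
    by move=> n; apply: measurable_ae_measurable; exact: (mS n).1.
  apply: filterS cS => zeta h; apply: (cvg_dist_le _ t0); apply: nearW => N.
  by rewrite distrC -ReN -ReD (le_trans (ge_Re _)).
apply: (@ae_measurable_cvg _ _ _ _ (fun N zeta => complex.Im (S N zeta))).
  by move=> n; apply: measurable_ae_measurable; exact: (mS n).2.
apply: filterS cS => zeta h; apply: (cvg_dist_le _ t0); apply: nearW => N.
rewrite distrC (_ : _ - _ = complex.Im (bergman_kernel eta z zeta - S N zeta)); last first.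
  by rewrite ImD; case: (S N zeta).
exact: le_trans (ge_Im _) _.
Qed.

End KernelExpansion.

(** * The weakly defined projection and its expansion in moments *)

Section BergmanOperator.
Context {R : realType} {H : completeNormedModType R[i]}.
Variable dot : {dot H for Num.conj}.
Hypothesis hdot : hilbert_dot dot.
Hypothesis hsep : separable H.
Hypothesis hnz : exists e : H, e != 0.
Variables (p eta : R) (hp : 1 < p) (heta : -1 < eta).
Local Notation mu := (mu_eta heta).
Local Notation s := (eta + 2).
Local Notation rdot := (rdot dot).
Local Notation smeas := (strongly_measurable mu).
Local Notation p' := (p / (p - 1)).
Implicit Types (f g : R * R -> H).

Let s0 : 0 < s.
Proof. by move: heta; lra. Qed.

Variable W : R * R -> H -> H.
Hypothesis hW : weight dot mu p W.

(** Makes sense for every [f] in [L^p(W)] and [z] in the disc, where a Bochner integral may fail to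
    exist; [bergman_weak] identifies it with [bergman] on the dense domain. *)
Definition weak_bergman f (z : R * R) : H :=
  xget 0 [set v | weak_integral dot mu (fun zeta => bergman_kernel eta z zeta *: f zeta) v].

Definition moment f (k : nat) : H :=
  xget 0 [set v | weak_integral dot mu (fun zeta => (cplx zeta)^* ^+ k *: f zeta) v].

Lemma weak_bergman_ae f g z : {ae mu, forall zeta, f zeta = g zeta} ->
  weak_bergman f z = weak_bergman g z.
Proof.
move=> fg; congr (xget 0); apply/seteqP; split => v; apply: weak_integral_eq;
  by apply: filterS fg => zeta ->.
Qed.

Lemma weak_bergmanE f z v :
  weak_integral dot mu (fun zeta => bergman_kernel eta z zeta *: f zeta) v ->
  weak_bergman f z = v.
Proof.
move=> fv; rewrite /weak_bergman; case: xgetP => [u _ fu|/(_ v)//].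
exact: (weak_integral_inj hdot fu fv).
Qed.

(** The multiplier [a] is bounded only where [f] does not vanish; the sharper bounds for [f]
    supported in the ball come from this. *)
Lemma Lpw_weak_integral (a : R * R -> R[i]) (M N C : R) f :
  ae_measurable mu (fun z => complex.Re (a z)) ->
  ae_measurable mu (fun z => complex.Im (a z)) ->
  0 <= M -> {ae mu, forall z, f z = 0 \/ cabs (a z) <= M} ->
  smeas f -> 0 <= N -> (Lpw mu p W f <= N%:E)%E ->
  0 <= C -> (forall e, (Lpop mu p' (fun z => op_pow (W z) (- p^-1)) (fun=> e) <= (C * hnorm e)%:E)%E) ->
  weakly_integrable dot mu (fun z => a z *: f z) /\
  exists2 v, weak_integral dot mu (fun z => a z *: f z) v & hnorm v <= M * N * C.
Proof.
move=> ma mb M0 aM mf N0 fN C0 hC.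
apply: (weight_weak_integral hdot hsep hnz hp hW) => //; [exact: smeasZ|by rewrite mulr_ge0|].
apply: (@le_trans _ _ (M%:E * Lpw mu p W f)%E).
  apply: (Lpw_dom hdot hsep hnz hp hW) => //.
  apply: filterS aM => z [->|aM]; last by exists (a z).
  by exists 0; rewrite ?cabs0// !scaler0.
by rewrite EFinM; apply: lee_wpmul2l; rewrite ?lee_fin.
Qed.

Section Expansion.
Variables (f : R * R -> H) (N C : R).
Hypotheses (mf : smeas f) (N0 : 0 <= N) (fN : (Lpw mu p W f <= N%:E)%E) (C0 : 0 <= C).
Hypothesis hC : forall e, (Lpop mu p' (fun z => op_pow (W z) (- p^-1)) (fun=> e) <= (C * hnorm e)%:E)%E.

Lemma moment_exists k : weakly_integrable dot mu (fun zeta => (cplx zeta)^* ^+ k *: f zeta) /\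
  weak_integral dot mu (fun zeta => (cplx zeta)^* ^+ k *: f zeta) (moment f k).
Proof.
have [m1 m2] := cmeasurableX k (@cmeasurable_cplxJ R).
have [||||fi [v fv _]] := @Lpw_weak_integral (fun zeta => (cplx zeta)^* ^+ k) 1 N C f _ _ _ _ mf N0 fN C0 hC.
- exact: measurable_ae_measurable.
- exact: measurable_ae_measurable.
- exact: ler01.
- apply: filterS (mu_eta_disc heta) => z z1; right.
  by rewrite cabsX cabsJ exprn_ile1 ?cabs_ge0// ltW.
by split => //; rewrite /moment; case: xgetP => [u _ //|/(_ v)].
Qed.

Lemma moment_le k (x : R) : 0 <= x -> {ae mu, forall zeta, f zeta = 0 \/ cabs (cplx zeta) <= x} ->
  hnorm (moment f k) <= x ^+ k * N * C.
Proof.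
move=> x0 fx.
have [m1 m2] := cmeasurableX k (@cmeasurable_cplxJ R).
have [||||fi [v fv vle]] := @Lpw_weak_integral (fun zeta => (cplx zeta)^* ^+ k) (x ^+ k) N C f _ _ _ _ mf N0 fN C0 hC.
- exact: measurable_ae_measurable.
- exact: measurable_ae_measurable.
- exact: exprn_ge0.
- apply: filterS fx => z [->|zx]; [by left|right].
  by rewrite cabsX cabsJ lerXn2r ?nnegrE ?cabs_ge0.
by have [_ fm] := moment_exists k; rewrite (weak_integral_inj hdot fm fv).
Qed.

Lemma weak_bergman_exists z (x : R) : cabs (cplx z) < 1 -> 0 <= x < 1 ->
  {ae mu, forall zeta, f zeta = 0 \/ cabs (cplx zeta) * cabs (cplx z) <= x} ->
  weakly_integrable dot mu (fun zeta => bergman_kernel eta z zeta *: f zeta) /\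
  weak_integral dot mu (fun zeta => bergman_kernel eta z zeta *: f zeta) (weak_bergman f z).
Proof.
move=> z1 x01 fx; have [m1 m2] := kernel_measurable heta z1.
have [||fi [v fv _]] := @Lpw_weak_integral (bergman_kernel eta z) (bintail s 0 x) N C f m1 m2 _ _ mf N0 fN C0 hC.
- exact: bintail_ge0.
- apply: filterS fx => zeta [->|zx]; [by left|right].
  by apply: kernel_bounded => //; case/andP: x01.
by split => //; rewrite (weak_bergmanE fv).
Qed.

Definition moment_sum n z : H :=
  \sum_(0 <= k < n) ((bincoef s k)%:C * cplx z ^+ k) *: moment f k.

Lemma moment_sum_weak n z : let P zeta := \sum_(0 <= k < n) (bincoef s k)%:C * ((cplx zeta)^* ^+ k * cplx z ^+ k) in
  weakly_integrable dot mu (fun zeta => P zeta *: f zeta) /\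
  weak_integral dot mu (fun zeta => P zeta *: f zeta) (moment_sum n z).
Proof.
move=> P; rewrite {}/P /moment_sum; elim: n => [|n [IH1 IH2]].
  rewrite big_geq//; have e : (fun zeta => (\sum_(0 <= k < 0)
      (bincoef s k)%:C * ((cplx zeta)^* ^+ k * cplx z ^+ k)) *: f zeta) = fun zeta => 0 *: f zeta.
    by apply/funext => zeta; rewrite big_geq.
  rewrite e; have [i0 w0] := moment_exists 0.
  have e' : (fun zeta => 0 *: f zeta) = (fun zeta => 0 *: ((cplx zeta)^* ^+ 0 *: f zeta)).
    by apply/funext => zeta; rewrite !scale0r.
  rewrite e'; split; first exact: weakly_integrableZ.
  by rewrite -(scale0r (moment f 0)); exact: weak_integralZ.
have [in1 wn1] := moment_exists n.
have e : (fun zeta => (\sum_(0 <= k < n.+1) (bincoef s k)%:C * ((cplx zeta)^* ^+ k * cplx z ^+ k)) *: f zeta) =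
  fun zeta => (\sum_(0 <= k < n) (bincoef s k)%:C * ((cplx zeta)^* ^+ k * cplx z ^+ k)) *: f zeta +
   ((bincoef s n)%:C * cplx z ^+ n) *: ((cplx zeta)^* ^+ n *: f zeta).
  apply/funext => zeta; rewrite big_nat_recr//= scalerDl scalerA; congr (_ + _ *: _).
  by rewrite -mulrA (mulrC (cplx z ^+ n)).
rewrite e big_nat_recr//=; split.
  by apply: weakly_integrableD => //; exact: weakly_integrableZ.
apply: weak_integralD => //; first exact: weakly_integrableZ.
exact: weak_integralZ.
Qed.

Lemma weak_bergman_tail n z (x : R) : cabs (cplx z) < 1 -> 0 <= x < 1 ->
  {ae mu, forall zeta, f zeta = 0 \/ cabs (cplx zeta) * cabs (cplx z) <= x} ->
  hnorm (weak_bergman f z - moment_sum n z) <= bintail s n x * N * C.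
Proof.
move=> z1 x01 fx; have [m1 m2] := kernel_measurable heta z1.
pose P zeta := \sum_(0 <= k < n) (bincoef s k)%:C * ((cplx zeta)^* ^+ k * cplx z ^+ k).
have mP : cmeasurable P.
  apply: cmeasurable_sum => k; apply: cmeasurableM; first exact: cmeasurable_cst.
  by apply: cmeasurableM; [apply: cmeasurableX; exact: cmeasurable_cplxJ|exact: cmeasurable_cst].
have [i1 w1] := weak_bergman_exists z1 x01 fx.
have [i2 w2] := moment_sum_weak n z.
have [||||_ [v fv vle]] := @Lpw_weak_integral (fun zeta => bergman_kernel eta z zeta - P zeta)
  (bintail s n x) N C f _ _ _ _ mf N0 fN C0 hC.
- have := ae_measurableB m1 (measurable_ae_measurable mu mP.1).
  by apply: ae_measurable_eq; apply: aeW => zeta; rewrite ReD ReN.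
- have := ae_measurableB m2 (measurable_ae_measurable mu mP.2).
  by apply: ae_measurable_eq; apply: aeW => zeta; rewrite ImD; case: (P zeta).
- exact: bintail_ge0.
- apply: filterS fx => zeta [->|zx]; [by left|right].
  by apply: kernel_tail => //; case/andP: x01.
suff -> : weak_bergman f z - moment_sum n z = v by [].
have i2' := weakly_integrableZ (-1) i2; have w2' := weak_integralZ (-1) w2.
apply: (weak_integral_inj hdot _ fv); rewrite -scaleN1r.
have := weak_integralD i1 i2' w1 w2'; apply: weak_integral_eq.
by apply: aeW => zeta; rewrite scaleN1r scalerBl.
Qed.

Lemma moment_sum_cvg z (x : R) : cabs (cplx z) < 1 -> 0 <= x < 1 ->
  {ae mu, forall zeta, f zeta = 0 \/ cabs (cplx zeta) * cabs (cplx z) <= x} ->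
  moment_sum n z @[n --> \oo] --> weak_bergman f z.
Proof.
move=> z1 x01 fx; apply/cvg_hnormP.
apply: (@cvg_dist_le _ _ _ _ _ (fun n => bintail s n x * N * C)).
  by apply: nearW => n; rewrite subr0 ger0_norm ?hnorm_ge0// hnormBC; exact: weak_bergman_tail.
rewrite -[X in _ --> X](mul0r C) -[X in X * C](mul0r N).
by apply: cvgMl; apply: cvgMl; exact: bintail_cvg0.
Qed.

(* The partial sums of the expansion are dominated termwise: [a] bounds the
   powers of [z], [b] the moments. *)
Lemma weak_bergman_Lpw (D : set (R * R)) (a b : nat -> R) (r K : R) : measurable D -> 0 <= r < 1 ->
  (forall z, D z -> forall k, cabs (cplx z) ^+ k <= a k) ->
  (forall k, hnorm (moment f k) <= b k) ->
  (forall k, a k * b k <= r ^+ k * (N * C)) -> 0 <= K ->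
  (forall e, (Lpw mu p W (fun=> e) <= (K * hnorm e)%:E)%E) ->
  {ae mu, forall z, D z -> moment_sum n z @[n --> \oo] --> weak_bergman f z} ->
  smeas (fun z => if z \in D then weak_bergman f z else 0) /\
  (Lpw mu p W (fun z => if z \in D then weak_bergman f z else 0%R) <=
    ((1 - r) `^ (- s) * K * C * N)%:E)%E.
Proof.
move=> mD r01 Da mb ab K0 hK cv.
have a0 k : (exists z, D z) -> 0 <= a k.
  by move=> [z Dz]; apply: le_trans (Da z Dz k); rewrite exprn_ge0// cabs_ge0.
pose t k z : H := (if z \in D then (bincoef s k)%:C * cplx z ^+ k else 0) *: moment f k.
have mt k : smeas (t k).
  have e z : t k z = if z \in D then ((bincoef s k)%:C * cplx z ^+ k) *: moment f k else 0.
    by rewrite /t; case: ifP => //; rewrite scale0r.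
  apply: (smeas_eq (g := fun z => if z \in D then ((bincoef s k)%:C * cplx z ^+ k) *: moment f k else 0)).
    exact: aeW.
  apply: smeas_indic => //; have [m1 m2] : cmeasurable (fun z : R * R => (bincoef s k)%:C * cplx z ^+ k).
    apply: cmeasurableM; first exact: cmeasurable_cst.
    by apply: cmeasurableX; exact: cmeasurable_cplx.
  by apply: (smeasZ hdot hsep); [exact: measurable_ae_measurable|exact: measurable_ae_measurable|exact: smeas_cst].
have tle k : (Lpw mu p W (t k) <= (bincoef s k * r ^+ k * (K * (N * C)))%:E)%E.
  have c0 : 0 <= bincoef s k by apply: bincoef_ge0; exact: ltW.
  (* Nonnegativity of [a k] comes from a point of [D]. When [D] is empty the terms [t k] vanish
     instead. *)
  have [[z0 Dz0]|nD] := pselect (exists z, D z); last first.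
    rewrite (@Lpw_eq _ _ _ _ mu p W _ (fun z => 0)); last first.
      apply: aeW => z; rewrite /t; case: ifP; rewrite ?scale0r// inE => Dz.
      by exfalso; apply: nD; exists z.
    apply: le_trans (hK 0) _; rewrite hnorm0 mulr0 lee_fin.
    by rewrite !mulr_ge0 ?exprn_ge0//; case/andP: r01.
  have ak0 : 0 <= a k by apply: a0; exists z0.
  apply: (@le_trans _ _ ((bincoef s k * a k)%:E * Lpw mu p W (fun=> moment f k))%E).
    apply: (Lpw_dom hdot hsep hnz hp hW) => //; [by rewrite mulr_ge0|exact: smeas_cst|].
    apply: aeW => z; exists (if z \in D then (bincoef s k)%:C * cplx z ^+ k else 0) => //.
    case: ifP; last by rewrite cabs0 mulr_ge0.
    by rewrite inE => Dz; rewrite cabsM cabsR ger0_norm// cabsX ler_wpM2l// Da.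
  apply: (@le_trans _ _ ((bincoef s k * a k)%:E * (K * hnorm (moment f k))%:E)%E).
    by apply: lee_wpmul2l; [rewrite lee_fin mulr_ge0|exact: hK].
  rewrite -EFinM lee_fin -!mulrA ler_wpM2l//.
  rewrite mulrCA [leRHS]mulrCA ler_wpM2l//.
  by apply: le_trans (ab k); rewrite ler_wpM2l.
pose S n z := \sum_(0 <= k < n) t k z.
have mS n : smeas (S n) /\ (Lpw mu p W (S n) <= ((\sum_(0 <= k < n) bincoef s k * r ^+ k) * (K * (N * C)))%:E)%E.
  elim: n => [|n [IH1 IH2]].
    have e : S 0 = fun=> 0 by apply/funext => z; rewrite /S big_geq.
    rewrite e; split; first exact: smeas_cst.
    by rewrite big_geq// mul0r (le_trans (hK 0))// hnorm0 mulr0.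
  have e : S n.+1 = fun z => S n z + t n z by apply/funext => z; rewrite /S big_nat_recr.
  rewrite e; split; first exact: smeasD IH1 (mt n).
  apply: le_trans (LpwD hdot hsep hnz hp hW IH1 (mt n)) _.
  by rewrite big_nat_recr//= mulrDl EFinD; apply: leeD.
have cS : {ae mu, forall z, S n z @[n --> \oo] --> (if z \in D then weak_bergman f z else 0)}.
  apply: filterS cv => z cz; case: ifP => zD.
    rewrite (_ : (fun n => S n z) = fun n => moment_sum n z); first by apply: cz; rewrite inE in zD.
    by apply/funext => n; apply: eq_bigr => k _; rewrite /t zD.
  rewrite (_ : (fun n => S n z) = fun n => 0); first exact: cvg_cst.
  by apply/funext => n; rewrite /S big1// => k _; rewrite /t zD scale0r.
have mS1 n : smeas (S n) by exact: (mS n).1.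
split; first by apply: (smeas_cvg hsep mS1); exact: cS.
apply: (Lpw_fatou hdot hsep hnz hp hW mS1 cS) => n.
apply: le_trans (mS n).2 _; rewrite lee_fin -!mulrA (mulrC C).
rewrite ler_wpM2r ?mulr_ge0//; apply: binomial_sum_le => //; exact: ltW.
Qed.

End Expansion.

End BergmanOperator.

(** * Transferring a bounded extension of the projection between two weights *)

Section BergmanTransfer.
Context {R : realType} {H : completeNormedModType R[i]}.
Variable dot : {dot H for Num.conj}.
Hypothesis hdot : hilbert_dot dot.
Hypothesis hsep : separable H.
Hypothesis hnz : exists e : H, e != 0.
Variables (p eta : R) (hp : 1 < p) (heta : -1 < eta).
Local Notation mu := (mu_eta heta).
Local Notation s := (eta + 2).
Local Notation smeas := (strongly_measurable mu).
Local Notation p' := (p / (p - 1)).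
Local Notation Lpw := (Lpw mu p).
Local Notation Lpw_mem := (Lpw_mem mu p).
Local Notation wb := (weak_bergman dot heta).
Implicit Types (f g F : R * R -> H).

Let s0 : 0 < s.
Proof. by move: heta; lra. Qed.

Definition restr (D : set (R * R)) f z : H := if z \in D then f z else 0.

Lemma restrE D f z : D z -> restr D f z = f z.
Proof. by move=> Dz; rewrite /restr mem_set. Qed.

Lemma restr0 D f z : ~ D z -> restr D f z = 0.
Proof. by move=> Dz; rewrite /restr memNset. Qed.

Lemma restrC D f z : restr D f z + restr (~` D) f z = f z.
Proof.
have [Dz|Dz] := pselect (D z).
  by rewrite restrE// restr0 ?addr0//; apply.
by rewrite restr0// restrE ?add0r.
Qed.

Lemma restrD D (a : R[i]) f g z : restr D (fun z => a *: f z + g z) z = a *: restr D f z + restr D g z.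
Proof. by rewrite /restr; case: ifP => // _; rewrite scaler0 addr0. Qed.

Lemma LpW_normE (U : R * R -> H -> H) f : LpW_norm p heta U f = Lpw U f.
Proof. by rewrite /LpW_norm /Lpw /Lpop LpnormE. Qed.

Lemma in_LpWE (U : R * R -> H -> H) f : in_LpW p heta U f <-> Lpw_mem U f.
Proof. by rewrite /in_LpW LpW_normE. Qed.

Section OneWeight.
Variable W : R * R -> H -> H.
Hypothesis hW : weight dot mu p W.

Lemma restr_mem (V : R * R -> H -> H) (D : set (R * R)) f : measurable D ->
  {ae mu, forall z, D z -> W z = V z} -> Lpw_mem W f -> Lpw_mem V (restr D f).
Proof.
move=> mD WV fW; have h := (Lpw_mem_indic hdot hsep hnz hp hW mD fW).1.
by apply: (Lpw_mem_agree WV _ h); apply: aeW => z; exact: restr0.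
Qed.

Lemma weak_bergman_ex f z : Lpw_mem W f -> cabs (cplx z) < 1 ->
  weakly_integrable dot mu (fun zeta => bergman_kernel eta z zeta *: f zeta) /\
  weak_integral dot mu (fun zeta => bergman_kernel eta z zeta *: f zeta) (wb f z).
Proof.
move=> fW z1; have [C C0 [_ hC]] := Lpw_coconstP hdot hsep hnz hp hW.
have e := Lpw_fineK fW; have [mf _] := fW.
apply: (weak_bergman_exists hdot hsep hnz hp hW mf _ _ C0 hC (N := fine (Lpw W f)) (x := cabs (cplx z))) => //.
- by rewrite fine_ge0// Lpw_ge0.
- by rewrite -e.
- by rewrite cabs_ge0.
- apply: filterS (mu_eta_disc heta) => zeta zeta1; right.
  by rewrite ler_piMl ?cabs_ge0// ltW.
Qed.

Lemma weak_bergmanP (a : R[i]) f g z : Lpw_mem W f -> Lpw_mem W g -> cabs (cplx z) < 1 ->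
  wb (fun zeta => a *: f zeta + g zeta) z = a *: wb f z + wb g z.
Proof.
move=> fW gW z1; have [f1 f2] := weak_bergman_ex fW z1; have [g1 g2] := weak_bergman_ex gW z1.
apply: (weak_bergmanE hdot).
have := weak_integralD (weakly_integrableZ a f1) g1 (weak_integralZ a f2) g2.
apply: weak_integral_eq; apply: aeW => zeta.
by rewrite scalerDr !scalerA mulrC.
Qed.

(** For fixed [z] in the disc the kernel is bounded in [zeta], and [W^(-1/p) F] has integrable norm,
    so the Bochner integral exists and equals the weak one. *)
Lemma bergman_weak F z : simple_fun F -> cabs (cplx z) < 1 ->
  bergman heta (fun z => op_pow (W z) (- p^-1) (F z)) z = wb (fun z => op_pow (W z) (- p^-1) (F z)) z.
Proof.
move=> hF z1; set f := fun z => _.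
have fW : Lpw_mem W f by exact: (op_pow_simple_mem hdot hsep hnz hp hW hF).
have [k1 k2] := kernel_measurable heta z1.
have [_ fz] := weak_bergman_ex fW z1.
have mufin := weight_finite_measure hdot hsep hnz hp hW.
apply: (bochner_integralE hdot hsep mufin _ _ fz).
- by apply: (smeasZ hdot hsep k1 k2); case: fW.
have x01 : 0 <= cabs (cplx z) < 1 by rewrite cabs_ge0.
pose M := bintail s 0 (cabs (cplx z)).
have M0 : 0 <= M by exact: bintail_ge0.
apply: (@le_lt_trans _ _ (\int[mu]_z (M * hnorm (f z))%:E)%E).
  apply: ge0_ae_le_integral => [zeta|zeta|]; rewrite ?lee_fin ?mulr_ge0 ?hnorm_ge0//.
  apply: filterS (mu_eta_disc heta) => zeta zeta1; rewrite lee_fin hnormZ.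
  rewrite ler_wpM2r ?hnorm_ge0//; apply: kernel_bounded => //.
  by rewrite ler_piMl ?cabs_ge0// ltW.
rewrite ge0_ae_integralZ//.
- have := op_pow_simple_integrable hdot hsep hnz hp hW hF.
  move=> fin; rewrite lte_mul_pinfty ?lee_fin//.
- by move=> zeta; exact: hnorm_ge0.
- by apply: smeas_hnorm; case: fW.
Qed.

Section Bounds.
Variables (C K r : R).
Hypotheses (r01 : 0 < r < 1) (C0 : 0 <= C) (K0 : 0 <= K).
Hypothesis hC : forall e, (Lpop mu p' (fun z => op_pow (W z) (- p^-1)) (fun=> e) <= (C * hnorm e)%:E)%E.
Hypothesis hK : forall e, (Lpw W (fun=> e) <= (K * hnorm e)%:E)%E.
Local Notation B := [set z | cabs (cplx z) <= r].

Lemma measurable_ball (x : R) : measurable [set z : R * R | cabs (cplx z) <= x].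
Proof.
rewrite -[[set z | _]]setTI.
have := measurable_cabs_cplx measurableT (measurable_itv `]-oo, x]%R).
by congr (measurable _); apply/seteqP; split => z /=; rewrite in_itv.
Qed.

Let r0 : 0 <= r. Proof. by case/andP: r01 => /ltW. Qed.
Let r1 : r < 1. Proof. by case/andP: r01. Qed.
Let r01' : 0 <= r < 1. Proof. by rewrite r0 r1. Qed.

Lemma weak_bergman_near f : Lpw_mem W f ->
  Lpw_mem W (restr B (wb f)) /\
  (Lpw W (restr B (wb f)) <= ((1 - r) `^ (- s) * K * C)%:E * Lpw W f)%E.
Proof.
move=> fW; have e := Lpw_fineK fW; have [mf _] := fW.
set N := fine _ in e.
have N0 : 0 <= N by rewrite fine_ge0// Lpw_ge0.
have fN : (Lpw W f <= N%:E)%E by rewrite e.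
have [|||||m le] := @weak_bergman_Lpw _ _ _ hdot hsep hnz _ _ hp _ _ hW f N C N0 C0
  B (fun k => r ^+ k) (fun=> N * C) r K _ r01' _ _ _ K0 hK _.
- exact: measurable_ball.
- by move=> z zr k; rewrite lerXn2r ?nnegrE ?cabs_ge0.
- move=> k; have := moment_le hdot hsep hnz hp hW mf N0 fN C0 hC k ler01.
  rewrite expr1n mul1r; apply; apply: filterS (mu_eta_disc heta) => z /ltW; by right.
- by [].
- apply: aeW => z zr; apply: (moment_sum_cvg hdot hsep hnz hp hW mf N0 fN C0 hC (x := r)) => //.
    exact: le_lt_trans zr r1.
  apply: filterS (mu_eta_disc heta) => zeta zeta1; right.
  by apply: le_trans zr; rewrite ler_piMl ?cabs_ge0// ltW.
split; last by rewrite e -EFinM.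
by split; [exact: m|apply: le_lt_trans le _; exact: ltry].
Qed.

Lemma weak_bergman_far f : Lpw_mem W f ->
  Lpw_mem W (restr (~` B) (wb (restr B f))) /\
  (Lpw W (restr (~` B) (wb (restr B f))) <= ((1 - r) `^ (- s) * K * C)%:E * Lpw W f)%E.
Proof.
move=> fW; have e := Lpw_fineK fW.
set N := fine _ in e.
have N0 : 0 <= N by rewrite fine_ge0// Lpw_ge0.
have [[mg _] gf] := Lpw_mem_indic hdot hsep hnz hp hW (measurable_ball r) fW.
have gN : (Lpw W (restr B f) <= N%:E)%E by rewrite -e.
(* The factor [r ^+ k] now comes from the moments of [f] restricted to the ball. The powers of [z]
   are merely bounded by 1, which takes [|z| < 1]; intersecting with [unit_disc] changes the
   function on a null set only. *)
have [|||||m le] := @weak_bergman_Lpw _ _ _ hdot hsep hnz _ _ hp _ _ hW (restr B f)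
  N C N0 C0 (~` B `&` unit_disc) (fun k => 1) (fun k => r ^+ k * N * C) r K _ r01' _ _ _ K0 hK _.
- by apply: measurableI; [apply: measurableC; exact: measurable_ball|exact: measurable_unit_disc].
- by move=> z [_ /ltW z1] k; rewrite exprn_ile1 ?cabs_ge0.
- move=> k; apply: (moment_le hdot hsep hnz hp hW mg N0 gN C0 hC) => //.
  apply: aeW => z; have [zr|zr] := pselect (B z); [by right|by left; exact: restr0].
- by move=> k; rewrite mul1r mulrA.
- apply: aeW => z [_ z1]; apply: (moment_sum_cvg hdot hsep hnz hp hW mg N0 gN C0 hC (x := r)) => //.
  apply: aeW => zeta; have [zr|zr] := pselect (B zeta); [right|by left; exact: restr0].
  by apply: le_trans zr; rewrite ler_piMr ?cabs_ge0// ltW.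
have eq : {ae mu, forall z, restr (~` B) (wb (restr B f)) z =
    if z \in ~` B `&` unit_disc then wb (restr B f) z else 0}.
  by apply: filterS (mu_eta_disc heta) => z z1; rewrite /restr in_setI (mem_set z1 : z \in unit_disc) andbT.
rewrite (Lpw_eq p W eq) e -EFinM; split; last exact: le.
by apply: (Lpw_mem_eq eq); split; [exact: m|apply: le_lt_trans le _; exact: ltry].
Qed.

End Bounds.

End OneWeight.

Section TwoWeights.
Variables W V : R * R -> H -> H.
Hypotheses (hW : weight dot mu p W) (hV : weight dot mu p V).
Variables (C K r : R).
Hypotheses (r01 : 0 < r < 1) (C0 : 0 <= C) (K0 : 0 <= K).
Hypothesis hC : forall e, (Lpop mu p' (fun z => op_pow (W z) (- p^-1)) (fun=> e) <= (C * hnorm e)%:E)%E.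
Hypothesis hK : forall e, (Lpw W (fun=> e) <= (K * hnorm e)%:E)%E.
Local Notation B := [set z | cabs (cplx z) <= r].
Hypothesis WV : {ae mu, forall z, (~` B) z -> W z = V z}.
Variables (T : (R * R -> H) -> R * R -> H) (c : R).
Hypothesis c0 : 0 <= c.
Hypothesis hT : bergman_extension p heta V T.
Hypothesis Tle : forall f, in_LpW p heta V f ->
  in_LpW p heta V (T f) /\ (LpW_norm p heta V (T f) <= c%:E * LpW_norm p heta V f)%E.

(* [T] is used only where [z] and [zeta] both lie off the ball; elsewhere
   [|z| * |zeta| <= r] and the kernel expands into a dominated power series. *)
Definition transfer f z : H :=
  restr (~` B) (T (restr (~` B) f)) z +
  (restr (~` B) (wb (restr B f)) z + restr B (wb f) z).

Let restr_W f : Lpw_mem W f -> Lpw_mem V (restr (~` B) f).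
Proof. by apply: (restr_mem hW _ WV); apply: measurableC; exact: measurable_ball. Qed.

Let restr_V f : Lpw_mem V f -> Lpw_mem W (restr (~` B) f).
Proof.
apply: (restr_mem hV); first by apply: measurableC; exact: measurable_ball.
by apply: filterS WV => z e /e.
Qed.

Lemma transfer_le f : Lpw_mem W f -> Lpw_mem W (transfer f) /\
  (Lpw W (transfer f) <= (c + 2 * (1 - r) `^ (- s) * K * C)%:E * Lpw W f)%E.
Proof.
move=> fW; have mB : measurable (~` B) by apply: measurableC; exact: measurable_ball.
have f1 := restr_W fW.
have [/in_LpWE g1 le1] := Tle ((in_LpWE _ _).2 f1).
have h1 := restr_V g1.
have [a1 a2] := weak_bergman_far hW r01 C0 K0 hC hK fW.
have [b1 b2] := weak_bergman_near hW r01 C0 K0 hC hK fW.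
have ab := Lpw_memD hdot hsep hnz hp hW a1 b1.
split; first exact: (Lpw_memD hdot hsep hnz hp hW h1 ab).
have m1 := h1.1; have m2 := ab.1; have m3 := a1.1; have m4 := b1.1.
apply: le_trans (LpwD hdot hsep hnz hp hW m1 m2) _.
(* The factor 2 counts the two pieces, from the ball to its complement and from the disc to the
   ball, each of norm at most [(1 - r)^(-s) K C]. *)
have -> : (c + 2 * (1 - r) `^ (- s) * K * C = c + ((1 - r) `^ (- s) * K * C + (1 - r) `^ (- s) * K * C))%R by ring.
have k0 : 0 <= (1 - r) `^ (- s) * K * C by rewrite !mulr_ge0 ?powR_ge0.
have N0 := Lpw_ge0 mu p W f.
rewrite EFinD ge0_muleDl ?lee_fin ?addr_ge0//; apply: leeD; last first.
  rewrite EFinD ge0_muleDl ?lee_fin//.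
  by apply: le_trans (LpwD hdot hsep hnz hp hW m3 m4) _; exact: leeD a2 b2.
have a0 (g : R * R -> H) : {ae mu, forall z, ~ (~` B) z -> restr (~` B) g z = 0}.
  by apply: aeW => z; exact: restr0.
(* Both the argument and the value of the truncated [T] vanish on the ball, so their norms for [W]
   and [V] coincide and the bound for [T] on [L^p(V)] applies. *)
rewrite (Lpw_agree p WV (a0 _)).
apply: le_trans (Lpw_mem_indic hdot hsep hnz hp hV mB g1).2 _.
move: le1; rewrite !LpW_normE => /le_trans; apply.
apply: lee_wpmul2l; first by rewrite lee_fin.
rewrite -(Lpw_agree p WV (a0 _)).
exact: (Lpw_mem_indic hdot hsep hnz hp hW mB fW).2.
Qed.

Lemma transfer_extension : bergman_extension p heta W transfer.
Proof.
have mB : measurable B by exact: measurable_ball.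
have mCB : measurable (~` B) by exact: measurableC.
have [T1 T2 T3 T4] := hT; split.
- by move=> f /in_LpWE fW; apply/in_LpWE; exact: (transfer_le fW).1.
- move=> f g /in_LpWE fW /in_LpWE gW fg.
  have fgr D : {ae mu, forall z, restr D f z = restr D g z}.
    by apply: filterS fg => z; rewrite /restr => ->.
  have := T2 _ _ ((in_LpWE _ _).2 (restr_W fW)) ((in_LpWE _ _).2 (restr_W gW)) (fgr _).
  apply: filterS => z e; rewrite /transfer /restr -!/(restr _ _) e.
  by rewrite (weak_bergman_ae _ z fg) (weak_bergman_ae _ z (fgr B)).
- move=> a f g /in_LpWE fW /in_LpWE gW.
  have := T3 a _ _ ((in_LpWE _ _).2 (restr_W fW)) ((in_LpWE _ _).2 (restr_W gW)).
  apply: filterS2 (mu_eta_disc heta) => z z1 e.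
  rewrite /transfer.
  have -> : restr (~` B) (fun z => a *: f z + g z) = fun z => a *: restr (~` B) f z + restr (~` B) g z.
    by apply/funext => y; exact: restrD.
  have -> : restr B (fun z => a *: f z + g z) = fun z => a *: restr B f z + restr B g z.
    by apply/funext => y; exact: restrD.
  have e1 : restr (~` B) (T (fun z => a *: restr (~` B) f z + restr (~` B) g z)) z =
    a *: restr (~` B) (T (restr (~` B) f)) z + restr (~` B) (T (restr (~` B) g)) z.
    by rewrite -restrD /restr -!/(restr _ _) e.
  have fB := (Lpw_mem_indic hdot hsep hnz hp hW mB fW).1.
  have gB := (Lpw_mem_indic hdot hsep hnz hp hW mB gW).1.
  have e2 : restr (~` B) (wb (fun z => a *: restr B f z + restr B g z)) z =
    a *: restr (~` B) (wb (restr B f)) z + restr (~` B) (wb (restr B g)) z.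
    by rewrite -restrD /restr -!/(restr _ _) (weak_bergmanP hW a fB gB z1).
  have e3 : restr B (wb (fun z => a *: f z + g z)) z = a *: restr B (wb f) z + restr B (wb g) z.
    by rewrite -restrD /restr (weak_bergmanP hW a fW gW z1).
  by rewrite e1 e2 e3 !scalerDr [X in _ + X]addrACA [LHS]addrACA.
- move=> f [F [hF [J [cJ JD FJ]]] ->].
  (* Cutting [F] off the ball, and not the function [W^(-1/p) F], gives an element of the dense
     domain for [V]. Almost everywhere it equals the restriction of [W^(-1/p) F], so [T] acts on the
     latter as the Bergman projection. *)
  pose f' z := op_pow (V z) (- p^-1) (restr (~` B) F z).
  have hF' : simple_fun (restr (~` B) F) by apply: simple_fun_if => //; exact: simple_fun_cst.
  set g := fun z => op_pow (W z) (- p^-1) (F z).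
  have gW : Lpw_mem W g by exact: (op_pow_simple_mem hdot hsep hnz hp hW hF).
  have f'V : Lpw_mem V f' by exact: (op_pow_simple_mem hdot hsep hnz hp hV hF').
  have ff : {ae mu, forall z, restr (~` B) g z = f' z}.
    apply: filterS WV => z e; rewrite /f' /restr; case: ifP => [|_].
      by rewrite inE => zB; rewrite /g e.
    by rewrite (linear_fun0 (proj1 (op_pow_bounded _ _))).
  have Tf : {ae mu, forall z, T (restr (~` B) g) z = T f' z}.
    exact: T2 ((in_LpWE _ _).2 (restr_W gW)) ((in_LpWE _ _).2 f'V) ff.
  have Tb : {ae mu, forall z, T f' z = bergman heta f' z}.
    apply: T4; exists (restr (~` B) F) => //; split => //; exists J; split => // z /FJ e.
    by rewrite /restr e; case: ifP.
  apply: filterS3 Tf Tb (mu_eta_disc heta) => z e1 e2 z1.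
  rewrite (bergman_weak hW hF z1) -/g /transfer.
  (* On the ball only the last piece survives, and it is the full integral. Off the ball the first
     two pieces integrate over the two halves of the disc and add up to it. *)
  have [zB|zB] := pselect (B z).
    rewrite restr0 ?add0r; last by apply.
    rewrite restr0 ?add0r; last by apply.
    by rewrite restrE.
  rewrite restrE// restrE// [X in _ + (_ + X)]restr0// addr0.
  rewrite e1 e2 (bergman_weak hV hF' z1) -/f' -(weak_bergman_ae _ z ff).
  have g1 := (Lpw_mem_indic hdot hsep hnz hp hW mCB gW).1.
  have g2 := (Lpw_mem_indic hdot hsep hnz hp hW mB gW).1.
  rewrite -[X in X + _]scale1r -(weak_bergmanP hW 1 g1 g2 z1).
  by apply: weak_bergman_ae; apply: aeW => y; rewrite scale1r addrC; exact: restrC.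
Qed.

End TwoWeights.

End BergmanTransfer.

(** * Carleson squares *)

Section PolarCoordinates.
Context {R : realType}.
Implicit Types (m t x q l : R) (z : R * R).

Lemma ltr_cos_norm (b t : R) : `|t| <= pi -> 0 <= b <= pi -> (cos b < cos t) = (`|t| < b).
Proof.
move=> tpi b0; have -> : cos t = cos `|t|.
  by case: (ger0P t) => // _; rewrite cosN.
by rewrite ltr_cos ?in_itv//= normr_ge0.
Qed.

Lemma unit_angle (x y : R) : x ^+ 2 + y ^+ 2 = 1 ->
  exists2 t : R, `|t| <= pi & x = cos t /\ y = sin t.
Proof.
move=> xy; have x1 : -1 <= x <= 1.
  by rewrite -ler_norml -(@ler_pXn2r _ 2) ?nnegrE// expr1n real_normK ?num_real// -xy lerDl sqr_ge0.
have yE : Num.sqrt (1 - x ^+ 2) = `|y| by rewrite -xy addrC addKr sqrtr_sqr.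
have [y0|y0] := ger0P y.
  exists (acos x); first by rewrite ger0_norm ?acos_ge0// acos_lepi.
  by rewrite acosK ?in_itv// sin_acos// yE ger0_norm.
exists (- acos x); first by rewrite normrN ger0_norm ?acos_ge0// acos_lepi.
by rewrite cosN sinN acosK ?in_itv// sin_acos// yE ltr0_norm// opprK.
Qed.

(** The component of [z] in the direction [expi m]: at [z = rho expi t] it is [rho cos (t - m)]. *)
Definition proj m z : R := z.1 * cos m + z.2 * sin m.

(** An angular sector about the direction [m], given by a lower bound [x] on the cosine of the
    angle. In this form measurability is immediate. With [x = cos (pi l)] and [q = 1 - l] it is a
    Carleson square of side [l] without its two end rays. *)
Definition sector m x q : set (R * R) :=
  [set z | q < cabs (cplx z) < 1 /\ cabs (cplx z) * x < proj m z].

Definition ray m q : set (R * R) :=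
  [set z | q < cabs (cplx z) < 1 /\ proj m z = cabs (cplx z)].

Lemma measurable_proj m : measurable_fun setT (proj m).
Proof.
apply: measurable_funD; apply: measurable_funM => //.
Qed.

Lemma measurable_annulus q : measurable [set z : R * R | q < cabs (cplx z) < 1].
Proof.
rewrite -[[set z | _]]setTI.
have := measurable_cabs_cplx measurableT (measurable_itv `]q, 1%R[%R).
by congr (measurable _); apply/seteqP; split => z /=; rewrite in_itv.
Qed.

Lemma measurable_sector m x q : measurable (sector m x q).
Proof.
have := measurable_annulus q; rewrite /sector.
rewrite (_ : [set z | _ /\ _] = [set z : R * R | q < cabs (cplx z) < 1] `&`
  ((fun z : R * R => proj m z - cabs (cplx z) * x) @^-1` `]0, +oo[%classic)); last first.
  by apply/seteqP; split => z /=; rewrite in_itv/= andbT subr_gt0.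
move=> mA; apply: measurableI => //; rewrite -[X in measurable X]setTI.
apply: measurable_funB => //; first exact: measurable_proj.
by apply: measurable_funM => //; exact: measurable_cabs_cplx.
Qed.

Lemma measurable_ray m q : measurable (ray m q).
Proof.
have := measurable_annulus q; rewrite /ray.
rewrite (_ : [set z | _ /\ _] = [set z : R * R | q < cabs (cplx z) < 1] `&`
  ((fun z : R * R => proj m z - cabs (cplx z)) @^-1` [set 0])); last first.
  apply/seteqP; split => z /= [qz e]; split => //; first by rewrite e subrr.
  by apply/eqP; rewrite -subr_eq0 e.
move=> mA; apply: measurableI => //; rewrite -[X in measurable X]setTI.
by apply: measurable_funB => //; [exact: measurable_proj|exact: measurable_cabs_cplx].
Qed.

Lemma cabs_expi m : cabs (expi m) = 1.
Proof. by rewrite cabsE /= cos2Dsin2 sqrtr1. Qed.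

Lemma polar_proj (rho t m : R) z : cplx z = rho%:C * expi t -> proj m z = rho * cos (t - m).
Proof.
rewrite /cplx /expi => /eqP; rewrite eq_complex /= !mul0r subr0 addr0 => /andP[/eqP e1 /eqP e2].
by rewrite /proj e1 e2 cosB mulrDr !mulrA.
Qed.

Lemma proj_le m z : `|proj m z| <= cabs (cplx z).
Proof.
rewrite -[leRHS]mulr1 -(cabs_expi m) -[cabs (expi m)]cabsJ -cabsM.
by apply: le_trans (ge_Re _); rewrite ReM /= mulrN opprK.
Qed.

Lemma polar_cabs (rho t : R) z : 0 < rho -> cplx z = rho%:C * expi t -> cabs (cplx z) = rho.
Proof. by move=> r0 ->; rewrite cabsM cabs_expi mulr1 cabsR gtr0_norm. Qed.

Lemma cplx_polar m z : 0 < cabs (cplx z) ->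
  exists2 t : R, `|t| <= pi & cplx z = (cabs (cplx z))%:C * expi (m + t).
Proof.
set q := cabs _ => q0; have qE : q ^+ 2 = z.1 ^+ 2 + z.2 ^+ 2 by rewrite /q cabs_sqr.
have qn : q != 0 by rewrite gt_eqF.
(* The coordinates of [z / |z|] rotated by [- m], so that the angle [t] is measured from the
   direction [m] and lies in [[-pi, pi]]. *)
have [|t tpi [e1 e2]] := @unit_angle ((z.1 * cos m + z.2 * sin m) / q) ((z.2 * cos m - z.1 * sin m) / q).
  rewrite !expr_div_n -mulrDl -[RHS](divff (expf_neq0 2 qn)); congr (_ / _).
  by rewrite qE -[RHS]mulr1 -(cos2Dsin2 m); ring.
exists t => //; apply/eqP; rewrite /cplx /expi eq_complex /= !mul0r subr0 addr0 cosD sinD -e1 -e2.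
by apply/andP; split; apply/eqP; rewrite -[LHS]mulr1 -(cos2Dsin2 m); field.
Qed.

Lemma ray_polar m q z : 0 <= q -> ray m q z -> cplx z = (cabs (cplx z))%:C * expi m.
Proof.
move=> q0 [/andP[qz _] e]; have z0 := le_lt_trans q0 qz.
move: e; set r := cabs _ => e; have rE : r ^+ 2 = z.1 ^+ 2 + z.2 ^+ 2 by rewrite /r cabs_sqr.
(* Lagrange's identity: [|z|^2] is the square of [proj m z] plus the square of this component
   orthogonal to [expi m]. *)
have d0 : z.1 * sin m - z.2 * cos m = 0.
  apply/eqP; rewrite -sqrf_eq0; apply/eqP.
  have : r ^+ 2 * (cos m ^+ 2 + sin m ^+ 2) - proj m z ^+ 2 = 0 by rewrite cos2Dsin2 e mulr1 subrr.
  by rewrite rE /proj => <-; ring.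
apply/eqP; rewrite /cplx /expi eq_complex /= !mul0r subr0 addr0 -e /proj.
move/eqP: d0; rewrite subr_eq0 => /eqP d0.
by apply/andP; split; apply/eqP; rewrite -[LHS]mulr1 -(cos2Dsin2 m); ring: d0.
Qed.

End PolarCoordinates.

(** * Measurability and measure of Carleson squares *)

Section CarlesonSquares.
Context {R : realType}.
Implicit Types (a l t x q : R) (z : R * R) (I : set R[i]).

Lemma sector_carleson a l I : 0 < l <= 1 ->
  [set expi t | t in [set t | a < t < a + 2 * pi * l]] `<=` I ->
  sector (a + pi * l) (cos (pi * l)) (1 - l) `<=` carleson_square l I.
Proof.
move=> /andP[l0 l1] aI z [/andP[qz z1] pz].
have z0 : 0 < cabs (cplx z) by apply: le_lt_trans qz; rewrite subr_ge0.
have [t tpi e] := cplx_polar (a + pi * l) z0.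
exists (cabs (cplx z)); exists (expi (a + pi * l + t)); last by rewrite qz z1.
apply: aI; exists (a + pi * l + t) => //=.
move: pz; rewrite (polar_proj _ e) addrC addKr ltr_pM2l// ltr_cos_norm//; last first.
  by rewrite mulr_ge0 ?pi_ge0 ?(ltW l0)//= ler_piMr ?pi_ge0.
by rewrite ltr_norml => /andP[h1 h2]; apply/andP; split; lra.
Qed.

(** An arc may or may not contain each of its endpoints. The interior of the arc gives the sector,
    and each endpoint in [I] adds a ray, so measurability follows although [I] is an arbitrary set
    between the open and the closed arc. *)
Lemma carleson_square_decomposition a l I : 0 < l <= 1 ->
  [set expi t | t in [set t | a < t < a + 2 * pi * l]] `<=` I ->
  I `<=` [set expi t | t in [set t | a <= t <= a + 2 * pi * l]] ->
  carleson_square l I = sector (a + pi * l) (cos (pi * l)) (1 - l) `|`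
    ((if `[< I (expi a) >] then ray a (1 - l) else set0) `|`
     (if `[< I (expi (a + 2 * pi * l)) >] then ray (a + 2 * pi * l) (1 - l) else set0)).
Proof.
move=> l01 aI Ia; have /andP[l0 l1] := l01.
have pl0 : 0 <= pi * l by rewrite mulr_ge0 ?pi_ge0 ?ltW.
have plpi : pi * l <= pi by rewrite ler_piMr ?pi_ge0.
have q0 : 0 <= 1 - l by rewrite subr_ge0.
have rayS m : I (expi m) -> ray m (1 - l) `<=` carleson_square l I.
  move=> Im z zr; have e := ray_polar q0 zr.
  by exists (cabs (cplx z)); exists (expi m) => //; split => //; case: zr.
apply/seteqP; split; last first.
  move=> z [|[]]; first exact: sector_carleson.
    by case: asboolP => // h; exact: rayS h _.
  by case: asboolP => // h; exact: rayS h _.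
move=> z [rho [u Iu [/andP[qr r1] e]]].
have [t /= /andP[t1 t2] ut] := Ia _ Iu; rewrite -ut in Iu e.
have r0 := le_lt_trans q0 qr; have zr := polar_cabs r0 e.
have zq : 1 - l < cabs (cplx z) < 1 by rewrite zr qr.
have ray_t : ray t (1 - l) z by split; rewrite // zr (polar_proj _ e) subrr cos0 mulr1.
have [ta|ta] := eqVneq t a.
  by right; left; rewrite -ta; case: ifPn => // /asboolP.
have [tb|tb] := eqVneq t (a + 2 * pi * l).
  by right; right; rewrite -tb; case: ifPn => // /asboolP.
left; split => //; rewrite zr (polar_proj _ e) ltr_pM2l//.
have h : `|t - (a + pi * l)| < pi * l.
  have {}ta : a < t by rewrite lt_neqAle eq_sym ta.
  have {}tb : t < a + 2 * pi * l by rewrite lt_neqAle tb.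
  by rewrite ltr_norml; apply/andP; split; lra.
by rewrite ltr_cos_norm ?pl0// (le_trans (ltW h)).
Qed.

Lemma measurable_carleson (S : set (R * R)) : carleson_squares S -> measurable S.
Proof.
move=> [l [I l01 [[a [aI Ia]] ->]]]; rewrite (carleson_square_decomposition l01 aI Ia).
apply: measurableU; first exact: measurable_sector.
by apply: measurableU; case: ifP => _ //; exact: measurable_ray.
Qed.

Lemma sector_sub (m x y q q' : R) : x <= y -> q <= q' -> sector m y q' `<=` sector m x q.
Proof.
move=> xy qq z [/andP[qz z1] zp]; split; first by rewrite (le_lt_trans qq qz).
by apply: le_lt_trans zp; rewrite ler_wpM2l ?cabs_ge0.
Qed.

(** Used for the density, where [eta] may have either sign: a negative power is smallest at [x = 1],
    a nonnegative one at [x = a]. *)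
Lemma powR_lower (a s : R) : 0 < a <= 1 -> exists2 c : R, 0 < c & forall x, a <= x <= 1 -> c <= x `^ s.
Proof.
move=> /andP[a0 a1]; have [s0|s0] := leP 0 s.
  exists (a `^ s); first exact: powR_gt0.
  move=> x /andP[ax _]; have x0 := lt_le_trans a0 ax.
  by apply: ge0_ler_powR; rewrite ?nnegrE ?(ltW a0) ?(ltW x0).
exists 1 => // x /andP[ax x1]; have x0 := lt_le_trans a0 ax.
rewrite -[s]opprK powRN invf_ge1 ?powR_gt0//.
have -> : 1 = 1 `^ (- s) :> R by rewrite powR1.
by apply: ge0_ler_powR; rewrite ?nnegrE ?oppr_ge0 ?(ltW s0) ?(ltW x0).
Qed.

(* The square of side [2 d] around the point of the central ray at distance
   [(1 + q) / 2] from the origin lies in the sector, for [d] independent of the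
   direction. *)
Lemma sector_measure (eta : R) (heta : -1 < eta) (x q : R) : x < 1 -> -1 <= x -> 0 < q < 1 ->
  exists2 c : R, 0 < c & forall m, (c%:E <= mu_eta heta (sector m x q))%E.
Proof.
move=> x1 xN1 /andP[q0 q1].
(* Points of the box are within [2 d] of the centre. The first bound on [d] keeps the box in the
   annulus, the second keeps its angular spread inside the sector. *)
pose rho := (1 + q) / 2; pose d := Num.min ((1 - q) / 8) (rho * (1 - x) / 16).
have rho0 : 0 < rho by rewrite /rho; lra.
have d0 : 0 < d by rewrite lt_min; apply/andP; split; [lra|apply: divr_gt0 => //; apply: mulr_gt0 => //; lra].
have d1 : d <= (1 - q) / 8 by rewrite ge_min lexx.
have d2 : d <= rho * (1 - x) / 16 by rewrite ge_min lexx orbT.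
pose box m := `](rho * cos m - d), (rho * cos m + d)[%classic `*` `](rho * sin m - d), (rho * sin m + d)[%classic.
have boxE m z : box m z -> cabs (cplx z) <= rho + 2 * d /\ rho - 2 * d <= proj m z.
  move=> []; rewrite /= !in_itv /= => /andP[x_1 x_2] /andP[y_1 y_2].
  have e : cplx z = rho%:C * expi m + cplx (z.1 - rho * cos m, z.2 - rho * sin m).
    by apply/eqP; rewrite /cplx /expi eq_complex /= !mul0r subr0 addr0 !subrKC !eqxx.
  have w : cabs (cplx (z.1 - rho * cos m, z.2 - rho * sin m)) <= 2 * d.
    apply: le_trans (cabs_le _) _ => /=.
    have : `|z.1 - rho * cos m| <= d by rewrite ler_norml; apply/andP; split; lra.
    have : `|z.2 - rho * sin m| <= d by rewrite ler_norml; apply/andP; split; lra.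
    by lra.
  split.
    rewrite e (le_trans (cabsD _ _))// cabsM cabs_expi cabsR gtr0_norm// mulr1.
    by rewrite lerD2l.
  have -> : proj m z = rho * (cos m ^+ 2 + sin m ^+ 2) + proj m (z.1 - rho * cos m, z.2 - rho * sin m).
    by rewrite /proj /=; ring.
  rewrite cos2Dsin2 mulr1 lerD2l.
  by have := le_trans (proj_le m _) w; rewrite ler_norml => /andP[].
have boxS m : box m `<=` sector m x q.
  move=> z /boxE[z1 z2].
  have pz : proj m z <= cabs (cplx z) by apply: le_trans (proj_le m z); exact: ler_norm.
  split; first by apply/andP; split; rewrite /rho in z1 z2; lra.
  have zlo : rho - 2 * d <= cabs (cplx z) by exact: le_trans z2 pz.
  apply: lt_le_trans z2.
  (* As [x] may be negative, [|z| x] is split as [|z| - |z| (1 - x)], where the upper bound of [|z|]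
     serves the first term and the lower bound the second. *)
  apply: (@le_lt_trans _ _ (rho + 2 * d - (rho - 2 * d) * (1 - x))).
    have : 0 <= (cabs (cplx z) - (rho - 2 * d)) * (1 - x) by rewrite mulr_ge0 ?subr_ge0// ltW.
    by lra.
  have h8 : 8 * d <= rho by have : 0 <= rho * (1 + x) by [rewrite mulr_ge0 ?(ltW rho0)//; lra]; lra.
  have : 0 <= (rho - 8 * d) * (1 - x) by rewrite mulr_ge0 ?subr_ge0// ltW.
  by lra.
have rd0 : 0 <= rho + 2 * d by lra.
have rd1 : rho + 2 * d < 1 by rewrite /rho; lra.
have [|c c0 hc] := @powR_lower (1 - (rho + 2 * d) ^+ 2) eta.
  rewrite subr_gt0 expr_lt1// rd1/= gerBl sqr_ge0//.
pose k := (eta + 1) * c / pi; have e1 : 0 < eta + 1 by lra.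
have k0 : 0 < k by rewrite divr_gt0 ?pi_gt0// mulr_gt0.
have mb m : measurable (box m) by exact: measurableX.
exists (k * (2 * d * (2 * d))); first by apply: mulr_gt0 => //; apply: mulr_gt0; lra.
move=> m; apply: (@le_trans _ _ (mu_eta heta (box m))); last first.
  by apply: le_measure; rewrite ?inE//; exact: measurable_sector.
rewrite /mu_eta setIidl; last by move=> z /boxS[/andP[]].
apply: (@le_trans _ _ (\int[lebesgue_measure \x lebesgue_measure]_(z in box m) k%:E)%E).
  rewrite integral_cst/=; last exact: mb.
  have -> : (lebesgue_measure \x lebesgue_measure)%E (box m) =
    (lebesgue_measure `](rho * cos m - d)%R, (rho * cos m + d)%R[%classic *
     lebesgue_measure `](rho * sin m - d)%R, (rho * sin m + d)%R[%classic)%E :> \bar R by exact: product_measure1E.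
  rewrite !lebesgue_measure_itv /= !lte_fin.
  rewrite !ifT; [|by lra|by lra].
  rewrite -!EFinB -!EFinM lee_fin le_eqVlt; apply/orP; left; apply/eqP; ring.
apply: ge0_le_integral => //; first exact: mb.
- by move=> z _; rewrite lee_fin ltW.
- by apply: measurable_funTS; apply/measurable_EFinP; exact: measurable_disc_density.
move=> z bz; have [z1 _] := boxE m z bz.
rewrite lee_fin /k /disc_density ler_pM2r ?invr_gt0 ?pi_gt0// ler_pM2l//; apply: hc.
by rewrite gerBl sqr_ge0 andbT lerD2l lerN2 lerXn2r ?nnegrE ?cabs_ge0.
Qed.

(** A square of side above [1 - r] contains the sector about the same central direction with
    half-angle [pi (1 - r)] and inner radius [r], whose measure is bounded below independently of
    the direction. *)
Lemma carleson_measure (eta : R) (heta : -1 < eta) (r : R) : 0 < r < 1 ->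
  exists2 c : R, 0 < c & forall l I, 0 < l <= 1 -> is_arc l I -> 1 - r < l ->
    (c%:E <= mu_eta heta (carleson_square l I))%E.
Proof.
move=> r01; have /andP[r0 r1] := r01.
have b0 : 0 <= pi * (1 - r) <= (pi : R) by rewrite mulr_ge0 ?pi_ge0 ?subr_ge0 ?(ltW r1)//= ler_piMr ?pi_ge0// gerBl ltW.
have x1 : cos (pi * (1 - r)) < 1.
  have := @ltr_cos_norm R (pi * (1 - r)) 0; rewrite normr0 pi_ge0 cos0 => /(_ isT b0) ->.
  by rewrite mulr_gt0 ?pi_gt0 ?subr_gt0.
have [c c0 hc] := sector_measure heta x1 (cos_geN1 _) r01.
exists c => // l I l01 [a [aI Ia]] rl.
have mS : measurable (carleson_square l I) by apply: measurable_carleson; exists l; exists I => //; split => //; exists a.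
apply: le_trans (hc (a + pi * l)) _; apply: le_measure; rewrite ?inE//; first exact: measurable_sector.
apply: subset_trans (sector_carleson l01 aI); have /andP[l0 l1] := l01.
apply: sector_sub; last by rewrite lerBlDr -lerBlDl ltW.
apply/ltW; rewrite ltr_cos_norm.
- by rewrite ger0_norm ?ltr_pM2l ?pi_gt0//; case/andP: b0.
- by rewrite ger0_norm; case/andP: b0.
- by rewrite mulr_ge0 ?pi_ge0 ?(ltW l0)//= ler_piMr ?pi_ge0.
Qed.

End CarlesonSquares.

Lemma ge0_le_poweR {R : realType} (q : R) (x y : \bar R) : 0 <= q -> (0 <= x)%E -> (x <= y)%E -> (x `^ q <= y `^ q)%E.
Proof.
move=> q0 x0 xy; have y0 := le_trans x0 xy.
by apply: gt0_ler_poweR; rewrite ?in_itv/= ?leey ?andbT.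
Qed.

(** * Averaging operators on Carleson squares *)

Section Averaging.
Context {R : realType} {H : completeNormedModType R[i]}.
Variable dot : {dot H for Num.conj}.
Hypothesis hdot : hilbert_dot dot.
Hypothesis hsep : separable H.
Hypothesis hnz : exists e : H, e != 0.
Variables (p eta : R) (hp : 1 < p) (heta : -1 < eta).
Local Notation mu := (mu_eta heta).
Local Notation p' := (p / (p - 1)).
Local Notation Lpw := (Lpw mu p).
Local Notation Lpw_mem := (Lpw_mem mu p).
Local Notation rdot := (rdot dot).
Implicit Types (f g F : R * R -> H) (S : set (R * R)).

Lemma LpW_opnorm_le W T c : 0 <= c ->
  (forall f, Lpw_mem W f -> Lpw_mem W (T f) /\ (Lpw W (T f) <= c%:E * Lpw W f)%E) ->
  (LpW_opnorm p heta W T <= c%:E)%E.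
Proof.
move=> c0 hc; apply: ereal_inf_lbound; exists c; last by [].
split; first exact: c0.
move=> f /in_LpWE fW; rewrite in_LpWE !LpW_normE; exact: hc.
Qed.

Lemma averaging_eq S f g : (forall z, S z -> f z = g z) -> averaging dot heta S f = averaging dot heta S g.
Proof.
move=> fg; apply/funext => z; rewrite /averaging; case: ifP => // _.
rewrite /weak_average; congr (xget 0); apply/seteqP.
have e h : complex_integral mu S (fun z => dot (f z) h) = complex_integral mu S (fun z => dot (g z) h).
  rewrite /complex_integral; congr (_ +i* _); congr fine; apply: eq_integral => y;
    by rewrite inE => /fg ->.
by split => v /= hv h; rewrite hv e.
Qed.

Lemma weak_averageE S f v : (forall h, dot v h =
    ((fine (mu S))^-1)%:C * complex_integral mu S (fun z => dot (f z) h)) ->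
  weak_average dot heta S f = v.
Proof.
move=> hv; rewrite /weak_average; case: xgetP => [u _ hu|/(_ v)//].
by apply: (rdot_ext hdot) => h; rewrite /rdot hu hv.
Qed.

(** The imaginary part of a pairing is its real part against ['i *: h], so the weak integral,
    defined by real pairings, gives both components of [complex_integral]. *)
Lemma complex_integral_dot S f v h : weak_integral dot mu (restr S f) v ->
  complex_integral mu S (fun z => dot (f z) h) = dot v h.
Proof.
move=> fv.
have e k : rdot v k = \int[mu]_(z in S) rdot (f z) k.
  rewrite fv [RHS]Rintegral_mkcond; congr fine; apply: eq_integral => z _.
  by rewrite /patch /restr; case: ifP => // _; rewrite rdot0l.
rewrite /complex_integral; apply/eqP; rewrite eq_complex /=; apply/andP; split; apply/eqP.
  by rewrite -[RHS]/(rdot v h) e.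
rewrite Im_dot e; congr fine; apply: eq_integral => z _; by rewrite Im_dot.
Qed.

Section TwoWeights.
Variables W V : R * R -> H -> H.
Hypotheses (hW : weight dot mu p W) (hV : weight dot mu p V).
Variable D : set (R * R).
Hypothesis mD : measurable D.
Hypothesis WV : {ae mu, forall z, D z -> W z = V z}.

Lemma averaging_opnorm_agree S : S `<=` D ->
  (LpW_opnorm p heta W (averaging dot heta S) <= LpW_opnorm p heta V (averaging dot heta S))%E.
Proof.
move=> SD; apply: le_ereal_inf_tmp => _ [c [c0 hc] <-].
apply: (LpW_opnorm_le c0) => f fW.
have gV := restr_mem hdot hsep hnz hp hW mD WV fW.
have [/in_LpWE hg] := hc _ ((in_LpWE _ _ _ _).2 gV).
have -> : averaging dot heta S f = averaging dot heta S (restr D f).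
  by apply: averaging_eq => z /SD Dz; rewrite restrE.
have a0 : {ae mu, forall z, ~ D z -> averaging dot heta S (restr D f) z = 0}.
  apply: aeW => z Dz; rewrite /averaging; case: ifPn => //; rewrite inE => /SD //.
have b0 : {ae mu, forall z, ~ D z -> restr D f z = 0} by apply: aeW => z; exact: restr0.
have VW : {ae mu, forall z, D z -> V z = W z} by apply: filterS WV => z e /e.
rewrite !LpW_normE -(Lpw_agree p WV a0) -(Lpw_agree p WV b0) => le.
split; first exact: (Lpw_mem_agree VW a0 hg).
apply: le_trans le _; apply: lee_wpmul2l; first by rewrite lee_fin.
exact: (Lpw_mem_indic hdot hsep hnz hp hW mD fW).2.
Qed.

End TwoWeights.

Lemma averaging_opnorm_bound W (m : R) : weight dot mu p W -> 0 < m -> exists2 M : R, 0 <= M &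
  forall S, measurable S -> (m%:E <= mu S)%E -> (LpW_opnorm p heta W (averaging dot heta S) <= M%:E)%E.
Proof.
move=> hW m0; have [C C0 [_ hC]] := Lpw_coconstP hdot hsep hnz hp hW.
have [K K0 [_ hK]] := Lpw_constP hdot hsep hnz hp hW.
have mufin := weight_finite_measure hdot hsep hnz hp hW.
have M0 : 0 <= K * (m^-1 * C) by rewrite !mulr_ge0// invr_ge0 ltW.
exists (K * (m^-1 * C)); first exact: M0.
move=> S mS mle.
apply: (LpW_opnorm_le M0) => f fW.
have [[mg gi] gle] := Lpw_mem_indic hdot hsep hnz hp hW mS fW.
have e := Lpw_fineK fW; set N := fine _ in e.
have N0 : 0 <= N by rewrite fine_ge0// Lpw_ge0.
have gN : (Lpw W (restr S f) <= N%:E)%E by rewrite -e.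
have [_ [v fv vle]] := weight_weak_integral hdot hsep hnz hp hW mg N0 gN C0 hC.
set s := fine (mu S); have sE : mu S = s%:E.
  by rewrite fineK// ge0_fin_numE// (finite_measure_le mufin).
have ms : m <= s by rewrite -lee_fin -sE.
have s0 : 0 < s by exact: lt_le_trans ms.
have vE : weak_average dot heta S f = s^-1%:C *: v.
  by apply: weak_averageE => h; rewrite (complex_integral_dot h fv) linearZl_LR.
have cmem : Lpw_mem W (fun=> s^-1%:C *: v).
  by split; [exact: smeas_cst|apply: le_lt_trans (hK _) _; exact: ltry].
have -> : averaging dot heta S f = restr S (fun=> s^-1%:C *: v).
  by apply/funext => z; rewrite /averaging vE.
have [a1 a2] := Lpw_mem_indic hdot hsep hnz hp hW mS cmem; split; first exact: a1.
apply: le_trans a2 _; apply: le_trans (hK _) _.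
rewrite e -EFinM lee_fin -!mulrA ler_wpM2l// hnormZR.
rewrite gtr0_norm ?invr_gt0//; apply: ler_pM; rewrite ?hnorm_ge0 ?invr_ge0 ?(ltW s0)//.
  by rewrite lef_pV2.
by rewrite mulrC.
Qed.

Lemma Bp_av_transfer W V (r : R) : weight dot mu p W -> weight dot mu p V -> 0 < r < 1 ->
  {ae mu, forall z, r < cabs (cplx z) -> W z = V z} ->
  (Bp_av dot p heta V < +oo)%E -> (Bp_av dot p heta W < +oo)%E.
Proof.
move=> hW hV r01 WV BV.
have [c c0 hc] := carleson_measure heta r01.
have [M M0 hM] := averaging_opnorm_bound hW c0.
have p0 : 0 <= p by rewrite ltW// (lt_trans ltr01).
have opn0 U S : (0 <= LpW_opnorm p heta U (averaging dot heta S))%E.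
  by apply: le_ereal_inf_tmp => _ [k [k0 _] <-]; rewrite lee_fin.
apply: (@le_lt_trans _ _ (maxe (Bp_av dot p heta V) (M%:E `^ p)%E)); last first.
  by rewrite gt_max BV poweR_lty// ltry.
have mD : measurable [set z : R * R | r < cabs (cplx z)].
  have := measurableC (measurable_ball r); congr measurable.
  by apply/seteqP; split => z /=; [move/negP; rewrite -ltNge|rewrite ltNge => /negP].
apply: ge_ereal_sup => _ [S hS <-]; rewrite le_max; have [l [I l01 [hI SE]]] := hS.
(* Either the square has measure at least [c], or its side is at most [1 - r] and all its points
   satisfy [|z| > 1 - l >= r]. *)
have [rl|rl] := ltP (1 - r) l.
  apply/orP; right; apply: (ge0_le_poweR p0 (opn0 _ _)).
  by apply: hM; [exact: measurable_carleson|rewrite SE; exact: hc].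
apply/orP; left; apply: (@le_trans _ _ (LpW_opnorm p heta V (averaging dot heta S) `^ p)%E).
  apply: (ge0_le_poweR p0 (opn0 _ _)).
  apply: (averaging_opnorm_agree hW mD WV); rewrite SE => z [rho [u Iu [/andP[qr _] e]]].
  have [a [_ Ia]] := hI; have [t _ ut] := Ia _ Iu; have /andP[_ l1] := l01.
  rewrite /= (@polar_cabs _ rho t); [|by lra|by rewrite ut].
  by lra.
by apply: ereal_sup_ubound; exists S.
Qed.

End Averaging.

(** * Translation to the stated norms and constants, and conclusion *)

Section Transfer.
Context {R : realType} {H : completeNormedModType R[i]}.
Variable dot : {dot H for Num.conj}.
Hypothesis hdot : hilbert_dot dot.
Hypothesis hsep : separable H.
Hypothesis hnz : exists e : H, e != 0.
Variables (p eta : R) (hp : 1 < p) (heta : -1 < eta).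
Local Notation mu := (mu_eta heta).

Lemma operator_weightP W : operator_weight dot p heta W -> weight dot mu p W.
Proof.
move=> [gW mW W1 W2]; split => // e; rewrite /Lpop LpnormE; apply: poweR_lty; [exact: W1|exact: W2].
Qed.

Lemma C_plusE (W : R * R -> H -> H) : C_plus p heta W = Lpw_const mu p W.
Proof.
by congr ereal_sup; apply/seteqP; split => _ [e he <-]; exists e => //; rewrite /Lpop LpnormE.
Qed.

Lemma C_minusE (W : R * R -> H -> H) : C_minus p heta W = Lpw_coconst mu p W.
Proof.
by congr ereal_sup; apply/seteqP; split => _ [e he <-]; exists e => //; rewrite /Lpop LpnormE.
Qed.

Variables W V : R * R -> H -> H.
Hypotheses (hW : weight dot mu p W) (hV : weight dot mu p V).
Variable r : R.
Hypothesis r01 : 0 < r < 1.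
Hypothesis WV : {ae mu, forall z, r < cabs (cplx z) -> W z = V z}.

(** The strict bound [x] yields an admissible constant below it, so the infimum defining the norm
    need not be attained. Both the boundedness statement and the norm estimate follow by choosing
    [x]. *)
Lemma bergman_transfer : exists2 M : R,
  ((2 * (1 - r) `^ (- eta - 2))%:E * C_plus p heta W * C_minus p heta W)%E = M%:E &
  forall T x, bergman_extension p heta V T -> (LpW_opnorm p heta V T < x)%E ->
  exists2 T', bergman_extension p heta W T' & (LpW_opnorm p heta W T' <= x + M%:E)%E.
Proof.
have [C C0 [CE hC]] := Lpw_coconstP hdot hsep hnz hp hW.
have [K K0 [KE hK]] := Lpw_constP hdot hsep hnz hp hW.
exists (2 * (1 - r) `^ (- eta - 2) * K * C); first by rewrite C_plusE C_minusE KE CE.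
move=> T x hT /ereal_inf_ltP[_ [c [c0 Tle] <-] cx].
have WV' : {ae mu, forall z, (~` [set z | cabs (cplx z) <= r]) z -> W z = V z}.
  by apply: filterS WV => z e /negP; rewrite -ltNge.
exists (transfer dot heta r T).
  exact: (transfer_extension hdot hsep hnz hp hW hV r01 C0 K0 hC hK WV' c0 hT Tle).
have M0 : 0 <= 2 * (1 - r) `^ (- eta - 2) * K * C by rewrite !mulr_ge0 ?powR_ge0.
apply: (@le_trans _ _ (c + 2 * (1 - r) `^ (- eta - 2) * K * C)%:E); last first.
  by rewrite EFinD; apply: leeD2r; exact: ltW.
apply: LpW_opnorm_le => [|f fW]; first by rewrite addr_ge0.
rewrite -opprD.
exact: (transfer_le hdot hsep hnz hp hW hV r01 C0 K0 hC hK WV' c0 Tle fW).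
Qed.

Lemma bergman_bounded_transfer : bergman_bounded p heta V -> bergman_bounded p heta W.
Proof.
have [M _ hM] := bergman_transfer.
move=> [T hT /ereal_inf_ltP[_ [c cT <-] _]].
have [|T' hT' le] := hM T (c + 1)%:E hT.
  by apply: (@le_lt_trans _ _ c%:E); [apply: ereal_inf_lbound; exists c|rewrite lte_fin ltrDl].
by exists T' => //; apply: le_lt_trans le _; exact: ltry.
Qed.

Lemma bergman_norm_transfer : (bergman_norm p heta V < +oo)%E ->
  (bergman_norm p heta W <= bergman_norm p heta V +
    (2 * (1 - r) `^ (- eta - 2))%:E * C_plus p heta W * C_minus p heta W)%E.
Proof.
have [M -> hM] := bergman_transfer; move=> Voo.
have V0 : (0 <= bergman_norm p heta V)%E.
  apply: le_ereal_inf_tmp => _ [T hT <-]; apply: le_ereal_inf_tmp => _ [c [c0 _] <-].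
  by rewrite lee_fin.
apply/lee_addgt0Pr => e e0.
have : (bergman_norm p heta V < bergman_norm p heta V + e%:E)%E.
  by rewrite lteDl ?lte_fin// ge0_fin_numE.
move=> /ereal_inf_ltP[_ [T hT <-] Tlt].
have [T' hT' le] := hM _ _ hT Tlt.
apply: (@le_trans _ _ (LpW_opnorm p heta W T')); first by apply: ereal_inf_lbound; exists T'.
by rewrite addeAC.
Qed.

End Transfer.

Theorem proposition5p2 (R : realType) (H : completeNormedModType R[i])
    (dot : {dot H for Num.conj}) (hdot : hilbert_dot dot)
    (hsep : separable H) (hnz : exists e : H, e != 0)
    (p eta : R) (hp : 1 < p) (heta : -1 < eta)
    (W V : R * R -> H -> H)
    (hW : operator_weight dot p heta W) (hV : operator_weight dot p heta V)
    (r : R) (hr : 0 < r < 1)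
    (hWV : {ae mu_eta heta, forall z, r < cabs (cplx z) -> W z = V z}) :
  [/\ bergman_bounded p heta W <-> bergman_bounded p heta V,
      (bergman_norm p heta V < +oo)%E ->
        (bergman_norm p heta W <= bergman_norm p heta V +
           (2 * (1 - r) `^ (- eta - 2))%:E * C_plus p heta W *
             C_minus p heta W)%E &
      (Bp_av dot p heta W < +oo)%E <-> (Bp_av dot p heta V < +oo)%E].
Proof.
have {}hW := operator_weightP hW; have {}hV := operator_weightP hV.
have hVW : {ae mu_eta heta, forall z, r < cabs (cplx z) -> V z = W z}.
  by apply: filterS hWV => z e /e.
split.
- split; first exact: (bergman_bounded_transfer hdot hsep hnz hp hV hW hr hVW).
  exact: (bergman_bounded_transfer hdot hsep hnz hp hW hV hr hWV).
- exact: (bergman_norm_transfer hdot hsep hnz hp hW hV hr hWV).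
- split; first exact: (Bp_av_transfer hdot hsep hnz hp hV hW hr hVW).
  exact: (Bp_av_transfer hdot hsep hnz hp hW hV hr hWV).
Qed.
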